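(* Let $l/k$ be a finite separable field extension of degree $d$ and let $A$ and $A'$ be central simple $l$-algebras. The map $$\mathrm{Hom}_{\mathrm{CSA}(l)}(U(A),U(A'))\longrightarrow\mathrm{Hom}_{\mathrm{CSA}(k)}\big(U(\mathcal{R}^{\mathrm{nc}}_{l/k}(A)),U(\mathcal{R}^{\mathrm{nc}}_{l/k}(A'))\big)$$ induced by the $\otimes$-functor $\mathcal{R}^{\mathrm{nc}}_{l/k}\colon\mathrm{CSA}(l)\to\mathrm{CSA}(k)$ identifies, under the isomorphisms $\mathrm{Hom}(U(B),U(B'))\simeq\mathrm{ind}(B^{\mathrm{op}}\otimes B')\cdot\mathbb{Z}$ (over $l$ and over $k$), with the polynomial map $$\mathrm{ind}(A^{\mathrm{op}}\otimes A')\cdot\mathbb{Z}\longrightarrow\mathrm{ind}\big(\mathcal{R}^{\mathrm{nc}}_{l/k}(A)^{\mathrm{op}}\otimes\mathcal{R}^{\mathrm{nc}}_{l/k}(A')\big)\cdot\mathbb{Z},\qquad n\mapsto n^d.$$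
   Context: Setup: $L/k$ is a finite Galois extension containing $l$, $G=\mathrm{Gal}(L/k)$, $H\subseteq G$ the subgroup with $L^H=l$, $G/H$ the left cosets. For a complex of $l$-vector spaces $V$, $V_L:=V\otimes_lL$; ${}^{\sigma}V_L$ is $V_L$ with $L$ acting through $\sigma^{-1}$, $\lambda\cdot x=\sigma^{-1}(\lambda)x$ (up to canonical isomorphism depending only on $\sigma H$); $G$ acts skew-linearly on $\bigotimes_{\sigma\in G/H}{}^{\sigma}V_L$ (over $L$) by permutation of factors (with Koszul signs), $\rho(\otimes_\sigma v_\sigma)=\otimes_\sigma v_{\rho^{-1}\sigma}$. Put $\mathcal{R}^{\mathrm{nc}}_{l/k}(V)=(\bigotimes_{\sigma\in G/H}{}^{\sigma}V_L)^G$. This is symmetric monoidal, hence sends dg $l$-algebras to dg $k$-algebras; it sends central simple $l$-algebras to central simple $k$-algebras. $\mathrm{NChow}(k)$ is the idempotent completion of the category with objects $U(A)$, $A$ a smooth proper dg $k$-algebra (smooth: $A$ compact in $\mathcal{D}(A^{\mathrm{op}}\otimes A)$; proper: finite-dimensional total cohomology), $\mathrm{Hom}(U(A),U(A'))=K_0(A^{\mathrm{op}}\otimes A')$ ($K_0$ of the compact objects of the derived category of right dg modules), composition by derived tensor product of bimodules, tensor by $\otimes_k$. The functor $\mathcal{R}^{\mathrm{nc}}_{l/k}\colon\mathrm{NChow}(l)\to\mathrm{NChow}(k)$ sends $U(A)$ to $U(\mathcal{R}^{\mathrm{nc}}_{l/k}(A))$ and acts on morphisms by the polynomial map $[M]\mapsto[(\bigotimes_{\sigma\in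 G/H}{}^{\sigma}M_L)^G]$. $\mathrm{CSA}(k)$ is the full symmetric monoidal subcategory of $\mathrm{NChow}(k)$ on the objects $U(A)$ with $A$ a central simple $k$-algebra, and $\mathcal{R}^{\mathrm{nc}}_{l/k}$ restricts to $\mathrm{CSA}(l)\to\mathrm{CSA}(k)$. For central simple algebras $B,B'$ over a field there is a natural isomorphism $\mathrm{ind}(B^{\mathrm{op}}\otimes B')\cdot\mathbb{Z}\simeq K_0(B^{\mathrm{op}}\otimes B')=\mathrm{Hom}(U(B),U(B'))$ sending the generator $\mathrm{ind}(B^{\mathrm{op}}\otimes B')$ to the class of the minimal (right) ideal $I_{B^{\mathrm{op}}\otimes B'}$ of $B^{\mathrm{op}}\otimes B'$; here $\mathrm{ind}$ is the index and $m\mathbb{Z}\subseteq\mathbb{Z}$. Under these isomorphisms composition corresponds to multiplication of integers. *)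

(* Defs.v *)
From HB Require Import structures.
From mathcomp Require Import all_boot all_order all_algebra all_fingroup all_field.
From mathcomp Require Import boolp classical_sets.

Set Implicit Arguments.
Unset Strict Implicit.
Unset Printing Implicit Defensive.

Import GRing.Theory.
Local Open Scope ring_scope.

(** [scalg t] is the free L-module on a finite set I, with the multiplication
  e_a * e_b = \sum_c (sc_mul t a b c) e_c, seen as an algebra over a subfield
  k of L. *)

Record sctable (L : comNzRingType) (I : finType) := ScTable {
  sc_mul : I -> I -> I -> L;
  sc_one : I -> L;
  sc_assoc : forall a b c f,
    \sum_e sc_mul a b e * sc_mul e c f = \sum_e sc_mul b c e * sc_mul a e f;
  sc_mul1l : forall b f, \sum_a sc_one a * sc_mul a b f = (b == f)%:R;
  sc_mul1r : forall a f, \sum_b sc_one b * sc_mul a b f = (a == f)%:R;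
  sc_one_neq0 : exists a, sc_one a != 0 }.

Definition scalg (k : fieldType) (L : fieldExtType k) (I : finType)
  (t : sctable L I) : Type := {ffun I -> L}.

Section ScAlg.
Variables (k : fieldType) (L : fieldExtType k) (I : finType).
Variable t : sctable L I.

HB.instance Definition _ := Vector.copy (scalg t) {ffun I -> L}.

Implicit Types x y z : scalg t.

Definition sc_one_elt : scalg t := [ffun c => sc_one t c].
Definition sc_mul_elt x y : scalg t :=
  [ffun c => \sum_a \sum_b x a * y b * sc_mul t a b c].

Fact sc_mulA : associative sc_mul_elt.
Proof.
move=> x y z; apply/ffunP => f; rewrite !ffunE.
transitivity (\sum_a \sum_b \sum_c
    x a * y b * z c * \sum_e sc_mul t b c e * sc_mul t a e f).
  apply: eq_bigr => a _.
  transitivity (\sum_e \sum_b \sum_c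
      x a * (y b * z c * sc_mul t b c e) * sc_mul t a e f).
    apply: eq_bigr => e _; rewrite ffunE mulr_sumr mulr_suml.
    by apply: eq_bigr => b _; rewrite mulr_sumr mulr_suml.
  rewrite exchange_big; apply: eq_bigr => b _; rewrite exchange_big.
  apply: eq_bigr => c _; rewrite mulr_sumr; apply: eq_bigr => e _.
  by rewrite !mulrA.
transitivity (\sum_e \sum_c \sum_a \sum_b
    x a * y b * z c * (sc_mul t a b e * sc_mul t e c f)); last first.
  apply: eq_bigr => e _; apply: eq_bigr => c _; rewrite ffunE 2!mulr_suml.
  apply: eq_bigr => a _; rewrite 2!mulr_suml; apply: eq_bigr => b _.
  by rewrite !mulrA; congr (_ * _); rewrite -!mulrA; congr (_ * (_ * _)); rewrite mulrC.
under [RHS]eq_bigr => e _ do rewrite exchange_big /=.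
rewrite [RHS]exchange_big /=; apply: eq_bigr => a _.
transitivity (\sum_e \sum_b \sum_c
    x a * y b * z c * (sc_mul t a b e * sc_mul t e c f)); last first.
  by apply: eq_bigr => e _; rewrite exchange_big.
rewrite [RHS]exchange_big /=; apply: eq_bigr => b _.
rewrite [RHS]exchange_big /=; apply: eq_bigr => c _.
by rewrite -mulr_sumr sc_assoc.
Qed.

Fact sc_mul1e : left_id sc_one_elt sc_mul_elt.
Proof.
move=> x; apply/ffunP => f; rewrite ffunE exchange_big /=.
transitivity (\sum_b x b * (b == f)%:R); last first.
  rewrite (bigD1 f) //= eqxx mulr1 big1 ?addr0 // => b /negPf->.
  by rewrite mulr0.
apply: eq_bigr => b _; rewrite -(sc_mul1l t) mulr_sumr.
by apply: eq_bigr => a _; rewrite ffunE mulrCA mulrA.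
Qed.

Fact sc_mule1 : right_id sc_one_elt sc_mul_elt.
Proof.
move=> x; apply/ffunP => f; rewrite ffunE.
transitivity (\sum_a x a * (a == f)%:R); last first.
  rewrite (bigD1 f) //= eqxx mulr1 big1 ?addr0 // => b /negPf->.
  by rewrite mulr0.
apply: eq_bigr => b _; rewrite -(sc_mul1r t) mulr_sumr.
by apply: eq_bigr => a _; rewrite ffunE mulrA.
Qed.

Fact sc_mulDl : left_distributive sc_mul_elt +%R.
Proof.
move=> x y z; apply/ffunP => f; rewrite !ffunE -big_split /=.
apply: eq_bigr => a _; rewrite -big_split /=; apply: eq_bigr => b _.
by rewrite ffunE !mulrDl.
Qed.

Fact sc_mulDr : right_distributive sc_mul_elt +%R.
Proof.
move=> x y z; apply/ffunP => f; rewrite !ffunE -big_split /=.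
apply: eq_bigr => a _; rewrite -big_split /=; apply: eq_bigr => b _.
by rewrite ffunE mulrDr !mulrDl.
Qed.

Fact sc_one_elt_neq0 : sc_one_elt != 0.
Proof.
have [a a0] := sc_one_neq0 t; apply: contraNneq a0 => /ffunP/(_ a).
by rewrite !ffunE => ->.
Qed.

HB.instance Definition _ := GRing.Zmodule_isNzRing.Build (scalg t)
  sc_mulA sc_mul1e sc_mule1 sc_mulDl sc_mulDr sc_one_elt_neq0.

Fact sc_scaleAl (a : k) x y : a *: (x * y) = (a *: x) * y.
Proof.
apply/ffunP => f; rewrite !ffunE scaler_sumr; apply: eq_bigr => i _.
rewrite scaler_sumr; apply: eq_bigr => j _.
by rewrite ffunE -!scalerAl.
Qed.
HB.instance Definition _ :=
  GRing.Lmodule_isLalgebra.Build k (scalg t) sc_scaleAl.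

Fact sc_scaleAr (a : k) x y : a *: (x * y) = x * (a *: y).
Proof.
apply/ffunP => f; rewrite !ffunE scaler_sumr; apply: eq_bigr => i _.
rewrite scaler_sumr; apply: eq_bigr => j _.
by rewrite ffunE -scalerAr -!scalerAl.
Qed.
HB.instance Definition _ :=
  GRing.Lalgebra_isAlgebra.Build k (scalg t) sc_scaleAr.
HB.instance Definition _ := Algebra_isFalgebra.Build k (scalg t).

Lemma scalg_mulE x y c :
  (x * y) c = \sum_a \sum_b x a * y b * sc_mul t a b c.
Proof. by rewrite [LHS]ffunE. Qed.

Lemma scalg_oneE c : (1 : scalg t) c = sc_one t c.
Proof. by rewrite [LHS]ffunE. Qed.

End ScAlg.

Section Tables.
Variables (F : fieldType).

Definition crd (A : falgType F) (i : 'I_(\dim {:A})) (x : A) : F :=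
  coord (vbasis {:A}) i x.
Definition bas (A : falgType F) (i : 'I_(\dim {:A})) : A := (vbasis {:A})`_i.

Lemma crd_expand (A : falgType F) (x : A) : x = \sum_i crd i x *: bas i.
Proof. exact: coord_vbasis (memvf x). Qed.

Lemma crd_bas (A : falgType F) (i j : 'I_(\dim {:A})) :
  crd i (bas j) = (j == i)%:R.
Proof.
rewrite /crd /bas coord_free; first by rewrite eq_sym.
exact: basis_free (vbasisP _).
Qed.

Lemma crd_mul (A : falgType F) (x y : A) i :
  crd i (x * y) = \sum_a \sum_b crd a x * crd b y * crd i (bas a * bas b).
Proof.
rewrite {1}(crd_expand x) mulr_suml /crd linear_sum; apply: eq_bigr => a _.
rewrite {1}(crd_expand y) mulr_sumr linear_sum; apply: eq_bigr => b _.
by rewrite -scalerAl -scalerAr !linearZ /= mulrA.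
Qed.

Fact alg_assoc (A : falgType F) (a b c f : 'I_(\dim {:A})) :
  \sum_e crd e (bas a * bas b) * crd f (bas e * bas c) =
  \sum_e crd e (bas b * bas c) * crd f (bas a * bas e).
Proof.
transitivity (crd f (bas a * bas b * bas c)).
  rewrite {2}(crd_expand (bas a * bas b)) mulr_suml /crd linear_sum.
  by apply: eq_bigr => e _; rewrite -scalerAl linearZ.
rewrite -mulrA {1}(crd_expand (bas b * bas c)) mulr_sumr /crd linear_sum.
by apply: eq_bigr => e _; rewrite -scalerAr linearZ.
Qed.

Fact alg_1l (A : falgType F) (b f : 'I_(\dim {:A})) :
  \sum_a crd a 1 * crd f (bas a * bas b) = (b == f)%:R.
Proof.
rewrite -(crd_bas f b) -[in RHS](mul1r (bas b)) [in RHS](crd_expand 1).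
rewrite mulr_suml [in RHS]/crd linear_sum.
by apply: eq_bigr => e _; rewrite -scalerAl linearZ.
Qed.

Fact alg_1r (A : falgType F) (a f : 'I_(\dim {:A})) :
  \sum_b crd b 1 * crd f (bas a * bas b) = (a == f)%:R.
Proof.
rewrite -(crd_bas f a) -[in RHS](mulr1 (bas a)) [in RHS](crd_expand 1).
rewrite mulr_sumr [in RHS]/crd linear_sum.
by apply: eq_bigr => e _; rewrite -scalerAr linearZ.
Qed.

Fact alg_1_neq0 (A : falgType F) : exists a : 'I_(\dim {:A}), crd a 1 != 0.
Proof.
apply: contrapT => /forallNP h; have := oner_neq0 A; rewrite (crd_expand 1).
rewrite big1 ?eqxx // => i _; have /negP := h i; rewrite negbK => /eqP ->.
by rewrite scale0r.
Qed.

Definition alg_table (A : falgType F) : sctable F 'I_(\dim {:A}) :=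
  ScTable (@alg_assoc A) (@alg_1l A) (@alg_1r A) (@alg_1_neq0 A).

End Tables.

Lemma sum_prod (D : comNzRingType) (I J : finType) (f : I -> D) (g : J -> D) :
  \sum_(e : I * J) f e.1 * g e.2 = (\sum_i f i) * (\sum_j g j).
Proof.
rewrite -(pair_bigA _ (fun i j => f i * g j)) mulr_suml /=.
by apply: eq_bigr => i _; rewrite mulr_sumr.
Qed.

Section TensorTable.
Variables (F : comNzRingType).

Fact op_assoc (I : finType) (t : sctable F I) a b c f :
  \sum_e sc_mul t b a e * sc_mul t c e f =
  \sum_e sc_mul t c b e * sc_mul t e a f.
Proof. by rewrite sc_assoc. Qed.

Definition op_table (I : finType) (t : sctable F I) : sctable F I :=
  @ScTable F I (fun a b c => sc_mul t b a c) (sc_one t) (op_assoc t)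
    (sc_mul1r t) (sc_mul1l t) (sc_one_neq0 t).

Variables (D : idomainType) (I J : finType) (s : sctable D I) (t : sctable D J).

Let m (a b c : I * J) := sc_mul s a.1 b.1 c.1 * sc_mul t a.2 b.2 c.2.
Let u (a : I * J) := sc_one s a.1 * sc_one t a.2.

Fact tens_assoc a b c f :
  \sum_e m a b e * m e c f = \sum_e m b c e * m a e f.
Proof.
rewrite (eq_bigr (fun e => (sc_mul s a.1 b.1 e.1 * sc_mul s e.1 c.1 f.1) *
  (sc_mul t a.2 b.2 e.2 * sc_mul t e.2 c.2 f.2))); last first.
  by move=> e _; rewrite /m mulrACA.
rewrite (sum_prod (fun e => _ e * _ e _ _) (fun e => _ e * _ e _ _)).
rewrite !sc_assoc -sum_prod; apply: eq_bigr => e _.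
by rewrite /m mulrACA.
Qed.

Fact tens_1l b f : \sum_a u a * m a b f = (b == f)%:R.
Proof.
rewrite (eq_bigr (fun e => (sc_one s e.1 * sc_mul s e.1 b.1 f.1) *
  (sc_one t e.2 * sc_mul t e.2 b.2 f.2))); last first.
  by move=> e _; rewrite /m mulrACA.
rewrite (sum_prod (fun e => _ e * _ e _ _) (fun e => _ e * _ e _ _)).
by rewrite !sc_mul1l -natrM mulnb.
Qed.

Fact tens_1r a f : \sum_b u b * m a b f = (a == f)%:R.
Proof.
rewrite (eq_bigr (fun e => (sc_one s e.1 * sc_mul s a.1 e.1 f.1) *
  (sc_one t e.2 * sc_mul t a.2 e.2 f.2))); last first.
  by move=> e _; rewrite /m mulrACA.
rewrite (sum_prod (fun e => _ e * _ _ e _) (fun e => _ e * _ _ e _)).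
by rewrite !sc_mul1r -natrM mulnb.
Qed.

Fact tens_1_neq0 : exists a, u a != 0.
Proof.
have [i i0] := sc_one_neq0 s; have [j j0] := sc_one_neq0 t.
by exists (i, j); rewrite mulf_neq0.
Qed.

Definition tens_table : sctable D (I * J)%type :=
  ScTable tens_assoc tens_1l tens_1r tens_1_neq0.

End TensorTable.

(* A^op \otimes_F B *)
Definition optens (F : fieldType) (A B : falgType F) : falgType F :=
  scalg (k := F) (L := F^o)
    (tens_table (op_table (alg_table A)) (alg_table B)).

Definition optens_pure (F : fieldType) (A B : falgType F) (x : A) (y : B) :
    optens A B :=
  ([ffun ij => crd ij.1 x * crd ij.2 y] : {ffun _ -> F^o}).

Lemma optens_pureM (F : fieldType) (A B : falgType F) (x x' : A) (y y' : B) :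
  optens_pure x y * optens_pure x' y' = optens_pure (x' * x) (y * y').
Proof.
apply/ffunP => -[r s]; rewrite scalg_mulE ffunE /= !crd_mul.
rewrite [X in _ = X * _]exchange_big /= -(sum_prod (fun i => \sum_p crd p x' * crd i x * crd r (bas p * bas i))
  (fun j => \sum_q crd j y * crd q y' * crd s (bas j * bas q))).
apply: eq_bigr => -[i j] _ /=; rewrite -sum_prod.
apply: eq_bigr => -[p q] _ /=; rewrite !ffunE /=.
rewrite [in RHS]mulrACA; congr (_ * _).
by rewrite [crd p x' * crd i x]mulrC; exact: mulrACA.
Qed.

Lemma optens_pure1 (F : fieldType) (A B : falgType F) :
  optens_pure 1 1 = 1 :> optens A B.
Proof. by apply/ffunP => ij; apply: etrans (ffunE _ _) _; rewrite scalg_oneE. Qed.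

(** Elements of [gal_of {:L}] are multiplied in the order of application,
  (x * y)%g a = y (x a), so the left coset \sigma H of the automorphisms
  \sigma \circ h is the right coset H :* \sigma, and left translation by \rho
  is c |-> c :* \rho. *)

Section Galois.
Variables (k : fieldType) (l : fieldExtType k) (L : splittingFieldType k).
Variable iota : 'AHom(l, L).

Notation G := (gal_of {:L}).

Definition galH : {group G} := 'Gal({:L} / limg iota)%G.

Definition cosetT : Type := {c : {set G} | c \in rcosets galH [set: G]}.
HB.instance Definition _ := Finite.on cosetT.

Fact coset_mul_subproof (c : cosetT) (rho : G) :
  (val c :* rho)%g \in rcosets galH [set: G].
Proof.
case: c => c /= /rcosetsP[s _ ->].
by rewrite -rcosetM; apply/rcosetsP; exists (s * rho)%g; rewrite ?inE.
Qed.
Definition coset_mul (c : cosetT) (rho : G) : cosetT :=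
  exist _ (val c :* rho)%g (coset_mul_subproof c rho).

(* The k-embedding a |-> \sigma(a) of l in L; it depends only on \sigma H. *)
Definition emb (c : cosetT) (a : l) : L := (repr (val c) : G) (iota a).

Lemma embE (s : G) (hs : (galH :* s)%g \in rcosets galH [set: G]) (a : l) :
  emb (exist _ (galH :* s)%g hs) a = s (iota a).
Proof.
rewrite /emb /=; have /rcosetP[h Hh ->] := mem_repr_rcoset galH s.
rewrite galM ?memvf //; congr (s _); apply: (fixed_gal _ Hh); first exact: subvf.
by rewrite memv_img ?memvf.
Qed.

Lemma emb_mul (c : cosetT) (rho : G) (a : l) :
  emb (coset_mul c rho) a = rho (emb c a).
Proof.
case: c => c hc; have /rcosetsP[s _ ec] := hc; subst c.
rewrite embE /coset_mul /=; move: (coset_mul_subproof _ _) => /=.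
by rewrite -rcosetM => hs; rewrite embE galM ?memvf.
Qed.

Fact emb_is_zmod_morphism c : zmod_morphism (emb c).
Proof. by move=> x y; rewrite /emb !rmorphB. Qed.
Fact emb_is_monoid_morphism c : monoid_morphism (emb c).
Proof. by split=> [|x y]; rewrite /emb ?rmorph1 // !rmorphM. Qed.
HB.instance Definition _ c :=
  GRing.isZmodMorphism.Build l L (emb c) (emb_is_zmod_morphism c).
HB.instance Definition _ c :=
  GRing.isMonoidMorphism.Build l L (emb c) (emb_is_monoid_morphism c).

(* (\rho v)_\sigma = v_(\rho^-1 \sigma) *)
Definition permute (V : Type) (rho : G) (v : {ffun cosetT -> V}) :
  {ffun cosetT -> V} := [ffun c => v (coset_mul c rho^-1%g)].

(** ^\sigma A_L is identified with A \otimes_(l, \sigma) L as explained before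
  [multisemilinear] below. If (e_i) is the chosen basis of A, then the elements
  e_f = \otimes_\sigma e_(f \sigma) form an L-basis of
  \otimes_(\sigma in G/H) ^\sigma A_L, indexed by the functions f on G/H. *)

Section WeilTable.
Variables (I : finType) (t : sctable l I).

Let m (a b c : {ffun cosetT -> I}) : L :=
  \prod_s emb s (sc_mul t (a s) (b s) (c s)).
Let u (a : {ffun cosetT -> I}) : L := \prod_s emb s (sc_one t (a s)).

Fact weil_assoc a b c f :
  \sum_e m a b e * m e c f = \sum_e m b c e * m a e f.
Proof.
transitivity (\prod_s \sum_e
    emb s (sc_mul t (a s) (b s) e * sc_mul t e (c s) (f s))).
  rewrite bigA_distr_bigA; apply: eq_bigr => e _; rewrite -big_split /=.
  by apply: eq_bigr => s _; rewrite rmorphM.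
transitivity (\prod_s \sum_e
    emb s (sc_mul t (b s) (c s) e * sc_mul t (a s) e (f s))).
  by apply: eq_bigr => s _; rewrite -!rmorph_sum sc_assoc.
rewrite bigA_distr_bigA; apply: eq_bigr => e _; rewrite -big_split /=.
by apply: eq_bigr => s _; rewrite rmorphM.
Qed.

Let prod_eq (b f : {ffun cosetT -> I}) :
  \prod_s emb s (b s == f s)%:R = (b == f)%:R.
Proof.
have [->|neq] := eqVneq b f.
  by rewrite big1 // => s _; rewrite eqxx rmorph1.
have /existsP[s bfs] : [exists s, b s != f s].
  apply: contraNT neq; rewrite negb_exists => /forallP h.
  by apply/eqP/ffunP => s; apply/eqP; rewrite -[_ == _]negbK.
by rewrite (bigD1 s) //= (negPf bfs) rmorph0 mul0r.
Qed.

Fact weil_1l b f : \sum_a u a * m a b f = (b == f)%:R.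
Proof.
rewrite -prod_eq; transitivity (\prod_s \sum_e
    emb s (sc_one t e * sc_mul t e (b s) (f s))); last first.
  by apply: eq_bigr => s _; rewrite -rmorph_sum sc_mul1l.
rewrite bigA_distr_bigA; apply: eq_bigr => e _; rewrite -big_split /=.
by apply: eq_bigr => s _; rewrite rmorphM.
Qed.

Fact weil_1r a f : \sum_b u b * m a b f = (a == f)%:R.
Proof.
rewrite -prod_eq; transitivity (\prod_s \sum_e
    emb s (sc_one t e * sc_mul t (a s) e (f s))); last first.
  by apply: eq_bigr => s _; rewrite -rmorph_sum sc_mul1r.
rewrite bigA_distr_bigA; apply: eq_bigr => e _; rewrite -big_split /=.
by apply: eq_bigr => s _; rewrite rmorphM.
Qed.

Fact weil_1_neq0 : exists a, u a != 0.
Proof.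
have [i i0] := sc_one_neq0 t; exists [ffun => i].
by apply/prodf_neq0 => s _; rewrite ffunE fmorph_eq0.
Qed.

Definition weil_table : sctable L {ffun cosetT -> I} :=
  ScTable weil_assoc weil_1l weil_1r weil_1_neq0.

End WeilTable.

Section WeilAlg.
Variable A : falgType l.

(* \otimes_(\sigma in G/H) ^\sigma A_L, as a k-algebra *)
Definition tensA : falgType k := scalg (k := k) (weil_table (alg_table A)).

Definition tensA_pure (a : {ffun cosetT -> A}) : tensA :=
  ([ffun f : {ffun _ -> _} => \prod_s emb s (crd (f s) (a s))] : {ffun _ -> L}).

Lemma tensA_pureM a b :
  tensA_pure a * tensA_pure b = tensA_pure [ffun s => a s * b s].
Proof.
apply/ffunP => f; rewrite scalg_mulE ffunE.
transitivity (\prod_s \sum_i \sum_j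
    emb s (crd i (a s) * crd j (b s) * crd (f s) (bas i * bas j))).
  rewrite bigA_distr_bigA; apply: eq_bigr => g _.
  rewrite bigA_distr_bigA; apply: eq_bigr => h _.
  rewrite !ffunE -!big_split; apply: eq_bigr => s _ /=.
  by rewrite !rmorphM.
apply: eq_bigr => s _; rewrite ffunE crd_mul rmorph_sum.
by apply: eq_bigr => i _; rewrite rmorph_sum.
Qed.

Lemma tensA_pure1 : tensA_pure [ffun => 1] = 1.
Proof.
apply/ffunP => f; rewrite scalg_oneE ffunE /=.
by apply: eq_bigr => s _; rewrite ffunE.
Qed.

(* The skew-linear action of \rho, for which \rho(x e_f) = \rho(x) e_(\rho f). *)
Definition tensA_gal (rho : G) (t : tensA) : tensA :=
  ([ffun f => rho (t (permute rho^-1%g f))] : {ffun _ -> L}).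

Lemma coset_mulK rho : cancel (coset_mul^~ rho) (coset_mul^~ rho^-1%g).
Proof. by move=> c; apply: val_inj; rewrite /= -rcosetM mulgV rcoset1. Qed.

Lemma coset_mulVK rho : cancel (coset_mul^~ rho^-1%g) (coset_mul^~ rho).
Proof. by move=> c; apply: val_inj; rewrite /= -rcosetM mulVg rcoset1. Qed.

Lemma permuteK (V : Type) rho : cancel (@permute V rho) (permute rho^-1%g).
Proof. by move=> v; apply/ffunP => c; rewrite !ffunE invgK coset_mulK. Qed.

Lemma permuteVK (V : Type) rho : cancel (@permute V rho^-1%g) (permute rho).
Proof. by move=> v; apply/ffunP => c; rewrite !ffunE invgK coset_mulVK. Qed.

Lemma tensA_gal_pure rho a :
  tensA_gal rho (tensA_pure a) = tensA_pure (permute rho a).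
Proof.
apply/ffunP => f; rewrite !ffunE rmorph_prod /=.
rewrite [RHS](reindex_inj (can_inj (coset_mulK rho))) /=.
by apply: eq_bigr => s _; rewrite emb_mul !ffunE invgK coset_mulK.
Qed.

Fact tensA_gal_is_linear rho : linear (tensA_gal rho).
Proof. by move=> a x y; apply/ffunP => f; rewrite !ffunE linearP. Qed.
HB.instance Definition _ rho := GRing.isSemilinear.Build k tensA tensA _
  (tensA_gal rho) (GRing.semilinear_linear (tensA_gal_is_linear rho)).

Lemma tensA_galM rho x y :
  tensA_gal rho (x * y) = tensA_gal rho x * tensA_gal rho y.
Proof.
apply/ffunP => f; rewrite ffunE !scalg_mulE rmorph_sum /=.
rewrite [RHS](reindex_inj (can_inj (permuteK rho))) /=.
apply: eq_bigr => a _; rewrite rmorph_sum.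
rewrite [RHS](reindex_inj (can_inj (permuteK rho))) /=.
apply: eq_bigr => b _; rewrite 2!rmorphM rmorph_prod /= 2!ffunE !permuteK.
congr (_ * _); rewrite [RHS](reindex_inj (can_inj (coset_mulK rho))) /=.
by apply: eq_bigr => s _; rewrite emb_mul !ffunE invgK coset_mulK.
Qed.

Lemma tensA_gal1 rho : tensA_gal rho 1 = 1.
Proof.
rewrite -tensA_pure1 tensA_gal_pure; congr tensA_pure.
by apply/ffunP => c; rewrite !ffunE.
Qed.

Definition tensA_inv : {vspace tensA} :=
  (\bigcap_(rho : G) fixedSpace (linfun (tensA_gal rho)))%VS.

Lemma tensA_invP (t : tensA) :
  reflect (forall rho, tensA_gal rho t = t) (t \in tensA_inv).
Proof.
rewrite memvE; apply: (iffP subv_bigcapP) => h rho.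
  by have := h rho isT; rewrite -memvE => /fixedSpaceP; rewrite lfunE.
by move=> _; rewrite -memvE; apply/fixedSpaceP; rewrite lfunE; exact: h.
Qed.

Fact tensA_inv_is_aspace : is_aspace tensA_inv.
Proof.
rewrite /is_aspace has_algid1; last by apply/tensA_invP => rho; exact: tensA_gal1.
apply/prodvP => x y /tensA_invP hx /tensA_invP hy; apply/tensA_invP => rho.
by rewrite tensA_galM hx hy.
Qed.
Definition tensA_inv_aspace : {aspace tensA} := ASpace tensA_inv_is_aspace.

(* R^nc_(l/k)(A) = (\otimes_(\sigma in G/H) ^\sigma A_L)^G *)
Definition Rnc : falgType k := subvs_of tensA_inv_aspace.

End WeilAlg.
End Galois.

Section CSA.
Variables (F : fieldType).

Definition central_simple (B : falgType F) : Prop :=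
  'Z({:B})%VS = 1%VS /\
  forall U : {vspace B}, ({:B} * U <= U)%VS -> (U * {:B} <= U)%VS ->
    U = 0%VS \/ U = {:B}%VS.

(* B is isomorphic to the matrix algebra M_(n+1)(D) over a division algebra D
   with \dim_F D = e^2. *)
Definition is_index (B : falgType F) (e : nat) : Prop :=
  exists (D : falgType F) (n : nat) (f : {rmorphism B -> 'M[D]_n.+1}),
    [/\ forall x : D, x != 0 -> x \is a GRing.unit,
        bijective f,
        forall a : F, f a%:A = (a%:A : D)%:M
      & \dim {:D} = (e ^ 2)%N].

(* The index of a central simple algebra (0 if there is none). *)
Definition ind (B : falgType F) : nat := xget 0%N [set e | is_index B e].

Definition minimal_right_ideal (B : falgType F) (U : {vspace B}) : Prop :=
  [/\ (U * {:B} <= U)%VS, U != 0%VS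
    & forall V : {vspace B}, (V * {:B} <= V)%VS -> (V <= U)%VS ->
        V = 0%VS \/ V = U].

Definition rideal (B : falgType F) (U : {vspace B})
  (hU : (U * {:B} <= U)%VS) : Type := subvs_of U.

Section Rideal.
Variables (B : falgType F) (U : {vspace B}) (hU : (U * {:B} <= U)%VS).
HB.instance Definition _ := GRing.Zmodule.copy (rideal hU) (subvs_of U).

Fact rideal_mul_subproof (b : B) (u : rideal hU) : vsval u * b \in U.
Proof. by apply: (subvP hU); rewrite memv_mul ?memvf // subvsP. Qed.
Definition rideal_mul (b : B^c) (u : rideal hU) : rideal hU :=
  Subvs (rideal_mul_subproof b u).

Fact rideal_mulA (a b : B^c) u :
  rideal_mul a (rideal_mul b u) = rideal_mul (a * b) u.
Proof. by apply: val_inj; rewrite /= -mulrA. Qed.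
Fact rideal_mul1 : left_id 1 rideal_mul.
Proof. by move=> u; apply: val_inj; rewrite /= mulr1. Qed.
Fact rideal_mulDr : right_distributive rideal_mul +%R.
Proof. by move=> b u v; apply: val_inj; rewrite /= mulrDl. Qed.
Fact rideal_mulDl u : {morph rideal_mul^~ u : a b / a + b}.
Proof. by move=> a b; apply: val_inj; rewrite /= mulrDr. Qed.
HB.instance Definition _ := GRing.Zmodule_isLmodule.Build B^c (rideal hU)
  rideal_mulA rideal_mul1 rideal_mulDr rideal_mulDl.
End Rideal.
End CSA.

(** The algebra C is placed in degree 0. A right C-module is a left module over
  the converse ring C^c. The grading is given by the projections [dg_comp i] on
  the homogeneous components. *)

Section DG.
Variable C : nzRingType.

Record dgmod := DGMod {
  dg_mod :> lmodType C^c;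
  dg_comp : int -> {linear dg_mod -> dg_mod};
  dg_dif : {linear dg_mod -> dg_mod};
  dg_comp_comp : forall i j x,
    dg_comp i (dg_comp j x) = if i == j then dg_comp j x else 0;
  dg_comp_sum : forall x, exists s : seq int,
    uniq s /\ x = \sum_(i <- s) dg_comp i x;
  dg_dif_deg : forall i x, dg_comp (i + 1) (dg_dif x) = dg_dif (dg_comp i x);
  dg_dif_dif : forall x, dg_dif (dg_dif x) = 0 }.

Definition homogeneous (X : dgmod) (i : int) (x : X) : Prop := dg_comp X i x = x.

Section Deg0.
Variable M : lmodType C^c.
Definition deg0_comp (i : int) : {linear M -> M} :=
  if i == 0 then (idfun : {linear M -> M}) else (\0 : {linear M -> M}).
Fact deg0_comp_comp i j x :
  deg0_comp i (deg0_comp j x) = if i == j then deg0_comp j x else 0.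
Proof.
rewrite /deg0_comp; have [->|ij] := eqVneq i j; first by case: (j == 0).
have [i0|//] := eqVneq i 0; have [j0|//] := eqVneq j 0.
by rewrite i0 j0 eqxx in ij.
Qed.
Fact deg0_comp_sum x : exists s : seq int,
  uniq s /\ x = \sum_(i <- s) deg0_comp i x.
Proof. by exists [:: 0]; rewrite big_seq1. Qed.
Fact deg0_dif_deg i x :
  deg0_comp (i + 1) ((\0 : {linear M -> M}) x) =
  (\0 : {linear M -> M}) (deg0_comp i x).
Proof. by rewrite /= linear0. Qed.
Definition dg_deg0 : dgmod :=
  DGMod deg0_comp_comp deg0_comp_sum deg0_dif_deg (fun=> erefl).
End Deg0.

Definition is_dghom (X Y : dgmod) (f : {linear X -> Y}) : Prop :=
  (forall i x, f (dg_comp X i x) = dg_comp Y i (f x)) /\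
  (forall x, f (dg_dif X x) = dg_dif Y (f x)).

(* bijectivity on Ker d / Im d *)
Definition is_qis (X Y : dgmod) (f : {linear X -> Y}) : Prop :=
  [/\ is_dghom f,
      forall x, dg_dif X x = 0 -> (exists y, f x = dg_dif Y y) ->
        exists x', x = dg_dif X x'
    & forall y, dg_dif Y y = 0 ->
        exists2 x, dg_dif X x = 0 & exists y', f x - y = dg_dif Y y'].

Definition homotopic (X Y : dgmod) (f g : {linear X -> Y}) : Prop :=
  exists h : {linear X -> Y},
    (forall i x, h (dg_comp X i x) = dg_comp Y (i - 1) (h x)) /\
    (forall x, f x - g x = dg_dif Y (h x) + h (dg_dif X x)).

(** Morphisms X -> Y of D(C) are right fractions X <-s- X' -f-> Y with s a
  quasi-isomorphism, modulo [frac_eq], i.e. equality after pulling back to a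
  common denominator in the homotopy category. *)

Definition is_frac (X Y X' : dgmod) (s : {linear X' -> X})
  (f : {linear X' -> Y}) : Prop := is_qis s /\ is_dghom f.

Definition frac_eq (X Y X1 X2 : dgmod)
    (s1 : {linear X1 -> X}) (f1 : {linear X1 -> Y})
    (s2 : {linear X2 -> X}) (f2 : {linear X2 -> Y}) : Prop :=
  exists (Z : dgmod) (a : {linear Z -> X1}) (b : {linear Z -> X2}),
    [/\ is_dghom a, is_dghom b, is_qis (s1 \o a : {linear Z -> X}),
        homotopic (s1 \o a : {linear Z -> X}) (s2 \o b : {linear Z -> X})
      & homotopic (f1 \o a : {linear Z -> Y}) (f2 \o b : {linear Z -> Y})].

Definition is_dsum (I : choiceType) (Y_ : I -> dgmod) (Y : dgmod)
    (inj : forall i, {linear Y_ i -> Y}) : Prop :=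
  [/\ forall i, is_dghom (inj i),
      forall y, exists (s : seq I) (x : forall i, Y_ i),
        uniq s /\ y = \sum_(i <- s) inj i (x i)
    & forall (s : seq I) (x : forall i, Y_ i), uniq s ->
        \sum_(i <- s) inj i (x i) = 0 -> {in s, forall i, x i = 0}].

(* X is compact: \bigoplus_i Hom(X, Y_i) -> Hom(X, \bigoplus_i Y_i) is
   bijective in D(C) for all families. As finitely many fractions have a common
   denominator, an element of the source is a family of fractions
   X <-t- X' -g_i-> Y_i, i in a finite set s; its image is the fraction
   X <-t- X' -> Y whose numerator is the sum of the inj_i g_i. *)
Definition compact (X : dgmod) : Prop :=
  forall (I : choiceType) (Y_ : I -> dgmod) (Y : dgmod)
      (inj : forall i, {linear Y_ i -> Y}), is_dsum inj ->
    (forall (X' : dgmod) (t : {linear X' -> X}) (f : {linear X' -> Y}),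
       is_frac t f ->
       exists (s : seq I) (X'' : dgmod) (t' : {linear X'' -> X})
         (g : forall i, {linear X'' -> Y_ i}) (f' : {linear X'' -> Y}),
         [/\ uniq s, forall i, is_frac t' (g i),
             forall x, f' x = \sum_(i <- s) inj i (g i x)
           & frac_eq t f t' f']) /\
    (forall (s : seq I) (X' : dgmod) (t : {linear X' -> X})
        (g : forall i, {linear X' -> Y_ i}) (f : {linear X' -> Y}),
       uniq s -> (forall i, is_frac t (g i)) ->
       (forall x, f x = \sum_(i <- s) inj i (g i x)) ->
       frac_eq t f t (\0 : {linear X' -> Y}) ->
       {in s, forall i, frac_eq t (g i) t (\0 : {linear X' -> Y_ i})}).

(** K_0 is the abelian group of formal expressions [K0] modulo [K0_eq]. Every
  distinguished triangle of D(C) is isomorphic to the one of a short exact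
  sequence of dg modules, and every isomorphism of D(C) is a fraction of
  quasi-isomorphisms; hence the last two relations are those given by the
  distinguished triangles of compact objects. *)

Inductive K0 : Type :=
| K0_class (X : dgmod) of compact X
| K0_zero
| K0_opp of K0
| K0_add of K0 & K0.

Inductive K0_eq : K0 -> K0 -> Prop :=
| K0_refl x : K0_eq x x
| K0_sym x y : K0_eq x y -> K0_eq y x
| K0_trans x y z : K0_eq x y -> K0_eq y z -> K0_eq x z
| K0_add_congr x x' y y' :
    K0_eq x x' -> K0_eq y y' -> K0_eq (K0_add x y) (K0_add x' y')
| K0_opp_congr x x' : K0_eq x x' -> K0_eq (K0_opp x) (K0_opp x')
| K0_addA x y z : K0_eq (K0_add x (K0_add y z)) (K0_add (K0_add x y) z)
| K0_addC x y : K0_eq (K0_add x y) (K0_add y x)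
| K0_add0 x : K0_eq (K0_add K0_zero x) x
| K0_addN x : K0_eq (K0_add (K0_opp x) x) K0_zero
| K0_qis X Y (cX : compact X) (cY : compact Y) (f : {linear X -> Y}) :
    is_qis f -> K0_eq (K0_class cX) (K0_class cY)
| K0_ses X Y Z (cX : compact X) (cY : compact Y) (cZ : compact Z)
    (f : {linear X -> Y}) (g : {linear Y -> Z}) :
    is_dghom f -> is_dghom g -> injective f -> (forall z, exists y, g y = z) ->
    (forall y, g y = 0 <-> exists x, y = f x) ->
    K0_eq (K0_class cY) (K0_add (K0_class cX) (K0_class cZ)).

Definition has_class (X : dgmod) (a : K0) : Prop :=
  exists cX : compact X, K0_eq (K0_class cX) a.

End DG.

(* Hom(U(A), U(A')), both in NChow and in its full subcategory CSA *)
Definition HomU (F : fieldType) (A A' : falgType F) : Type :=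
  K0 (optens A A').

(* phi, restricted to the multiples of ind C, is an isomorphism from
   ind(C) * Z to K_0(C) sending ind C to the class of the minimal right ideals
   of C; its values elsewhere are irrelevant. *)
Definition ind_iso_K0 (F : fieldType) (C : falgType F) (phi : int -> K0 C) :
    Prop :=
  [/\ forall m n : int, (Posz (ind C) %| m)%Z -> (Posz (ind C) %| n)%Z ->
        K0_eq (phi (m + n)) (K0_add (phi m) (phi n)),
      forall m n : int, (Posz (ind C) %| m)%Z -> (Posz (ind C) %| n)%Z ->
        K0_eq (phi m) (phi n) -> m = n,
      forall x : K0 C, exists2 m : int, (Posz (ind C) %| m)%Z
        & K0_eq (phi m) x
    & forall (U : {vspace C}) (hU : (U * {:C} <= U)%VS),
        minimal_right_ideal U ->
        has_class (dg_deg0 (rideal hU)) (phi (Posz (ind C)))].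

Section Transfer.
Variables (k : fieldType) (l : fieldExtType k) (L : splittingFieldType k).
Variable iota : 'AHom(l, L).
Variables (A A' : falgType l).

Notation G := (gal_of {:L}).
Notation GH := (cosetT iota).
Notation C := (optens A A').
Notation C' := (optens (Rnc iota A) (Rnc iota A')).

Implicit Types (M : dgmod C) (W : dgmod C').

Definition upd (V : eqType) (v : {ffun GH -> V}) (s : GH) (x : V) :
  {ffun GH -> V} := [ffun c => if c == s then x else v c].

(* As ^\sigma M_L is M \otimes_l L with L acting on the right factor through
   \sigma^-1, it is identified with M \otimes_(l, \sigma) L by
   v \otimes x |-> v \otimes \sigma(x). Hence L-multilinear maps out of the
   family (^\sigma M_L)_(\sigma in G/H) are the same as maps out of M^(G/H)
   that are \sigma-semilinear over l in the slot \sigma. This description does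
   not depend on the choice of \sigma in its coset. *)
Definition multisemilinear M (T : lmodType L) (f : {ffun GH -> M} -> T) : Prop :=
  forall (v : {ffun GH -> M}) (s : GH) (a : l) (x y : M),
    f (upd v s (((a%:A : C) : C^c) *: x + y)) =
    emb s a *: f (upd v s x) + f (upd v s y).

(* pure v is the tensor \otimes_\sigma (v_\sigma \otimes 1) *)
Definition is_tensor M (T : lmodType L) (pure : {ffun GH -> M} -> T) : Prop :=
  multisemilinear pure /\
  forall (S : lmodType L) (f : {ffun GH -> M} -> S), multisemilinear f ->
    (exists g : {linear T -> S}, forall v, g (pure v) = f v) /\
    (forall g g' : {linear T -> S},
       (forall v, g (pure v) = f v) -> (forall v, g' (pure v) = f v) -> g =1 g').

Definition multihomogeneous M (deg : GH -> int) (v : {ffun GH -> M}) : Prop :=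
  forall s, homogeneous (deg s) (v s).

(* The factors of the tensor product are ordered by the enumeration of G/H;
   \rho moves the factor in position \sigma to position \rho \sigma. *)
Definition before (s t : GH) : bool := (enum_rank s < enum_rank t)%N.

Definition koszul (rho : G) (deg : GH -> int) : nat :=
  (\sum_s \sum_(t | before s t && before (coset_mul t rho) (coset_mul s rho))
     `|deg s| * `|deg t|)%N.

Definition deg_before (deg : GH -> int) (s : GH) : nat :=
  (\sum_(t | before t s) `|deg t|)%N.

(* W is (\otimes_(\sigma in G/H) ^\sigma M_L)^G, as a complex of
   R(A)^op \otimes R(A')-modules. *)
Record transfer M W : Type := Transfer {
  (* \otimes_(\sigma in G/H) ^\sigma M_L, graded by total degree *)
  tr_tensor : lmodType L;
  tr_pure : {ffun GH -> M} -> tr_tensor;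
  tr_tensorP : is_tensor tr_pure;
  tr_comp : int -> {linear tr_tensor -> tr_tensor};
  tr_comp_pure : forall n deg v, multihomogeneous deg v ->
    tr_comp n (tr_pure v) = if \sum_s deg s == n then tr_pure v else 0;
  tr_dif : {linear tr_tensor -> tr_tensor};
  tr_dif_pure : forall deg v, multihomogeneous deg v ->
    tr_dif (tr_pure v) =
      \sum_s (-1) ^+ deg_before deg s *: tr_pure (upd v s (dg_dif M (v s)));
  tr_gal : G -> tr_tensor -> tr_tensor;
  tr_gal_semilinear : forall rho (a : L) x y,
    tr_gal rho (a *: x + y) = rho a *: tr_gal rho x + tr_gal rho y;
  tr_gal_pure : forall rho deg v, multihomogeneous deg v ->
    tr_gal rho (tr_pure v) = (-1) ^+ koszul rho deg *: tr_pure (permute rho v);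
  (* the action of \otimes_\sigma (a_\sigma \otimes a'_\sigma) *)
  tr_act : {ffun GH -> A} -> {ffun GH -> A'} -> {linear tr_tensor -> tr_tensor};
  tr_act_pure : forall a a' v, tr_act a a' (tr_pure v) =
    tr_pure [ffun s => ((optens_pure (a s) (a' s) : C) : C^c) *: v s];
  tr_incl : {additive W -> tr_tensor};
  tr_incl_inj : injective tr_incl;
  tr_inclP : forall t,
    (exists w, tr_incl w = t) <-> (forall rho, tr_gal rho t = t);
  tr_incl_comp : forall n w, tr_incl (dg_comp W n w) = tr_comp n (tr_incl w);
  tr_incl_dif : forall w, tr_incl (dg_dif W w) = tr_dif (tr_incl w);
  (* where r = \sum_f r_f e_f in \otimes_\sigma ^\sigma A_L, and likewise r' *)
  tr_incl_act : forall (r : Rnc iota A) (r' : Rnc iota A') (w : W),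
    tr_incl (((optens_pure r r' : C') : C'^c) *: w) =
      \sum_f \sum_g ((vsval r : tensA iota A) f * (vsval r' : tensA iota A') g) *:
        tr_act [ffun s => bas (f s)] [ffun s => bas (g s)] (tr_incl w) }.

(* The map [M] |-> [(\otimes_\sigma ^\sigma M_L)^G] is defined at x, and its
   value there is y, whatever the representative M of x and the model of the
   fixed part of the tensor product. *)
Definition Rnc_hom (x : HomU A A') (y : HomU (Rnc iota A) (Rnc iota A')) :
    Prop :=
  (exists M W, inhabited (transfer M W) /\ has_class M x) /\
  (forall M W, transfer M W -> has_class M x -> has_class W y).

End Transfer.

(* Main.v *)
Require Import Defs.
From HB Require Import structures.
From mathcomp Require Import all_boot all_order all_algebra all_fingroup all_field.
From mathcomp Require Import boolp classical_sets.
From mathcomp Require Import zify ring.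
Set Implicit Arguments.
Unset Strict Implicit.
Unset Printing Implicit Defensive.
Import GRing.Theory.
Local Open Scope ring_scope.

(** Let C be a central simple algebra with \dim C = delta^2 and minimal right ideal U,
  so that \dim U = delta * ind C. Every dg C-module is quasi-isomorphic to a direct
  sum of shifts of U; it is compact iff its cohomology is finite-dimensional, and
  K_0(C) is infinite cyclic, its elements being detected by the Euler
  characteristic. The class of the integer n is the one of Euler characteristic
  n * delta.

  Let M have finite cohomology, T = \otimes_\sigma ^\sigma M_L and W = T^G. A
  contraction of M onto its cohomology induces one of T, so that the Euler
  characteristic of T over L is \chi(M)^d. By Galois descent T is L \otimes_k W, so
  W has the same Euler characteristic over k. Since
  \dim (R(A)^op \otimes R(A')) = (\dim (A^op \otimes A'))^d, the class n goes to the
  class n^d. A fixed part W exists when M is a sum of copies of U in one degree,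
  and every class has such a representative. *)

(** * Linear algebra modulo a subspace *)

(** A [transfer] is known only through a universal property and formulas on homogeneous pure
    tensors, and every compact [M] in the class has to be treated. Invariance of the non-additive
    construction under quasi-isomorphism is not proved directly: the cohomology of [W] is computed,
    and the Euler characteristic, injective on K_0, then identifies its class. That the tensor power
    is a complex graded by parity is obtained from [W], which spans it over [L]. Dimensions are
    those of subquotients given by predicates, because the modules may be infinite-dimensional, and
    only parities of degrees are kept. The indices of the two algebras are never compared. The Euler
    characteristic of [W] is [n ^ d * delta ^ d], and it is also a multiple of the dimension of a
    minimal right ideal, which is [delta ^ d] times the index; this yields the divisibility of
    [n ^ d]. Central simplicity is carried to tensor products and to the Weil restriction by way of
    the Azumaya property, that all linear endomorphisms are sums of maps [x |-> a * x * b]. *)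

Section ModSub.
Variables (F : fieldType) (V : lmodType F).
Implicit Types (B Q : V -> Prop) (s t : seq V).

(** Subspaces are predicates and not [{vspace V}], because the modules underlying complexes may have
    infinite dimension. *)
Definition lsub B := B 0 /\ forall a x y, B x -> B y -> B (a *: x + y).

(* x lies in B plus the span of s, and s is independent modulo B *)
Fixpoint spanm B s x : Prop :=
  if s is y :: s' then exists a, spanm B s' (x - a *: y) else B x.

Fixpoint indepm B s : Prop :=
  if s is x :: s' then indepm B s' /\ ~ spanm B s' x else True.

Lemma lsubZ B a x : lsub B -> B x -> B (a *: x).
Proof. by move=> [B0 BL] Bx; rewrite -[_ *: _]addr0; apply: BL. Qed.

Lemma lsubD B x y : lsub B -> B x -> B y -> B (x + y).
Proof. by move=> [B0 BL] Bx By; rewrite -[x]scale1r; apply: BL. Qed.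

Lemma lsubN B x : lsub B -> B x -> B (- x).
Proof. by rewrite -scaleN1r; apply: lsubZ. Qed.

Lemma lsubB B x y : lsub B -> B x -> B y -> B (x - y).
Proof. by move=> hB Bx By; apply: lsubD => //; apply: lsubN. Qed.

Lemma lsub_sum B (I : Type) (r : seq I) (P : pred I) (f : I -> V) :
  lsub B -> (forall i, P i -> B (f i)) -> B (\sum_(i <- r | P i) f i).
Proof.
move=> hB hf; apply: (big_ind B) => //; first by case: hB.
by move=> x y; apply: lsubD.
Qed.

Lemma spanm_lsub B s : lsub B -> lsub (spanm B s).
Proof.
move=> hB; elim: s => [//|y s [IH0 IHL]] /=; split.
  by exists 0; rewrite scale0r subr0.
move=> a x x' [b hb] [b' hb']; exists (a * b + b').
rewrite scalerDl -scalerA opprD addrACA -scalerBr; exact: IHL.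
Qed.

Lemma spanm_sub B s x : lsub B -> B x -> spanm B s x.
Proof.
move=> hB; elim: s x => [//|y s IH] x Bx /=.
by exists 0; rewrite scale0r subr0; apply: IH.
Qed.

Lemma mem_spanm B s x : lsub B -> x \in s -> spanm B s x.
Proof.
move=> hB; elim: s x => [//|y s IH] x; rewrite inE => /predU1P[->|xs] /=.
  by exists 1; rewrite scale1r subrr; case: (spanm_lsub s hB).
by exists 0; rewrite scale0r subr0; apply: IH.
Qed.

Lemma spanm_cat B s t x : spanm B (s ++ t) x <-> spanm (spanm B t) s x.
Proof.
elim: s x => [//|y s IH] x /=.
by split=> -[a ha]; exists a; apply/IH.
Qed.

Lemma indepm_cat B s t :
  indepm B (s ++ t) <-> indepm B t /\ indepm (spanm B t) s.
Proof.
elim: s => [|y s IH] /=; first by split=> // -[].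
by rewrite IH spanm_cat; tauto.
Qed.

Lemma spanm_trans B B' s x : lsub B' -> (forall y, B y -> B' y) ->
  (forall y, y \in s -> B' y) -> spanm B s x -> B' x.
Proof.
move=> hB' BB'; elim: s x => [|y s IH] x hs /=; first exact: BB'.
move=> [a /IH h]; rewrite -[x](subrK (a *: y)); apply: lsubD => //.
  by apply: h => z zs; apply: hs; rewrite inE zs orbT.
by apply: lsubZ => //; apply: hs; rewrite inE eqxx.
Qed.

Lemma spanm_subset B s t x : lsub B -> {subset s <= t} ->
  spanm B s x -> spanm B t x.
Proof.
move=> hB st; apply: spanm_trans; first exact: spanm_lsub.
  by move=> y; apply: spanm_sub.
by move=> y /st; apply: mem_spanm.
Qed.

Lemma eq_spanm B B' s x : (forall y, B y <-> B' y) -> spanm B s x -> spanm B' s x.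
Proof.
move=> BB'; elim: s x => [|y s IH] x /=; first by move/BB'.
by move=> [a /IH ha]; exists a.
Qed.

Section Families.
Variables (I : eqType) (v : I -> V).

Lemma spanm_mapP B (r : seq I) x : uniq r ->
  spanm B (map v r) x <-> exists c : I -> F, B (x - \sum_(i <- r) c i *: v i).
Proof.
elim: r x => [|j r IH] x /=.
  move=> _; split=> [Bx|[c]]; last by rewrite big_nil subr0.
  by exists (fun=> 0); rewrite big_nil subr0.
move=> /andP[jr ur]; split=> [[a /IH -/(_ ur)[c hc]]|[c]].
  exists (fun i => if i == j then a else c i).
  rewrite big_cons eqxx opprD addrA (eq_big_seq (fun i => c i *: v i)) //.
  by move=> i ir; case: eqVneq ir jr => // -> ->.
by rewrite big_cons opprD addrA => hc; exists (c j); apply/IH => //; exists c.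
Qed.

Lemma indepm_mapP B (r : seq I) : lsub B -> uniq r ->
  indepm B (map v r) <->
  forall c : I -> F, B (\sum_(i <- r) c i *: v i) -> {in r, forall i, c i = 0}.
Proof.
move=> hB; elim: r => [|j r IH] /=; first by split.
move=> /andP[jr ur]; split=> [[/IH -/(_ ur) hi hj] c|h].
  rewrite big_cons => hc.
  have cj0 : c j = 0.
    apply/eqP/negPn/negP => cj; apply: hj; apply/spanm_mapP => //.
    exists (fun i => - ((c j)^-1 * c i)); rewrite -sumrN.
    rewrite (eq_bigr (fun i => (c j)^-1 *: (c i *: v i))); last first.
      by move=> i _; rewrite -scaleNr opprK scalerA.
    rewrite -scaler_sumr -{1}[v j]scale1r -(mulVf cj) -scalerA -scalerDr.
    exact: lsubZ.
  move: hc; rewrite cj0 scale0r add0r => /hi hc i.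
  by rewrite inE => /predU1P[->|/hc].
split.
  apply/IH => // c hc i ir.
  have := h (fun i => if i == j then 0 else c i).
  rewrite big_cons eqxx scale0r add0r (eq_big_seq (fun i => c i *: v i)); last first.
    by move=> i' ir'; case: eqVneq ir' jr => // -> ->.
  move=> /(_ hc i); rewrite inE ir orbT => /(_ isT).
  by case: eqVneq ir jr => // -> ->.
move=> /(spanm_mapP _ _ ur)[c hc].
have := h (fun i => if i == j then 1 else - c i).
rewrite big_cons eqxx scale1r (eq_big_seq (fun i => - (c i *: v i))); last first.
  by move=> i ir; rewrite -scaleNr; case: eqVneq ir jr => // -> ->.
rewrite sumrN => /(_ hc j); rewrite inE eqxx => /(_ isT) /eqP.
by rewrite oner_eq0.
Qed.

End Families.

Lemma map_nth_iota (T : Type) (x0 : T) (s : seq T) :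
  s = map (nth x0 s) (iota 0 (size s)).
Proof. by rewrite -/(mkseq _ _) mkseq_nth. Qed.

Lemma sum_iota n (f : nat -> V) : \sum_(i <- iota 0 n) f i = \sum_(i < n) f i.
Proof. by rewrite -(big_mkord xpredT) /index_iota subn0. Qed.

Lemma spanmP B s x :
  spanm B s x <-> exists c : nat -> F, B (x - \sum_(i < size s) c i *: s`_i).
Proof.
rewrite {1}[s](map_nth_iota 0) spanm_mapP ?iota_uniq //.
by split=> -[c hc]; exists c; move: hc; rewrite sum_iota.
Qed.

Lemma indepmP B s : lsub B -> indepm B s <->
  forall c : nat -> F, B (\sum_(i < size s) c i *: s`_i) ->
    forall i, (i < size s)%N -> c i = 0.
Proof.
move=> hB; rewrite {1}[s](map_nth_iota 0) indepm_mapP ?iota_uniq //.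
split=> h c; rewrite ?sum_iota => hc i.
  by move=> hi; apply: (h c); rewrite ?sum_iota ?mem_iota.
by rewrite mem_iota => /andP[_ hi]; apply: h hi.
Qed.

(** Modulo [B], the list [s] is a matrix times [t]. If it had more rows than columns, a nonzero row
    vector would kill the matrix and give a relation between the entries of [s]. *)
Lemma steinitz B s t : lsub B -> indepm B s ->
  (forall x, x \in s -> spanm B t x) -> (size s <= size t)%N.
Proof.
move=> hB /indepmP -/(_ hB) hs hst; rewrite leqNgt; apply/negP => lt_ts.
have /choice[a ha] (i : 'I_(size s)) : exists c : nat -> F,
  B (s`_i - \sum_(j < size t) c j *: t`_j) by apply/spanmP/hst/mem_nth.
pose A := \matrix_(i < size s, j < size t) a i j.
have : kermx A != 0.
  rewrite kermx_eq0 -row_leq_rank -ltnNge.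
  by apply: leq_ltn_trans lt_ts; rewrite rank_leq_col.
move=> /rowV0Pn[r /sub_kermxP rA /rV0Pn[i ri]].
pose c (n : nat) := if insub n is Some i' then r 0 i' else 0.
have cE (i' : 'I_(size s)) : c i' = r 0 i' by rewrite /c valK.
have /hs -/(_ i (ltn_ord i)) : B (\sum_(i < size s) c i *: s`_i).
  have -> : \sum_(i < size s) c i *: s`_i =
      \sum_(i < size s) c i *: (s`_i - \sum_(j < size t) a i j *: t`_j).
    rewrite -[LHS]subr0; under [RHS]eq_bigr do rewrite scalerBr.
    rewrite sumrB; congr (_ - _); symmetry.
    under eq_bigr do rewrite scaler_sumr.
    rewrite exchange_big big1 //= => j _.
    under eq_bigr do rewrite scalerA.
    rewrite -scaler_suml; have /rowP/(_ j) := rA; rewrite !mxE => h.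
    by rewrite (eq_bigr (fun i => r 0 i * A i j)) ?h ?scale0r // => i' _; rewrite mxE cE.
  by apply: lsub_sum => // i' _; apply: lsubZ.
by rewrite cE => /eqP; rewrite (negPf ri).
Qed.

(** Elements of [Q] outside the current span are adjoined one at a time; the bound [N] on
    independent lists in [Q] takes the place of a finite dimension and makes this stop. *)
Lemma extend_indepm B Q N t : lsub B ->
    (forall s, indepm B s -> (forall x, x \in s -> Q x) -> (size s <= N)%N) ->
    indepm B t -> (forall x, x \in t -> Q x) ->
  exists s, [/\ forall x, x \in s -> Q x, indepm B (s ++ t)
    & forall x, Q x -> spanm B (s ++ t) x].
Proof.
move=> hB hN; have [m] := ubnP (N - size t)%N; elim: m t => // m IH t.
rewrite ltnS => hm it qt.
have [h|/existsNP[x /not_implyP[Qx hx]]] := pselect (forall x, Q x -> spanm B t x).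
  by exists [::]; split.
have ixt : indepm B (x :: t) by split.
have qxt y : y \in x :: t -> Q y by rewrite inE => /predU1P[->|/qt].
have := hN _ ixt qxt => /= lt_tN.
have [|s [h1 h2 h3]] := IH (x :: t) _ ixt qxt; first by rewrite /=; lia.
by exists (rcons s x); rewrite cat_rcons; split=> // y; rewrite mem_rcons inE => /predU1P[->|/h1].
Qed.

(** For a subspace [Q] this is the dimension of [(Q + B) / B], stated as a relation with [n] since
    the quotient need not be finite-dimensional. *)
Definition dimq Q B n := exists s, [/\ size s = n, forall x, x \in s -> Q x,
  indepm B s & forall x, Q x -> spanm B s x].

Lemma dimq_uniq Q B n m : lsub B -> dimq Q B n -> dimq Q B m -> n = m.
Proof.
move=> hB [s [<- qs is_ hs]] [t [<- qt it ht]].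
by apply/eqP; rewrite eqn_leq !(@steinitz B) // => x; [move/qt/hs | move/qs/ht].
Qed.

Lemma dimq_exists Q B t : lsub B -> (forall x, Q x -> spanm B t x) ->
  exists n, dimq Q B n.
Proof.
move=> hB ht; have [s is_ qs|//|//|s] := @extend_indepm B Q (size t) [::] hB.
  by apply: (@steinitz B) => // x /qs/ht.
by rewrite cats0 => -[h1 h2 h3]; exists (size s), s.
Qed.

End ModSub.

Section MapMod.
Variables (F : fieldType) (V W : lmodType F) (f : {linear V -> W}).
Variables (B : V -> Prop) (B' : W -> Prop).

Definition lc (s : seq V) := spanm (fun u => u = 0) s.

Lemma lsub0 (U : lmodType F) : lsub (fun u : U => u = 0).
Proof. by split=> // a x y -> ->; rewrite scaler0 addr0. Qed.

Lemma lc_in (Q : V -> Prop) s u : lsub Q -> (forall x, x \in s -> Q x) ->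
  lc s u -> Q u.
Proof. by move=> hQ hs; apply: spanm_trans => // y ->; case: hQ. Qed.

Lemma spanm_lc s x : lsub B -> spanm B s x <-> exists2 u, lc s u & B (x - u).
Proof.
move=> hB; split; last first.
  move=> [u hu hx]; rewrite -[x](subrK u); apply: lsubD.
  - exact: spanm_lsub.
  - exact: spanm_sub.
  by apply: (spanm_trans (spanm_lsub s hB)) hu => [y ->|y]; [case: (spanm_lsub s hB) | apply: mem_spanm].
elim: s x => [|y s IH] x /=; first by move=> Bx; exists 0; rewrite ?subr0.
move=> [a /IH[u hu hx]]; exists (u + a *: y); first by exists a; rewrite addrK.
by rewrite opprD addrA addrAC.
Qed.

Lemma indepm_lc0 s u : lsub B -> indepm B s -> lc s u -> B u -> u = 0.
Proof.
move=> hB /indepmP -/(_ hB) hs /spanmP[c /eqP]; rewrite subr_eq0 => /eqP -> Bu.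
by apply: big1 => i _; rewrite (hs c) ?scale0r.
Qed.

Lemma spanm_map s x :
  (forall y, B y -> B' (f y)) -> spanm B s x -> spanm B' (map f s) (f x).
Proof.
move=> BB'; elim: s x => [|y s IH] x /=; first exact: BB'.
by move=> [a /IH]; rewrite linearB linearZ => h; exists a.
Qed.

Lemma lc_map s u : spanm (fun u => u = 0) (map f s) u ->
  exists2 v, lc s v & u = f v.
Proof.
elim: s u => [|y s IH] u /=; first by move=> ->; exists 0; rewrite ?linear0.
move=> [a /IH[v hv e]]; exists (v + a *: y); first by exists a; rewrite addrK.
by rewrite linearD linearZ -e subrK.
Qed.

Lemma indepm_map s : lsub B -> lsub B' ->
  (forall y, lc s y -> B' (f y) -> B y) ->
  indepm B s -> indepm B' (map f s).
Proof.
move=> hB hB' BB' /indepmP -/(_ hB) hs; apply/indepmP => // c hc i.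
rewrite size_map => hi; apply: hs hi; apply: BB'.
  apply: lsub_sum; first exact/spanm_lsub/lsub0.
  by move=> j _; apply: lsubZ; [apply/spanm_lsub/lsub0 | apply/mem_spanm/mem_nth; first apply: lsub0].
rewrite linear_sum; move: hc; rewrite size_map; congr B'.
by apply: eq_bigr => j _; rewrite linearZ (nth_map 0).
Qed.

Lemma indepm_map_inv s : (forall y, B y -> B' (f y)) ->
  indepm B' (map f s) -> indepm B s.
Proof.
move=> BB'; elim: s => [//|y s IH] /= [/IH hs hy]; split=> // sy.
exact/hy/spanm_map.
Qed.

Variables (Q : V -> Prop) (Q' : W -> Prop).
Hypotheses (hB : lsub B) (hB' : lsub B') (hQ : lsub Q) (hQ' : lsub Q').
Hypotheses (fB : forall y, B y -> B' (f y)) (fQ : forall y, Q y -> Q' (f y)).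
Hypothesis finj : forall y, Q y -> B' (f y) -> B y.
Hypothesis fsurj : forall z, Q' z -> exists2 y, Q y & B' (z - f y).

Lemma dimq_map n : dimq Q B n -> dimq Q' B' n.
Proof.
move=> [s [<- qs is_ hs]]; exists (map f s); split.
- by rewrite size_map.
- by move=> _ /mapP[x /qs/fQ ? ->].
- apply: (indepm_map hB hB') is_ => y hy; apply: finj; exact: (lc_in hQ qs hy).
move=> z /fsurj[y Qy hy]; rewrite -[z](subrK (f y)).
apply: lsubD; [exact: spanm_lsub | exact: spanm_sub |].
by apply: (spanm_map fB); apply: hs.
Qed.

(** A basis of the target is not lifted. Its length bounds the independent lists of the source,
    which therefore has a dimension, and [dimq_map] forces the two numbers to agree. *)
Lemma dimq_map_inv n : dimq Q' B' n -> dimq Q B n.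
Proof.
move=> h; have [t [tn qt it ht]] := h.
have [s is_ qs|//|//|s] := @extend_indepm _ _ B Q n [::] hB.
  rewrite -tn -(size_map f); apply: (@steinitz _ _ B') => //.
    apply: (indepm_map hB hB') is_ => y hy; apply: finj; exact: (lc_in hQ qs hy).
  by move=> _ /mapP[x /qs/fQ/ht ? ->].
rewrite cats0 => -[h1 h2 h3].
have hd : dimq Q B (size s) by exists s.
by rewrite -(dimq_uniq hB' (dimq_map hd) h).
Qed.

End MapMod.

(** * Z/2-graded complexes *)

(** The even and odd parts are predicates, [true] being odd. Parities instead of degrees are enough
    for Euler characteristics, and they ask for no boundedness. *)
Record scplx (F : fieldType) := SCplx {
  sc_mod :> lmodType F;
  sc_par : bool -> sc_mod -> Prop;
  sc_dif : {linear sc_mod -> sc_mod};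
  sc_par_sub : forall b, lsub (sc_par b);
  sc_par_dec : forall b x, exists x0 x1,
    [/\ sc_par b x0, sc_par (~~ b) x1 & x = x0 + x1];
  sc_par_uniq : forall b x, sc_par b x -> sc_par (~~ b) x -> x = 0;
  sc_dif_par : forall b x, sc_par b x -> sc_par (~~ b) (sc_dif x);
  sc_dif_dif : forall x, sc_dif (sc_dif x) = 0 }.

Section Scplx.
Variable F : fieldType.
Implicit Types X Y Z : scplx F.

Definition cyc X b (x : X) := sc_par b x /\ sc_dif X x = 0.
(** The primitive [y] carries no parity; when [x] has a parity, [bdy_par] provides a primitive of
    the opposite one. *)
Definition bdy X (x : X) := exists y, x = sc_dif X y.
Definition hdim X b n := dimq (cyc (X := X) b) (bdy (X := X)) n.

Lemma bdy_sub X : lsub (bdy (X := X)).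
Proof.
split; first by exists 0; rewrite linear0.
by move=> a _ _ [x ->] [y ->]; exists (a *: x + y); rewrite linearP.
Qed.

Lemma cyc_sub X b : lsub (cyc (X := X) b).
Proof.
split; first by split; [case: (sc_par_sub X b) | rewrite linear0].
move=> a x y [px dx] [py dy]; split; first by case: (sc_par_sub X b) => _; apply.
by rewrite linearP dx dy scaler0 addr0.
Qed.
#[local] Hint Resolve bdy_sub cyc_sub : core.

Lemma hdim_uniq X b n m : hdim X b n -> hdim X b m -> n = m.
Proof. exact: dimq_uniq. Qed.

(** In [x = d y0 + d y1] the term [d y0] has the parity opposite to that of [x], yet it equals
    [x - d y1], so it vanishes. *)
Lemma bdy_par X b x : sc_par b x -> bdy x -> exists2 y, sc_par (~~ b) y & x = sc_dif X y.
Proof.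
move=> px [y ey]; have [y0 [y1 [p0 p1 e]]] := sc_par_dec b y.
exists y1 => //; rewrite ey e linearD.
suff -> : sc_dif X y0 = 0 by rewrite add0r.
apply: (@sc_par_uniq _ _ b); last exact: sc_dif_par.
rewrite -(addrK (sc_dif X y1) (sc_dif X y0)) -linearD -e -ey.
apply: lsubB => //; first exact: sc_par_sub.
by rewrite -[b]negbK; apply: sc_dif_par.
Qed.

Definition schom X Y (f : {linear X -> Y}) :=
  (forall b x, sc_par b x -> sc_par b (f x)) /\
  (forall x, f (sc_dif X x) = sc_dif Y (f x)).

Lemma schom_bdy X Y (f : {linear X -> Y}) x : schom f -> bdy x -> bdy (f x).
Proof. by move=> [_ fd] [y ->]; exists (f y); rewrite fd. Qed.

Lemma schom_cyc X Y (f : {linear X -> Y}) b x : schom f -> cyc b x -> cyc b (f x).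
Proof. by move=> [fp fd] [/fp px dx]; split=> //; rewrite -fd dx linear0. Qed.

Definition scqis X Y (f : {linear X -> Y}) :=
  [/\ schom f, forall b x, cyc b x -> bdy (f x) -> bdy x
    & forall b y, cyc b y -> exists2 x, cyc b x & bdy (y - f x)].

Lemma hdim_qis X Y (f : {linear X -> Y}) b n : scqis f -> hdim X b n <-> hdim Y b n.
Proof.
move=> [fh fi fs]; split; [apply: (dimq_map (f := f)) | apply: (dimq_map_inv (f := f))] => //;
  by [move=> y; apply: schom_bdy | move=> y; apply: schom_cyc | apply: fi | apply: fs].
Qed.

(** The part of a preimage with the wrong parity is mapped to an element of both parities, hence to
    zero. *)
Lemma schom_lift X Y (g : {linear X -> Y}) b z : schom g -> (exists y, g y = z) -> sc_par b z ->
  exists2 y, sc_par b y & g y = z.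
Proof.
move=> [gp _] [y gy] pz; have [y0 [y1 [p0 p1 e]]] := sc_par_dec b y; exists y0 => //.
suff g1 : g y1 = 0 by rewrite -gy e linearD g1 addr0.
apply: (@sc_par_uniq _ _ b); last exact: gp.
rewrite -(addKr (g y0) (g y1)) -linearD -e gy addrC.
by apply: lsubB => //; [exact: sc_par_sub | apply: gp].
Qed.

Lemma schom_par_inj X Y (f : {linear X -> Y}) b x : schom f -> injective f ->
  sc_par b (f x) -> sc_par b x.
Proof.
move=> hf fi pf; have [||x' px' /fi <-//] := @schom_lift X Y f b (f x) hf; last by [].
by exists x.
Qed.

Section SES.
Variables (X Y Z : scplx F) (f : {linear X -> Y}) (g : {linear Y -> Z}).
Hypotheses (fh : schom f) (gh : schom g) (finj : injective f).
Hypothesis gsurj : forall z, exists y, g y = z.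
Hypothesis exact_fg : forall y, g y = 0 <-> exists x, y = f x.

Let gf x : g (f x) = 0. Proof. by apply/exact_fg; exists x. Qed.
Let f0 x : f x = 0 -> x = 0. Proof. by rewrite -(linear0 f) => /finj. Qed.

Let liftable b (z : Z) := exists2 y, cyc b y & g y = z.

Let map_lift (T U : eqType) (h : T -> U) (P : T -> Prop) (s : seq U) :
  (forall z, z \in s -> exists2 y, P y & h y = z) ->
  exists2 s', (forall y, y \in s' -> P y) & s = map h s'.
Proof.
elim: s => [|z s IH] hs; first by exists [::].
have [y Py ey] := hs z (mem_head _ _).
have [|s' Ps' es'] := IH; first by move=> z' z's; apply: hs; rewrite inE z's orbT.
exists (y :: s'); last by rewrite /= ey es'.
by move=> y'; rewrite inE => /predU1P[->|/Ps'].
Qed.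

(** Data at one place of the exact hexagon of cohomology. The cycles [ky] map to a basis of the
    image of [H(Y) -> H(Z)] in parity [b], of rank [k]. The chains [zy] lift a complementary part of
    [H(Z)], on which the connecting map to [H(X)] is injective, of rank [r]. *)
Definition ses_split b k r (ky zy : seq Y) :=
  [/\ size ky = k, size zy = r, forall y, y \in ky -> cyc b y
    & [/\ forall y, y \in zy -> sc_par b y,
      forall y, y \in zy -> exists x, sc_dif Y y = f x,
      indepm (bdy (X := Z)) (map g zy ++ map g ky),
      forall z, cyc b z -> spanm (bdy (X := Z)) (map g zy ++ map g ky) z
    & forall z, liftable b z -> spanm (bdy (X := Z)) (map g ky) z]].

Lemma ses_half b n : hdim Z b n -> exists k r : nat, exists ky zy : seq Y,
  n = (r + k)%N /\ ses_split b k r ky zy.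
Proof.
move=> hZ; have [t [tn qt it ht]] := hZ.
have lc_ z : liftable b z -> cyc b z by move=> [y hy <-]; apply: schom_cyc.
have hbound s : indepm (bdy (X := Z)) s -> (forall x, x \in s -> cyc b x) -> (size s <= size t)%N.
  by move=> is_ qs; apply: (@steinitz _ _ (bdy (X := Z))) => // x /qs/ht.
have [s is_ qs|//|//|k] := @extend_indepm _ _ (bdy (X := Z)) (liftable b) (size t) [::] (bdy_sub Z).
  by apply: hbound => // x /qs/lc_.
rewrite cats0 => -[qk ik hk].
have [|s [qs is_ hs]] := @extend_indepm _ _ (bdy (X := Z)) (cyc (X := Z) b) (size t) k (bdy_sub Z) hbound ik.
  by move=> x /qk/lc_.
have [ky qky eky] := map_lift qk.
have [zy qzy ezy] : exists2 zy, (forall y, y \in zy -> sc_par b y) & s = map g zy.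
  by apply: map_lift => z /qs[pz _]; apply: schom_lift.
exists (size k), (size s), ky, zy; split.
  rewrite -size_cat; apply: (hdim_uniq hZ); exists (s ++ k); split=> // x.
  by rewrite mem_cat => /orP[/qs|/qk/lc_].
split=> //; rewrite -?eky -?ezy; do ?by rewrite ?eky ?ezy size_map.
split=> // y yz; apply/exact_fg; case: gh => _ ->.
by have [] := qs (g y); rewrite ?ezy ?map_f.
Qed.

Lemma ses_bdy_lift b z : sc_par b z -> bdy z -> exists2 y, sc_par (~~ b) y & z = g (sc_dif Y y).
Proof.
move=> pz /(bdy_par pz)[z' pz' ->]; have [y py <-] := schom_lift gh (gsurj z') pz'.
by exists y => //; case: gh => _ ->.
Qed.

(** With [q] the rank of [H(X) -> H(Y)] in a given parity, exactness of the hexagon gives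
    [x = q + r'], [y = q + k] and [z = r + k], where [r'] belongs to the other parity. The ranks
    cancel in the alternating sum. *)
Lemma ses_euler x0 x1 y0 y1 z0 z1 :
  hdim X false x0 -> hdim X true x1 -> hdim Y false y0 -> hdim Y true y1 ->
  hdim Z false z0 -> hdim Z true z1 -> (y0 + x1 + z1 = x0 + z0 + y1)%N.
Proof.
move=> hX0 hX1 hY0 hY1 /ses_half[k0 [r0 [ky0 [zy0 h0]]]] /ses_half[k1 [r1 [ky1 [zy1 h1]]]].
have main b n m k r ky zy k' r' ky' zy' : hdim X b n -> hdim Y b m ->
    ses_split b k r ky zy -> ses_split (~~ b) k' r' ky' zy' ->
    exists q, n = (q + r')%N /\ m = (q + k)%N.
  move=> hX hY [sk sr cky [pzy dzy izk hzk hlk]] [sk' sr' cky' [pzy' dzy' izk' hzk' hlk']].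
  (* [dl] represents the images under the connecting map of the classes lifted by [zy']. *)
  have [dl [hdl sdl]] : exists dl : seq X,
      map f dl = map (sc_dif Y) zy' /\ size dl = r'.
    have [|dl _ e] := @map_lift _ _ f (fun=> True) (map (sc_dif Y) zy').
      by move=> _ /mapP[y /dzy'[x ->] ->]; exists x.
    by exists dl; split=> //; rewrite -sr' -(size_map (sc_dif Y)) e size_map.
  have fdl u : lc dl u -> exists2 v, lc zy' v & f u = sc_dif Y v.
    move=> hu; apply: lc_map; rewrite -hdl.
    by apply: (spanm_map (f := f)) hu => _ ->; rewrite linear0.
  have cdl x : x \in dl -> cyc b x.
    move=> xd; have /mapP[y yz e] : f x \in map (sc_dif Y) zy' by rewrite -hdl map_f.
    split; last by apply: f0; rewrite (fh.2) e sc_dif_dif.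
    apply: (schom_par_inj fh finj); rewrite e -[b]negbK; apply/sc_dif_par/pzy'/yz.
  have idl : indepm (bdy (X := X)) dl.
    pose B'' y := exists2 x, bdy x & y = f x.
    apply: (@indepm_map_inv _ _ _ f _ B''); first by move=> y hy; exists y.
    have hB'' : lsub B''.
      split; first by exists 0; rewrite ?linear0 //; case: (bdy_sub X).
      move=> a _ _ [x hx ->] [x' hx' ->]; exists (a *: x + x'); rewrite ?linearP //.
      by case: (bdy_sub X) => _; apply.
    rewrite hdl; move: izk' => /indepm_cat[_ izy].
    have izy' := indepm_map_inv (f := g) (B := fun y => spanm (bdy (X := Z)) (map g ky') (g y)) (fun _ h => h) izy.
    apply: indepm_map izy' => //.
      split; rewrite ?linear0; first by case: (spanm_lsub (map g ky') (bdy_sub Z)).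
      move=> a x y hx hy; rewrite linearP.
      by case: (spanm_lsub (map g ky') (bdy_sub Z)) => _; apply.
    (* Injectivity of the connecting map: if [d y = f x] with [x = d x'], then [y - f x'] is a cycle
       with the same image in [Z], so [g y] already lies in the span of [g ky']. *)
    move=> y hy [x hx e].
    have py : sc_par (~~ b) y by apply: lc_in hy => //; exact: sc_par_sub.
    have pdy : sc_par b (sc_dif Y y) by rewrite -[b]negbK; apply: sc_dif_par.
    have px : sc_par b x by apply: (schom_par_inj fh finj); rewrite -e.
    have [x' px' ex] := bdy_par px hx.
    apply: hlk'; exists (y - f x'); last by rewrite linearB gf subr0.
    split; last by rewrite linearB -(fh.2) -ex e subrr.
    by apply: lsubB => //; [exact: sc_par_sub | apply: (fh.1)].
  have [s0 [sn qs is_ hs]] := hX.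
  have [s is' qs'|//|xr [qxr ixr hxr]] := @extend_indepm _ _ (bdy (X := X)) (cyc (X := X) b) n dl (bdy_sub X) _ idl.
    by rewrite -sn; apply: (@steinitz _ _ (bdy (X := X))) => // x /qs'/hs.
  have nE : n = (size xr + r')%N.
    rewrite -sdl -size_cat; apply: (hdim_uniq hX); exists (xr ++ dl); split=> // x.
    by rewrite mem_cat => /orP[/qxr|/cdl].
  exists (size xr); split=> //.
  have dl0 u : lc dl u -> bdy (f u) by move=> /fdl[v _ ->]; exists v.
  have qy y : y \in map f xr ++ ky -> cyc b y.
    by rewrite mem_cat => /orP[/mapP[x /qxr hx ->]|/cky//]; apply: schom_cyc.
  have iky : indepm (bdy (X := Z)) (map g ky) by case/indepm_cat: izk.
  (* [xr] completes [dl] to a homology basis of [X]; its image survives in [H(Y)] because only the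
     span of [dl] is killed, and [ky] accounts for the rest. *)
  suff [iy hy] : indepm (bdy (X := Y)) (map f xr ++ ky) /\
      forall y, cyc b y -> spanm (bdy (X := Y)) (map f xr ++ ky) y.
    rewrite -sk -(size_map f) -size_cat; apply: (hdim_uniq hY).
    by exists (map f xr ++ ky); split.
  have kysub := spanm_lsub ky (bdy_sub Y).
  split.
    apply/indepm_cat; split.
      by apply: (indepm_map_inv (f := g)) iky => y; apply: schom_bdy.
    case/indepm_cat: ixr => _ ixr.
    apply: (indepm_map (B := spanm (bdy (X := X)) dl)) ixr => //; first exact: spanm_lsub.
    move=> x hx /(spanm_lc _ _ (bdy_sub Y))[u hu [y ey]].
    have gu : g u = 0.
      apply: (indepm_lc0 (bdy_sub Z) iky).
        by apply: (spanm_map (f := g)) hu => _ ->; rewrite linear0.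
      exists (- g y); rewrite linearN -(gh.2) -ey linearB gf sub0r opprK //.
    have u0 : u = 0.
      apply: (@indepm_lc0 _ _ (fun y => bdy (g y)) ky) => //.
      - split; rewrite ?linear0; first by case: (bdy_sub Z).
        by move=> a p q hp hq; rewrite linearP; case: (bdy_sub Z) => _; apply.
      - by apply: (indepm_map_inv (f := g)) iky.
      - by rewrite gu; case: (bdy_sub Z).
    move: ey; rewrite u0 subr0 => fx.
    have [px _] : cyc b x by apply: lc_in hx => //; exact: cyc_sub.
    have [||{}y py {}fx] := @bdy_par Y b (f x); [exact: fh.1 | by exists y|].
    (* Here [f x = d y], so the class of [x] is the connecting image of the cycle [g y]. Writing
       [g y] through [zy'] and [ky'] puts [x] in the span of [dl] modulo boundaries. *)
    have cgy : cyc (~~ b) (g y).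
      by split; [apply: gh.1 | rewrite -(gh.2) -fx gf].
    have /spanm_cat/spanm_lc[|v hv] := hzk' _ cgy; first exact: spanm_lsub.
    move=> /spanm_lc[|w hw hb]; first exact: bdy_sub.
    have [v' hv' ev] := lc_map (f := g) hv; have [w' hw' ew] := lc_map (f := g) hw.
    have pv' : sc_par (~~ b) v' by apply: lc_in hv' => //; exact: sc_par_sub.
    have cw' : cyc (~~ b) w' by apply: lc_in hw' => //; exact: cyc_sub.
    move: hb; rewrite ev ew -!linearB => hb.
    have [|y' py' ey'] := @ses_bdy_lift (~~ b) _ _ hb.
      apply: gh.1; apply: lsubB cw'.1; first exact: sc_par_sub.
      by apply: lsubB => //; exact: sc_par_sub.
    have /exact_fg[x'' ex''] : g (y - v' - w' - sc_dif Y y') = 0 by rewrite linearB ey' subrr.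
    have [x3 hx3 ex3] : exists2 x3, lc dl x3 & f x3 = sc_dif Y v'.
      have : lc (map f dl) (sc_dif Y v').
        by rewrite hdl; apply: (spanm_map (f := sc_dif Y)) hv' => _ ->; rewrite linear0.
      by move=> h3; have [x3 hx3 ->] := lc_map (f := f) h3; exists x3.
    apply/spanm_lc; first exact: bdy_sub.
    exists x3 => //; exists x''; apply: finj.
    rewrite linearB ex3 fx (fh.2) -ex'' !linearB sc_dif_dif cw'.2 !subr0 //.
  move=> y cy; apply/spanm_cat.
  have /(spanm_lc _ _ (bdy_sub Z))[u hu hb] := hlk _ (ex_intro2 _ _ y cy erefl).
  have [u' hu' eu] := lc_map (f := g) hu.
  have cu' : cyc b u' by apply: lc_in hu' => //; exact: cyc_sub.
  move: hb; rewrite eu -linearB => hb.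
  have [|y' py' ey'] := @ses_bdy_lift b _ _ hb.
    by apply: gh.1; apply: lsubB cu'.1; [exact: sc_par_sub | exact: cy.1].
  have /exact_fg[x ex] : g (y - u' - sc_dif Y y') = 0 by rewrite linearB ey' subrr.
  have cx : cyc b x.
    have [pf df] : cyc b (f x).
      rewrite -ex; apply: lsubB; first exact: cyc_sub.
        by apply: lsubB => //; exact: cyc_sub.
      by split; [rewrite -[b]negbK; apply: sc_dif_par | exact: sc_dif_dif].
    by split; [apply: (schom_par_inj fh finj) | apply: f0; rewrite (fh.2)].
  have -> : y = f x + (u' + sc_dif Y y') by rewrite -ex -[y - u' - _]addrA -opprD subrK.
  apply: lsubD; first exact: spanm_lsub.
    have /spanm_cat := hxr _ cx; apply: spanm_map => x' /(spanm_lc _ _ (bdy_sub X))[v hv hb'].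
    apply: spanm_sub; first exact: bdy_sub.
    rewrite -[x'](subrK v) linearD; apply: lsubD; first exact: bdy_sub.
      exact: schom_bdy.
    exact: dl0.
  apply: spanm_sub => //; apply: lsubD => //; last first.
    by apply: spanm_sub; [exact: bdy_sub | exists y'].
  apply: spanm_trans hu' => // [_ ->|z zk]; first by case: kysub.
  by apply: mem_spanm => //; exact: bdy_sub.
case: h0 => z0E h0; case: h1 => z1E h1.
have [q0 [-> ->]] := main false x0 y0 _ _ _ _ _ _ _ _ hX0 hY0 h0 h1.
have [q1 [-> ->]] := main true x1 y1 _ _ _ _ _ _ _ _ hX1 hY1 h1 h0.
by rewrite z0E z1E; lia.
Qed.
End SES.
End Scplx.

(** * Central simple algebras and their index *)

Section VspacePred.
Variables (F : fieldType) (V : vectType F).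

(** A subspace of largest dimension inside [P] must contain every [x] in [P], since the line through
    [x] could otherwise be added. *)
Lemma vspace_of_pred (P : V -> Prop) : lsub P ->
  exists U : {vspace V}, forall x, (x \in U) <-> P x.
Proof.
move=> hP; pose Q n := `[< exists2 U : {vspace V}, \dim U = n & forall x, x \in U -> P x >].
have Q0 : exists n, Q n.
  exists 0%N; apply/asboolP; exists 0%VS; rewrite ?dimv0 // => x.
  by rewrite memv0 => /eqP ->; case: hP.
have Qle n : Q n -> (n <= \dim {:V})%N.
  by move=> /asboolP[U <- _]; apply/dimvS/subvf.
have [n /asboolP[U <- hU] hmax] := ex_maxnP Q0 Qle.
exists U => x; split=> [/hU//|Px].
have : (\dim (U + <[x]>) <= \dim U)%N.
  apply: hmax; apply/asboolP; exists (U + <[x]>)%VS => // _ /memv_addP[u Uu [_ /vlineP[a ->] ->]].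
  by apply: lsubD => //; [apply: hU | apply: lsubZ].
rewrite (geq_leqif (dimv_leqif_sup (addvSl U <[x]>))) => /subvP; apply.
by rewrite memvE addvSr.
Qed.

Lemma dim_linear_onto (W : vectType F) (f : V -> W) (U : {vspace W}) : linear f ->
  injective f -> (forall w, (w \in U) <-> exists v, w = f v) -> \dim U = \dim {:V}.
Proof.
move=> fl fi fU; pose g := linfun (HB.pack f (GRing.isSemilinear.Build _ _ _ _ f (GRing.semilinear_linear fl)) : {linear V -> W}).
have gE x : g x = f x by rewrite lfunE.
have -> : U = (g @: fullv)%VS.
  apply/vspaceP => w; apply/idP/idP => [/fU[v ->]|/memv_imgP[v _ ->]].
    by rewrite -gE memv_img ?memvf.
  by apply/fU; exists v; rewrite gE.
apply/limg_dim_eq/eqP; rewrite capfv -subv0; apply/subvP => x.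
by rewrite memv_ker memv0 gE => /eqP e; rewrite -(inj_eq fi) e -gE linear0.
Qed.

End VspacePred.

Lemma dim_ffun (F : fieldType) (I : finType) (V : vectType F) :
  \dim {:{ffun I -> V}} = (#|I| * \dim {:V})%N.
Proof. by rewrite !dimvf. Qed.

(** Surjectivity of the map from [B] tensor [B^op] to [End_F(B)]. It is equivalent to being central
    simple, and it is the form that passes directly to tensor products. *)
Definition azumaya (F : fieldType) (B : falgType F) :=
  forall phi : B -> B, linear phi ->
  exists s : seq (B * B), forall x, phi x = \sum_(p <- s) p.1 * x * p.2.

Section CentralSimple.
Variables (F : fieldType) (B : falgType F).

Definition simple_alg := forall P : B -> Prop, lsub P ->
  (forall y z x, P x -> P (y * x * z)) -> forall c, c != 0 -> P c -> forall x, P x.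

Definition central_alg := forall z : B, (forall x, z * x = x * z) -> exists a : F, z = a%:A.

Lemma central_simpleP : central_simple B <-> central_alg /\ simple_alg.
Proof.
split=> [[hZ hS]|[hZ hS]]; split.
- move=> z hz; have : z \in 'Z({:B})%VS.
    by rewrite memv_cap memvf; apply/centvP => x _.
  by rewrite hZ => /vlineP[a ->]; exists a.
- move=> P hP hPm c c0 Pc; have [U hU] := vspace_of_pred hP.
  have [||U0|UT] := hS U.
  + by apply/prodvP => x y _ /hU Py; apply/hU; rewrite -[x * y]mulr1; apply: hPm.
  + by apply/prodvP => x y /hU Px _; apply/hU; rewrite -[x]mul1r; apply: hPm.
  + by move/hU: Pc; rewrite U0 memv0 (negPf c0).
  + by move=> x; apply/hU; rewrite UT memvf.
- apply/vspaceP => z; apply/idP/vlineP => [|[a ->]].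
    by rewrite memv_cap => /andP[_ /centvP h]; apply: hZ => x; apply: h; rewrite memvf.
  rewrite memv_cap memvf; apply/centvP => x _.
  by rewrite -scalerAl -scalerAr mul1r mulr1.
move=> U hl hr; have [->|/eqP U0] := eqVneq U 0%VS; [by left | right].
apply/vspaceP => x; rewrite memvf.
have hP : lsub (fun x => x \in U).
  by split=> [|a y z hy hz]; rewrite ?mem0v ?memvD ?memvZ.
apply: (hS _ hP _ (vpick U)); rewrite ?vpick0 ?memv_pick //; last exact/eqP.
move=> y z t Ut; apply: (subvP hr); rewrite memv_mul ?memvf //.
by apply: (subvP hl); rewrite memv_mul ?memvf.
Qed.

Hypotheses (hZ : central_alg) (hS : simple_alg).

(** The right-hand sides form the two-sided ideal generated by [c]. *)
Lemma simple_span c : c != 0 -> exists s : seq (B * B), 1 = \sum_(p <- s) p.1 * c * p.2.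
Proof.
move=> c0; pose P (x : B) := exists s : seq (B * B), x = \sum_(p <- s) p.1 * c * p.2.
apply: (hS (P := P) _ _ c0).
- split; first by exists [::]; rewrite big_nil.
  move=> a _ _ [s ->] [t ->]; exists ([seq (a *: p.1, p.2) | p <- s] ++ t).
  rewrite big_cat big_map /= scaler_sumr; congr (_ + _).
  by apply: eq_bigr => p _; rewrite -!scalerAl.
- move=> y z _ [s ->]; exists [seq (y * p.1, p.2 * z) | p <- s].
  by rewrite big_map mulr_sumr mulr_suml; apply: eq_bigr => p _; rewrite !mulrA.
by exists [:: (1, 1)]; rewrite big_seq1 mul1r mulr1.
Qed.

(* A relation with the fewest nonzero b_i can be normalised to have some
   b_i = 1; commutators then shorten it, so that all b_i are central. *)
Lemma sandwich_free (b : 'I_(\dim {:B}) -> B) :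
  (forall x, \sum_i b i * x * bas i = 0) -> forall i, b i = 0.
Proof.
have [m] := ubnP #|[pred i | b i != 0]|; elim: m b => // m IH b; rewrite ltnS => hm hb i.
apply/eqP/negPn/negP => bi0.
have [s hs] := simple_span bi0.
pose b' j := \sum_(p <- s) p.1 * b j * p.2.
have hb' x : \sum_j b' j * x * bas j = 0.
  transitivity (\sum_(p <- s) p.1 * \sum_j b j * (p.2 * x) * bas j); last first.
    by apply: big1 => p _; rewrite hb mulr0.
  under [RHS]eq_bigr do rewrite mulr_sumr.
  rewrite exchange_big /=; apply: eq_bigr => j _; rewrite !mulr_suml.
  by apply: eq_bigr => p _; rewrite !mulrA.
have hc j : exists a : F, b' j = a%:A.
  apply: hZ => y; apply/eqP; rewrite -subr_eq0; apply/eqP.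
  apply: (IH (fun j => b' j * y - y * b' j)).
    apply: leq_trans hm; apply: proper_card; apply/properP; split.
      apply/fintype.subsetP => k; rewrite !inE; apply: contraNneq => bk.
      by rewrite /b' bk big1 ?mulr0 ?mul0r ?subr0 // => p _; rewrite mulr0 mul0r.
    by exists i; rewrite !inE // /b' -hs mul1r mulr1 subrr eqxx.
  move=> x; under eq_bigr do rewrite !mulrBl.
  rewrite sumrB; under eq_bigr do rewrite -[_ * y * x]mulrA.
  rewrite hb' sub0r; under eq_bigr do rewrite -!mulrA.
  by rewrite -mulr_sumr; under eq_bigr do rewrite mulrA; rewrite hb' mulr0 oppr0.
have {hc} /choice[a ha] := hc.
have := hb' 1; under eq_bigr do rewrite ha mulr1 -scalerAl mul1r.
move=> e; have /freeP/(_ _ e i) ai := basis_free (vbasisP {:B}).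
by have := ha i; rewrite /b' -hs ai scale0r => /eqP; rewrite oner_eq0.
Qed.

(** The sandwich maps are the image of [B^n] in [End(B)], with [n] the dimension of [B]. By
    [sandwich_free] the map is injective, and both sides have dimension [n^2]. *)
Lemma sandwich_onto (phi : B -> B) : linear phi ->
  exists b : 'I_(\dim {:B}) -> B, forall x, phi x = \sum_i b i * x * bas i.
Proof.
move=> philin.
pose T (b : {ffun 'I_(\dim {:B}) -> B}) : 'End(B) := \sum_i (amull (b i) \o amulr (bas i))%VF.
have TE b x : T b x = \sum_i b i * x * bas i.
  by rewrite sum_lfunE; apply: eq_bigr => i _; rewrite comp_lfunE !lfunE /= mulrA.
have Tlin : linear T.
  move=> a b c; apply/lfunP => x; rewrite add_lfunE scale_lfunE !TE scaler_sumr -big_split /=.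
  by apply: eq_bigr => i _; rewrite !ffunE !mulrDl -!scalerAl.
have Tinj : injective T.
  move=> b c /eqP; rewrite -subr_eq0 => /eqP e; apply/ffunP => i; apply/eqP; rewrite -subr_eq0.
  apply/eqP; apply: (sandwich_free (b := fun i => b i - c i)) => x.
  rewrite -[RHS](zero_lfunE _ x) -e add_lfunE opp_lfunE !TE -sumrB.
  by apply: eq_bigr => j _; rewrite !mulrBl.
have hP : lsub (fun f : 'End(B) => exists b, f = T b).
  split; first by exists 0; apply/lfunP => x; rewrite TE zero_lfunE big1 // => i _; rewrite ffunE !mul0r.
  by move=> a _ _ [b ->] [c ->]; exists (a *: b + c); rewrite Tlin.
have [U hU] := vspace_of_pred hP.
have dU := dim_linear_onto Tlin Tinj hU.
have UT : U = fullv.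
  apply/eqP; by rewrite -(dimv_leqif_eq (subvf U)) dU dim_ffun card_ord !dimvf.
pose g := linfun (HB.pack phi (GRing.isSemilinear.Build _ _ _ _ phi (GRing.semilinear_linear philin)) : {linear B -> B}).
have /hU[b gb] : g \in U by rewrite UT memvf.
by exists b => x; rewrite -TE -gb lfunE.
Qed.

Lemma csa_azumaya : azumaya B.
Proof.
move=> phi /sandwich_onto[b hb]; exists [seq (b i, bas i) | i <- enum 'I_(\dim {:B})].
by move=> x; rewrite hb big_map /= big_enum.
Qed.

End CentralSimple.

(** Rank-one endomorphisms [phi] with [phi c = x] and values in the line of [x] are sandwich sums.
    For [c = x = 1] such a map sends a central [z] to itself, so [z] is scalar; for [c] in an ideal
    it shows that [x] lies there too. *)
Lemma azumaya_csa (F : fieldType) (B : falgType F) : azumaya B -> central_simple B.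
Proof.
move=> hB.
have key (c x : B) : c != 0 -> exists (phi : B -> B) (s : seq (B * B)),
    [/\ phi c = x, forall y, exists a : F, phi y = a *: x
      & forall y, phi y = \sum_(p <- s) p.1 * y * p.2].
  move=> c0; have [i ci] : exists i, crd i c != 0.
    apply: contrapT => /forallNP h; move: c0; rewrite (crd_expand c) big1 ?eqxx // => i _.
    by have /negP := h i; rewrite negbK => /eqP ->; rewrite scale0r.
  pose phi (y : B) := ((crd i c)^-1 * crd i y) *: x.
  have phil : linear phi.
    move=> a y z; rewrite /phi /crd linearP /= mulrDr scalerDl scalerA.
    by congr (_ *: _ + _); rewrite mulrCA.
  have [s hs] := hB _ phil; exists phi, s; split=> // [|y].
    by rewrite /phi mulVf ?scale1r.
  by exists ((crd i c)^-1 * crd i y).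
apply/central_simpleP; split.
  move=> z hz; have [phi [s [phi1 phia hs]]] := key 1 1 (oner_neq0 _).
  have [a ha] := phia z; exists a; rewrite -ha hs.
  rewrite -[LHS]mulr1 -[X in z * X]phi1 hs mulr_sumr.
  by apply: eq_bigr => p _; rewrite mulr1 !mulrA hz.
move=> P hP hPm c c0 Pc x; have [phi [s [phic _ hs]]] := key c x c0.
by rewrite -phic hs; apply: lsub_sum => // p _; apply: hPm.
Qed.

(* A subspace maximal among those on which multiplication commutes is its own
   centralizer K, and End_K(D) is K^n on one side and D^(dim_K D) on the other. *)
Lemma dim_division_square (F : fieldType) (D : falgType F) :
  (forall x : D, x != 0 -> x \is a GRing.unit) -> central_alg D ->
  exists e, \dim {:D} = (e ^ 2)%N.
Proof.
move=> hD hZ.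
have hS : simple_alg D.
  move=> P hP hPm c c0 Pc x; rewrite -[x]mulr1 -(mulVr (hD _ c0)) mulrA -[_ * c]mulr1.
  exact: hPm.
pose Q n := `[< exists2 U : {vspace D}, \dim U = n & (U <= 'C(U))%VS >].
have Q0 : exists n, Q n by exists 0%N; apply/asboolP; exists 0%VS; rewrite ?dimv0 ?sub0v.
have Qle n : Q n -> (n <= \dim {:D})%N by move=> /asboolP[U <- _]; apply/dimvS/subvf.
have [n0 /asboolP[U dU hU] hmax] := ex_maxnP Q0 Qle.
have UC : U = 'C(U)%VS.
  apply/eqP; rewrite eqEsubv hU /=; apply/subvP => x xC.
  have : (\dim (U + <[x]>) <= \dim U)%N.
    rewrite dU; apply: hmax; apply/asboolP; exists (U + <[x]>)%VS => //.
    apply/centvsP => _ _ /memv_addP[u Uu [_ /vlineP[a ->] ->]] /memv_addP[v Uv [_ /vlineP[b ->] ->]].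
    have uv : u * v = v * u by apply: (centvsP hU).
    have xu : x * u = u * x by apply: (centvP xC).
    have xv : x * v = v * x by apply: (centvP xC).
    rewrite !mulrDl !mulrDr -!scalerAl -!scalerAr uv xu xv -!addrA; congr (_ + _).
    by rewrite addrCA !scalerA [a * b]mulrC.
  rewrite (geq_leqif (dimv_leqif_sup (addvSl U <[x]>))) => /subvP; apply.
  by rewrite memvE addvSr.
pose K : {aspace D} := 'C(U)%AS.
have KC : (K : {vspace D}) = 'C(K)%VS by exact: (congr1 (fun V => 'C(V)%VS) UC).
have [X [sumX dirX nzX]] := skew_field_module_semisimple hD (subvf (K * fullv)%VS).

have [m [d [dgen dind dn]]] : exists m (d : 'I_m -> D),
    [/\ forall x, exists2 c : 'I_m -> D, (forall i, c i \in K) & x = \sum_i c i * d i,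
        forall c : 'I_m -> D, (forall i, c i \in K) -> \sum_i c i * d i = 0 -> forall i, c i = 0
      & \dim {:D} = (m * \dim K)%N].
  move: dirX; rewrite directvE /=; move: sumX => /=; rewrite !(big_tnth _ _ X).
  set d := tnth (in_tuple X) => sumX dirX.
  have dnz i : d i != 0 by apply: contraNneq nzX => <-; apply: mem_tnth.
  have dir : directv (\sum_i K * <[d i]>)%VS by rewrite directvE /=.
  exists (size X), d; split.
  - move=> x; have : x \in (\sum_i K * <[d i]>)%VS by rewrite sumX memvf.
    move=> /memv_sumP[u hu ->].
    have /choice[c hc] i : exists c, c \in K /\ u i = c * d i.
      by have := hu i isT; rewrite -limg_amulr => /memv_imgP[c Kc ->]; exists c; rewrite lfunE.
    by exists c => [i|]; [case: (hc i) | apply: eq_bigr => i _; case: (hc i)].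
  - move=> c Kc e0 i; apply: (mulIr (hD _ (dnz i))); rewrite mul0r.
    apply: (directv_sum_independent dir (fun i => c i * d i)) => // j _.
    exact: memv_mul (Kc j) (memv_line _).
  - rewrite -sumX (directvP dir) /= (eq_bigr (fun=> \dim K)) => [|i _].
      by rewrite sum_nat_const card_ord.
    by rewrite dim_cosetv_unit ?hD.
have /choice[cx hcx] x : exists c : 'I_m -> D, (forall i, c i \in K) /\ x = \sum_i c i * d i.
  by have [c] := dgen x; exists c.
have cxK x i : cx x i \in K by case: (hcx x).
have cxE x : x = \sum_i cx x i * d i by case: (hcx x).
have cx_uniq x (c : 'I_m -> D) : (forall i, c i \in K) -> x = \sum_i c i * d i -> forall i, cx x i = c i.
  move=> Kc ex i; apply/eqP; rewrite -subr_eq0; apply/eqP.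
  apply: (dind (fun i => cx x i - c i)) => [j|]; first by rewrite memvB.
  under eq_bigr do rewrite mulrBl.
  by rewrite sumrB -cxE -ex subrr.
(* The [K]-linear endomorphism [x |-> \sum_j b j * x * bas j], recorded by its values on the
   [K]-basis [d]. Bijectivity of [T] equates [\dim D * \dim K] with [m * \dim D], hence
   [m = \dim K]. *)
pose T (b : {ffun 'I_(\dim {:D}) -> subvs_of K}) : {ffun 'I_m -> D} :=
  [ffun i => \sum_j vsval (b j) * d i * bas j].
have Tlin : linear T.
  move=> a b c; apply/ffunP => i; rewrite !ffunE scaler_sumr -big_split /=.
  by apply: eq_bigr => j _; rewrite !ffunE linearP !mulrDl -!scalerAl.
have KU y v : y \in K -> v \in K -> y * v = v * y.
  by move=> yK vK; move: (yK); rewrite KC => /centvP; apply.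
have Tinj : injective T.
  move=> b c /eqP; rewrite -subr_eq0 => /eqP e; apply/ffunP => j; apply: val_inj; apply/eqP.
  rewrite -subr_eq0; apply/eqP.
  apply: (sandwich_free hZ hS (b := fun j => vsval (b j) - vsval (c j))) => x.
  rewrite (cxE x); under eq_bigr do rewrite mulr_sumr mulr_suml.
  rewrite exchange_big big1 //= => i _.
  transitivity (cx x i * (T b - T c) i); last by rewrite e ffunE mulr0.
  rewrite !ffunE -sumrB mulr_sumr; apply: eq_bigr => j' _.
  rewrite -!mulrBl !mulrA; congr (_ * _ * _); apply: KU => //.
  by rewrite memvB ?subvsP.
have Tonto w : (w \in fullv) <-> exists v, w = T v.
  rewrite memvf; split=> // _.
  pose phi x := \sum_i cx x i * w i.
  have cxL a x y i : cx (a *: x + y) i = a *: cx x i + cx y i.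
    apply: (cx_uniq _ (fun i => a *: cx x i + cx y i)) => [j|]; first by rewrite memvD ?memvZ.
    rewrite {1}(cxE x) {1}(cxE y) scaler_sumr -big_split /=.
    by apply: eq_bigr => j _; rewrite mulrDl scalerAl.
  have phil : linear phi.
    move=> a x y; rewrite /phi scaler_sumr -big_split /=.
    by apply: eq_bigr => j _; rewrite cxL mulrDl scalerAl.
  have cxM y x i : y \in K -> cx (y * x) i = y * cx x i.
    move=> yK; apply: (cx_uniq _ (fun i => y * cx x i)) => [j|]; first exact: memvM.
    by rewrite {1}(cxE x) mulr_sumr; apply: eq_bigr => j _; rewrite mulrA.
  have [b hb] := sandwich_onto hZ hS phil.
  (* [phi] commutes with left multiplication by [K]; by uniqueness of sandwich expressions each
     [b j] then commutes with [K], hence lies in it. *)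
  have bK j : b j \in K.
    rewrite KC; apply/centvP => y yK; apply/eqP; rewrite -subr_eq0; apply/eqP.
    apply: (sandwich_free hZ hS (b := fun j => b j * y - y * b j)) => x.
    under eq_bigr do rewrite !mulrBl -[_ * y * x]mulrA -[y * _ * x]mulrA -[y * _ * _]mulrA.
    rewrite sumrB -mulr_sumr -!hb /phi mulr_sumr -sumrB big1 // => i _.
    by rewrite cxM // mulrA subrr.
  exists [ffun j => vsproj K (b j)]; apply/ffunP => i; rewrite ffunE.
  under eq_bigr do rewrite ffunE vsprojK //.
  rewrite -hb /phi (bigD1 i) //= (cx_uniq (d i) (fun j => (j == i)%:R)) ?eqxx ?mul1r.
  - rewrite big1 ?addr0 // => j /negPf ji.
    rewrite (cx_uniq (d i) (fun j => (j == i)%:R)) ?ji ?mul0r // => [j'|].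
      by case: eqP => _; rewrite ?mem0v // -(skew_field_algid1 hD K) memv_algid.
    rewrite (bigD1 i) //= eqxx mul1r big1 ?addr0 // => j' /negPf ->.
    by rewrite mul0r.
  - by move=> j'; case: eqP => _; rewrite ?mem0v // -(skew_field_algid1 hD K) memv_algid.
  rewrite (bigD1 i) //= eqxx mul1r big1 ?addr0 // => j' /negPf ->.
  by rewrite mul0r.
have := dim_linear_onto Tlin Tinj Tonto.
rewrite !dim_ffun !card_ord [\dim {: subvs_of K}]dimvf => e.
have Dgt0 : (0 < \dim {:D})%N by rewrite dimvf FalgType_proper.
have mk : m = \dim K.
  by apply/eqP; rewrite -(eqn_pmul2r Dgt0) e mulnC.
by exists m; rewrite dn -mk mulnn.
Qed.

Section MinimalIdeal.
Variables (F : fieldType) (C : falgType F).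
Hypothesis hS : simple_alg C.
Implicit Types (U : {vspace C}).

Lemma minimal_right_idealP U : minimal_right_ideal U <->
  [/\ forall u x, u \in U -> u * x \in U, U != 0%VS
    & forall u v, u \in U -> u != 0 -> v \in U -> exists x, v = u * x].
Proof.
split=> [[h1 h2 h3]|[h1 h2 h3]].
  have hm u x : u \in U -> u * x \in U by move=> uU; apply: (subvP h1); rewrite memv_mul ?memvf.
  split=> // u v uU u0 vU.
  have := h3 (<[u]> * fullv)%VS; case.
  - by rewrite -prodvA prodvSr ?subvf.
  - by apply/prodvP => _ y /vlineP[a ->] _; rewrite -scalerAl memvZ ?hm.
  - move=> e; have : u \in (<[u]> * fullv)%VS by rewrite -[X in X \in _]mulr1 memv_mul ?memvf ?memv_line.
    by rewrite e memv0 (negPf u0).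
  move=> e; move: vU; rewrite -e.
  have P : lsub (fun v => exists x, v = u * x).
    split; first by exists 0; rewrite mulr0.
    by move=> a _ _ [x ->] [y ->]; exists (a *: x + y); rewrite mulrDr scalerAr.
  have [W hW] := vspace_of_pred P.
  suff : (<[u]> * fullv <= W)%VS by move=> /subvP hs /hs /hW.
  apply/prodvP => _ y /vlineP[a ->] _; apply/hW; exists (a *: y).
  by rewrite -scalerAl scalerAr.
split=> //; first by apply/prodvP => u x uU _; apply: h1.
move=> V hV VU; have [->|V0] := eqVneq V 0%VS; [by left | right].
apply/eqP; rewrite eqEsubv VU; apply/subvP => v vU.
have [||x ->] := h3 (vpick V) v _ _ vU; rewrite ?vpick0 ?(subvP VU) ?memv_pick //.
by apply: (subvP hV); rewrite memv_mul ?memvf ?memv_pick.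
Qed.

Lemma minimal_right_ideal_exists : exists U, minimal_right_ideal U.
Proof.
pose Q n := `[< exists U : {vspace C}, [/\ (U * fullv <= U)%VS, U != 0%VS & \dim U = n] >].
have Q0 : exists n, Q n.
  exists (\dim {:C}); apply/asboolP; exists fullv; split=> //; first exact: subvf.
  by rewrite -dimv_eq0 dimvf -lt0n FalgType_proper.
have [n /asboolP[U [h1 h2 <-]] hmin] := ex_minnP Q0.
exists U; split=> // V hV VU; have [->|V0] := eqVneq V 0%VS; [by left | right].
apply/eqP; rewrite -(geq_leqif (dimv_leqif_eq VU)).
by apply: hmin; apply/asboolP; exists V.
Qed.

Variable U : {vspace C}.
Hypothesis hU : minimal_right_ideal U.

(** Brauer's lemma. Simplicity gives [u] and [v] in [U] with [u * v != 0]; then [u * v] generates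
    [U], so [u = u * eps] with [eps] in [U]. Left multiplication by [u] is injective on [U], which
    turns this into [eps * eps = eps]. *)
Lemma minimal_idempotent : exists eps, [/\ eps \in U, eps != 0, eps * eps = eps
  & forall u, u \in U -> eps * u = u].
Proof.
have /minimal_right_idealP[h1 h2 h3] := hU.
have [u [v [uU vU uv]]] : exists u v, [/\ u \in U, v \in U & u * v != 0].
  apply: contrapT => hn.
  have hn' u v : u \in U -> v \in U -> u * v = 0.
    by move=> uU vU; apply/eqP/negPn/negP => h; apply: hn; exists u, v.
  have p0 : vpick U != 0 by rewrite vpick0.
  have [s e] := simple_span hS p0.
  have := p0; rewrite -[vpick U]mulr1 e mulr_sumr big1 ?eqxx // => p _.
  rewrite !mulrA -[_ * p.1 * _]mulrA.
  have -> : vpick U * (p.1 * vpick U) = 0; last by rewrite mul0r.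
  by rewrite mulrA hn' ?h1 ?memv_pick.
have [eps [epsU ue]] : exists eps, eps \in U /\ u = u * eps.
  have [|x ex] := h3 (u * v) u _ uv uU; first exact: h1.
  by exists (v * x); rewrite h1 // mulrA.
have u0 : u != 0 by apply: contraNneq uv => ->; rewrite mul0r.
have ann w : w \in U -> u * w = 0 -> w = 0.
  move=> wU uw; apply/eqP/negPn/negP => w0.
  have [x vx] := h3 w v wU w0 vU.
  by move: uv; rewrite vx mulrA uw mul0r eqxx.
have eps0 : eps != 0 by apply: contraNneq u0 => e0; rewrite ue e0 mulr0.
have ee : eps * eps = eps.
  apply/eqP; rewrite -subr_eq0; apply/eqP/ann; first by rewrite memvB ?h1.
  by rewrite mulrBr mulrA -ue -ue subrr.
exists eps; split=> // w wU; have [x ->] := h3 eps w epsU eps0 wU.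
by rewrite mulrA ee.
Qed.

Variable eps : C.
Hypotheses (epsU : eps \in U) (eps0 : eps != 0) (epsM : eps * eps = eps).
Hypothesis epsl : forall u, u \in U -> eps * u = u.

Lemma minimal_divides u : u \in U -> u != 0 -> exists x, u * x = eps.
Proof.
have /minimal_right_idealP[_ _ h3] := hU.
by move=> uU u0; have [x ex] := h3 u eps uU u0 epsU; exists x.
Qed.

Lemma minimal_mem x : eps * x \in U.
Proof. by have /minimal_right_idealP[h1 _ _] := hU; apply: h1. Qed.

(** Schur's lemma: [eps C eps] is a division ring. Minimality of [U] provides right inverses only; a
    right inverse of the right inverse must be the element itself, so the inverse is two-sided. *)
Lemma corner_inv c : eps * c = c -> c * eps = c -> c != 0 ->
  exists y, [/\ eps * y = y, y * eps = y & y * c = eps].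
Proof.
have main c' : eps * c' = c' -> c' * eps = c' -> c' != 0 ->
    exists y, [/\ eps * y = y, y * eps = y & c' * y = eps].
  move=> e1 e2 c0; have [|x ex] := minimal_divides _ c0; first by rewrite -e1 minimal_mem.
  exists (eps * x * eps); rewrite !mulrA epsM e2 ex -!mulrA epsM; split=> //.
move=> e1 e2 c0; have [y [y1 y2 y3]] := main c e1 e2 c0.
have y0 : y != 0 by apply: contraNneq eps0 => e; rewrite -y3 e mulr0.
have [z [z1 z2 z3]] := main y y1 y2 y0.
exists y; split=> //; suff -> : c = z by [].
by rewrite -e2 -z3 mulrA y3 z1.
Qed.

(** Generators of [C eps] and [eps C] over the corner [eps C eps]. Once [b i * a j] is [eps] or [0]
    as [i] and [j] agree or not, the [b i * x * a j] are matrix coordinates on [C]. *)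
Definition dual_bases r (a b : 'I_r -> C) :=
  [/\ \sum_i a i * b i = 1, forall i, a i * eps = a i & forall i, eps * b i = b i].

(* A relation between the b_i would allow a shorter expression of 1. *)
Lemma dual_bases_exist : exists r (a b : 'I_r.+1 -> C), dual_bases a b /\
  forall i j, b i * a j = if i == j then eps else 0.
Proof.
pose Q n := `[< exists a b : 'I_n -> C, dual_bases a b >].
have Q0 : exists n, Q n.
  have [s hs] := simple_span hS eps0.
  exists (size s); apply/asboolP.
  exists (fun i => (tnth (in_tuple s) i).1 * eps), (fun i => eps * (tnth (in_tuple s) i).2).
  split=> [|i|i]; last by rewrite mulrA epsM.
    by rewrite hs [RHS]big_tnth; apply: eq_bigr => i _; rewrite mulrA -[_ * eps * eps]mulrA epsM.
  by rewrite -mulrA epsM.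
have [[|r] /asboolP[a [b hab]] hmin] := ex_minnP Q0.
  by case: hab; rewrite big_ord0 => /esym/eqP; rewrite oner_eq0.
exists r, a, b; split=> //; have [h1 ha hb] := hab.
have ind (c : 'I_r.+1 -> C) : (forall i, eps * c i = c i) -> (forall i, c i * eps = c i) ->
    \sum_i c i * b i = 0 -> forall i, c i = 0.
  move=> c1 c2 cb j; apply/eqP/negPn/negP => cj0.
  have [y [y1 y2 y3]] := corner_inv (c1 j) (c2 j) cj0.
  suff : (r.+1 <= r)%N by rewrite ltnn.
  apply: hmin; apply/asboolP.
  exists (fun i => a (lift j i) - a j * y * c (lift j i)), (fun i => b (lift j i)).
  split=> [|i|i]; last exact: hb.
    have : y * (\sum_i c i * b i) = 0 by rewrite cb mulr0.
    rewrite (bigD1_ord j) //= mulrDr mulrA y3 hb => /eqP; rewrite addr_eq0 => /eqP bj.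
    move: h1; rewrite (bigD1_ord j) //= {1}bj => <-.
    under eq_bigr do rewrite mulrBl; rewrite sumrB addrC mulrN; congr (_ - _).
    by rewrite mulrA mulr_sumr; apply: eq_bigr => i _; rewrite mulrA.
  by rewrite mulrBl ha -[_ * c _ * eps]mulrA c2.
move=> i j; apply/eqP; rewrite -subr_eq0; apply/eqP.
apply: (ind (fun j => b i * a j - if i == j then eps else 0)) => [j'|j'|].
- by rewrite mulrBr mulrA hb; case: eqP; rewrite ?epsM ?mulr0.
- by rewrite mulrBl -mulrA ha; case: eqP; rewrite ?epsM ?mul0r.
under eq_bigr do rewrite mulrBl.
rewrite sumrB [X in _ - X](bigD1 i) //= eqxx hb [X in _ - (_ + X)]big1 ?addr0; last first.
  by move=> j' /negPf ji; rewrite eq_sym ji mul0r.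
by under eq_bigr do rewrite -mulrA; rewrite -mulr_sumr h1 mulr1 subrr.
Qed.

Lemma corner_lsub : lsub (fun c => eps * c = c /\ c * eps = c).
Proof.
split; first by rewrite mulr0 mul0r.
by move=> a x y [x1 x2] [y1 y2]; rewrite mulrDr mulrDl -scalerAr -scalerAl x1 x2 y1 y2.
Qed.

End MinimalIdeal.

(** Wedderburn's theorem with [D = eps C eps] and matrix entries [b i * x * a j]. A central element
    of [D] gives a central scalar matrix, so the centre of [D] is [F] and [dim_division_square]
    applies. *)
Lemma is_index_exists (F : fieldType) (C : falgType F) :
  central_alg C -> simple_alg C -> exists e, is_index C e.
Proof.
move=> hZ hS; have [U hU] := minimal_right_ideal_exists C.
have [eps [epsU eps0 epsM epsl]] := minimal_idempotent hS hU.
have [E hE] := vspace_of_pred (corner_lsub eps).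
have E_asp : is_aspace E.
  apply/andP; split.
    apply/has_algidP; exists eps; split=> //; first by apply/hE.
    by move=> u /hE[].
  apply/prodvP => x y /hE[x1 x2] /hE[y1 y2]; apply/hE.
  by rewrite mulrA x1 -mulrA y2.
pose Ea := ASpace E_asp; pose D : falgType F := subvs_of Ea.
(* The corner is an algebra with unit [eps], not [1], and [algid] is that unit. *)
have idE : algid Ea = eps.
  have /hE[e1 _] : algid Ea \in E by exact: memv_algid.
  have epsE : eps \in Ea by apply/hE.
  by rewrite -e1 algidr.
have [r [a [b [[ab1 ha hb] hba]]]] := dual_bases_exist hS hU epsU eps0 epsM.
have bE x i j : b i * x * a j \in Ea.
  by apply/hE; rewrite !mulrA hb -[_ * a j * eps]mulrA ha.
pose f (x : C) : 'M[D]_r.+1 := \matrix_(i, j) vsproj Ea (b i * x * a j).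
have fE x i j : vsval (f x i j) = b i * x * a j by rewrite mxE vsprojK.
have fB : zmod_morphism f.
  by move=> x y; apply/matrixP => i j; apply: val_inj; rewrite !mxE /= !vsprojK // mulrBr mulrBl.
have fM : monoid_morphism f.
  split=> [|x y].
    apply/matrixP => i j; apply: val_inj; rewrite /= fE mulr1 hba !mxE.
    by case: eqP => _ /=; rewrite ?idE.
  apply/matrixP => i j; apply: val_inj; rewrite /= fE mxE linear_sum /=.
  have -> : b i * (x * y) * a j = \sum_k b i * x * (a k * b k) * y * a j.
    by rewrite -!mulr_suml -mulr_sumr ab1 mulr1 !mulrA.
  by apply: eq_bigr => k _; rewrite !fE !mulrA.
pose g (M : 'M[D]_r.+1) := \sum_i \sum_j a i * vsval (M i j) * b j.
have fK : cancel f g.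
  move=> x; rewrite /g; under eq_bigr => i _ do under eq_bigr => j _ do rewrite fE !mulrA.
  transitivity (\sum_i a i * b i * x * \sum_j a j * b j).
    by apply: eq_bigr => i _; rewrite mulr_sumr; apply: eq_bigr => j _; rewrite !mulrA.
  by rewrite ab1 -!mulr_suml ab1 mulr1 mul1r.
have gK : cancel g f.
  move=> M; apply/matrixP => i j; apply: val_inj; rewrite /= fE.
  have -> : b i * g M * a j = \sum_k \sum_l b i * a k * vsval (M k l) * (b l * a j).
    rewrite /g mulr_sumr mulr_suml; apply: eq_bigr => k _.
    by rewrite mulr_sumr mulr_suml; apply: eq_bigr => l _; rewrite !mulrA.
  rewrite (bigD1 i) //= [X in _ + X]big1 => [|k /negPf ki]; last first.
    by apply: big1 => l _; rewrite hba eq_sym ki !mul0r.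
  rewrite addr0 (bigD1 j) //= [X in _ + X]big1 => [|l lj]; last first.
    by rewrite [b l * _]hba (negPf lj) mulr0.
  rewrite addr0 !hba !eqxx; have /hE[e1 e2] : vsval (M i j) \in E by exact: subvsP.
  by rewrite e1 e2.
pose fR : {rmorphism C -> 'M[D]_r.+1} := HB.pack f (GRing.isZmodMorphism.Build _ _ _ fB)
  (GRing.isMonoidMorphism.Build _ _ _ fM).
have Dinv (x : D) : x != 0 -> exists2 y : D, y != 0 & y * x = 1.
  move=> x0; have /hE[x1 x2] : vsval x \in E by exact: subvsP.
  have [|y [y1 y2 y3]] := corner_inv hU epsU eps0 epsM x1 x2.
    by apply: contraNneq x0 => e; apply/eqP/val_inj; rewrite /= e.
  have yE : y \in Ea by apply/hE.
  exists (vsproj Ea y); last by apply: val_inj; rewrite /= vsprojK // y3 idE.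
  apply: contraNneq eps0 => /(congr1 vsval); rewrite vsprojK //= => y0.
  by rewrite -y3 y0 mul0r.
have Ddiv (x : D) : x != 0 -> x \is a GRing.unit.
  move=> x0; have [y y0 yx] := Dinv x x0; have [z _ zy] := Dinv y y0.
  apply/unitrP; exists y; split=> //.
  by rewrite -[x]mul1r -zy -[z * y * x]mulrA yx mulr1.
have Dcent : central_alg D.
  move=> z hz.
  have [|c hc] := hZ (g z%:M).
    move=> x; apply: (can_inj fK); rewrite !fM.2 gK.
    apply/matrixP => i j; rewrite !mxE (bigD1 i) //= [in RHS](bigD1 j) //=.
    rewrite !mxE !eqxx !mulr1n big1 => [|k /negPf ki]; last by rewrite mxE eq_sym ki mul0r.
    rewrite [in RHS]big1 => [|k /negPf kj]; last by rewrite [z%:M _ _]mxE kj mulr0.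
    by rewrite !addr0 hz.
  exists c; apply: val_inj; rewrite /=.
  have := congr1 f hc; rewrite gK => /matrixP/(_ 0 0)/(congr1 vsval).
  rewrite fE [z%:M _ _]mxE eqxx mulr1n => ->.
  by rewrite -scalerAr mulr1 -scalerAl hba eqxx idE.
have [e dimD] := dim_division_square Ddiv Dcent.
exists e, D, r, fR; split=> //; first by exists g.
move=> c; apply/matrixP => i j; apply: val_inj; rewrite /= fE -scalerAr mulr1 -scalerAl hba !mxE.
by case: eqP => _ /=; rewrite ?idE ?scaler0.
Qed.

(* Column 0 of a suitable element identifies U with the row vectors over D. *)
Lemma is_index_dims (F : fieldType) (C : falgType F) e : is_index C e ->
  exists2 delta, \dim {:C} = (delta * delta)%N &
  forall U : {vspace C}, minimal_right_ideal U -> \dim U = (delta * e)%N.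
Proof.
move=> [D [n [f [hD [g fK gK] fA dD]]]].
have fL a x y i j : f (a *: x + y) i j = a *: f x i j + f y i j.
  rewrite rmorphD mxE -[a *: x]mulr_algl rmorphM fA !mxE (bigD1 i) //= !mxE eqxx mulr1n.
  rewrite big1 ?addr0 => [|k /negPf ki]; last by rewrite mxE eq_sym ki mul0r.
  by rewrite mulr_algl.
have gM x y : g (x *m y) = g x * g y by apply: (can_inj fK); rewrite rmorphM !gK.
(* [C] has dimension [(n+1)^2 e^2], and [U], a space of row vectors over [D], has dimension
   [(n+1) e^2], which is [delta * e]. *)
exists (n.+1 * e)%N.
  pose h x := [ffun p => f x p.1 p.2] : {ffun 'I_n.+1 * 'I_n.+1 -> D}.
  have hl : linear h by move=> a x y; apply/ffunP => p; rewrite !ffunE fL.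
  have hi : injective h.
    move=> x y /ffunP e0; apply: (can_inj fK); apply/matrixP => i j.
    by have := e0 (i, j); rewrite !ffunE.
  have := dim_linear_onto (U := fullv) hl hi; rewrite dim_ffun card_prod card_ord dD => <-; first by lia.
  move=> w; rewrite memvf; split=> // _; exists (g (\matrix_(i, j) w (i, j))).
  by apply/ffunP => -[i j]; rewrite ffunE gK mxE.
move=> U hU; have /minimal_right_idealP[h1 h2 h3] := hU.
have u0 : vpick U != 0 by rewrite vpick0.
set u := vpick U in u0; have uU : u \in U := memv_pick U.
have [i [j uij]] : exists i j, f u i j != 0.
  apply: contrapT => hn; move: u0; rewrite -[u]fK -[g _]fK; case/negP; apply/eqP.
  rewrite !fK; apply: (can_inj fK); rewrite rmorph0; apply/matrixP => i j; rewrite mxE.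
  by apply/eqP/negPn/negP => hij; apply: hn; exists i, j.
pose h (d : {ffun 'I_n.+1 -> D}) := u * g (\matrix_(i', j') if i' == j then d j' else 0).
have hf d i' j' : f (h d) i' j' = f u i' j * d j'.
  rewrite /h rmorphM gK mxE (bigD1 j) //= mxE eqxx big1 ?addr0 // => k /negPf kj.
  by rewrite mxE kj mulr0.
have hl : linear h.
  move=> a x y; apply: (can_inj fK); apply/matrixP => i' j'.
  by rewrite fL !hf !ffunE mulrDr scalerAr.
have hi : injective h.
  move=> x y exy; apply/ffunP => j'; have := hf x i j'; rewrite exy hf.
  by move/(mulrI (hD _ uij)).
have hU' : lsub (fun x => exists d, x = h d).
  split; first by exists 0; apply: (can_inj fK); apply/matrixP => i' j'; rewrite hf rmorph0 !mxE ffunE mulr0.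
  by move=> a _ _ [x ->] [y ->]; exists (a *: x + y); rewrite hl.
have := dim_linear_onto (U := U) hl hi; rewrite dim_ffun card_ord dD => -> //; first by lia.
move=> w; split=> [wU|[d ->]]; last exact: h1.
have hd0 : h [ffun j' => (j' == 0)%:R] != 0.
  apply: contraNneq uij => e0; have := hf [ffun j' => (j' == 0)%:R] i 0.
  by rewrite e0 rmorph0 !mxE ffunE eqxx mulr1 => <-.
have [x ->] := h3 _ w (h1 _ _ uU) hd0 wU.
exists [ffun j' => f x 0 j']; apply: (can_inj fK); apply/matrixP => i' j'.
rewrite hf rmorphM mxE (bigD1 0) //= hf !ffunE eqxx mulr1 big1 ?addr0 // => k /negPf k0.
by rewrite hf ffunE k0 mulr0 mul0r.
Qed.

Lemma ind_dims (F : fieldType) (C : falgType F) : central_alg C -> simple_alg C ->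
  exists2 delta, \dim {:C} = (delta * delta)%N &
  forall U : {vspace C}, minimal_right_ideal U -> \dim U = (delta * ind C)%N.
Proof.
move=> hZ hS; apply: is_index_dims.
have [e he] := is_index_exists hZ hS.
by rewrite /ind; apply: (xgetI 0%N he).
Qed.

Lemma linear_fun0 (R : pzRingType) (M N : lmodType R) (f : M -> N) : linear f -> f 0 = 0.
Proof.
by move=> fl; have := fl 1 0 0; rewrite !scale1r addr0 -{1}[f 0]addr0 => /addrI.
Qed.

Lemma linear_funZ (R : pzRingType) (M N : lmodType R) (f : M -> N) : linear f ->
  forall a x, f (a *: x) = a *: f x.
Proof. by move=> fl a x; have := fl a x 0; rewrite (linear_fun0 fl) !addr0. Qed.

Lemma linear_fun_sum (R : pzRingType) (M N : lmodType R) (f : M -> N) : linear f ->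
  forall (I : Type) (r : seq I) (P : pred I) (x : I -> M),
  f (\sum_(i <- r | P i) x i) = \sum_(i <- r | P i) f (x i).
Proof.
move=> fl I r P x; elim/big_rec2: _ => [|i u v _ <-]; first exact: linear_fun0.
by have := fl 1 (x i) v; rewrite !scale1r.
Qed.

(** * Dg modules over a central simple algebra *)

Section FinSupp.
Variables (R : nzRingType) (M : lmodType R) (I : choiceType).

(** Direct sum of copies of [M] over an index type that may be infinite, as those produced by Zorn's
    lemma are. The support is only bounded by some list, so that equality is pointwise. *)
Record fsum := FSum {
  fs_fun :> I -> M;
  fs_supp : exists s : seq I, forall i, i \notin s -> fs_fun i = 0 }.

HB.instance Definition _ := gen_eqMixin fsum.
HB.instance Definition _ := gen_choiceMixin fsum.
Implicit Types f g : fsum.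

Lemma fsumP f g : (forall i, f i = g i) -> f = g.
Proof.
case: f g => [f hf] [g hg] /= /funext e; case: _ / e in hg *.
by congr FSum; apply: Prop_irrelevance.
Qed.

Fact fs_zero_subproof : exists s : seq I, forall i, i \notin s -> (0 : M) = 0.
Proof. by exists [::]. Qed.
Definition fs_zero := @FSum (fun=> 0) fs_zero_subproof.
Fact fs_opp_subproof f : exists s : seq I, forall i, i \notin s -> - f i = 0.
Proof. by have [s hs] := fs_supp f; exists s => i /hs ->; rewrite oppr0. Qed.
Definition fs_opp f := FSum (fs_opp_subproof f).
Fact fs_add_subproof f g : exists s : seq I, forall i, i \notin s -> f i + g i = 0.
Proof.
have [s hs] := fs_supp f; have [t ht] := fs_supp g; exists (s ++ t) => i.
by rewrite mem_cat negb_or => /andP[/hs -> /ht ->]; rewrite addr0.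
Qed.
Definition fs_add f g := FSum (fs_add_subproof f g).
Fact fs_scale_subproof a f : exists s : seq I, forall i, i \notin s -> a *: f i = 0.
Proof. by have [s hs] := fs_supp f; exists s => i /hs ->; rewrite scaler0. Qed.
Definition fs_scale a f := FSum (fs_scale_subproof a f).

Fact fs_addA : associative fs_add. Proof. by move=> f g h; apply: fsumP => i /=; rewrite addrA. Qed.
Fact fs_addC : commutative fs_add. Proof. by move=> f g; apply: fsumP => i /=; rewrite addrC. Qed.
Fact fs_add0 : left_id fs_zero fs_add. Proof. by move=> f; apply: fsumP => i /=; rewrite add0r. Qed.
Fact fs_addN : left_inverse fs_zero fs_opp fs_add.
Proof. by move=> f; apply: fsumP => i /=; rewrite addNr. Qed.
HB.instance Definition _ := GRing.isZmodule.Build fsum fs_addA fs_addC fs_add0 fs_addN.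

Fact fs_scaleA a b f : fs_scale a (fs_scale b f) = fs_scale (a * b) f.
Proof. by apply: fsumP => i /=; rewrite scalerA. Qed.
Fact fs_scale1 : left_id 1 fs_scale. Proof. by move=> f; apply: fsumP => i /=; rewrite scale1r. Qed.
Fact fs_scaleDr : right_distributive fs_scale +%R.
Proof. by move=> a f g; apply: fsumP => i /=; rewrite scalerDr. Qed.
Fact fs_scaleDl f : {morph fs_scale^~ f : a b / a + b}.
Proof. by move=> a b; apply: fsumP => i /=; rewrite scalerDl. Qed.
HB.instance Definition _ := GRing.Zmodule_isLmodule.Build R fsum fs_scaleA fs_scale1 fs_scaleDr fs_scaleDl.

Lemma fs_addE f g i : (f + g) i = f i + g i. Proof. by []. Qed.
Lemma fs_oppE f i : (- f) i = - f i. Proof. by []. Qed.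
Lemma fs_scaleE a f i : (a *: f) i = a *: f i. Proof. by []. Qed.
Lemma fs_sumE (J : Type) (r : seq J) (f : J -> fsum) i :
  (\sum_(j <- r) f j) i = \sum_(j <- r) f j i.
Proof. by elim/big_rec2: _ => // j x y _ <-. Qed.

Fact fs_inj_subproof i (m : M) : exists s : seq I, forall j, j \notin s -> (if j == i then m else 0) = 0.
Proof. by exists [:: i] => j; rewrite inE => /negPf ->. Qed.
Definition fs_inj_fun i m := FSum (fs_inj_subproof i m).
Fact fs_inj_linear i : linear (fs_inj_fun i).
Proof. by move=> a x y; apply: fsumP => j /=; case: eqP => _; rewrite ?scaler0 ?addr0. Qed.
HB.instance Definition _ i := GRing.isSemilinear.Build R M fsum _ (fs_inj_fun i)
  (GRing.semilinear_linear (fs_inj_linear i)).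
Definition fs_inj i : {linear M -> fsum} := fs_inj_fun i.
Lemma fs_injE i m j : fs_inj i m j = if j == i then m else 0. Proof. by []. Qed.

Lemma fs_expand f s : uniq s -> (forall i, i \notin s -> f i = 0) ->
  f = \sum_(i <- s) fs_inj i (f i).
Proof.
move=> us hs; apply: fsumP => j; rewrite fs_sumE.
have [js|js] := boolP (j \in s).
  rewrite (bigD1_seq j) //= eqxx big1 ?addr0 // => i /negPf ij.
  by rewrite eq_sym ij.
rewrite hs // big_seq big1 // => i is_; rewrite fs_injE; case: eqP => // e.
by move: js; rewrite e is_.
Qed.

Lemma fs_suppU f : exists2 s : seq I, uniq s & forall i, i \notin s -> f i = 0.
Proof.
have [s hs] := fs_supp f; exists (undup s); rewrite ?undup_uniq // => i.
by rewrite mem_undup; apply: hs.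
Qed.

Section Lift.
Variables (N : lmodType R) (phi : I -> M -> N).
Hypothesis phil : forall i, linear (phi i).

Let phi0 i : phi i 0 = 0. Proof. exact: linear_fun0. Qed.

Definition fs_lift_fun f := \sum_(i <- undup (sval (cid (fs_supp f)))) phi i (f i).

(** Frees the value from the support list chosen by [cid]: two duplicate-free lists carrying the
    support are compared through their union. *)
Lemma fs_lift_eq f s : uniq s -> (forall i, i \notin s -> f i = 0) ->
  fs_lift_fun f = \sum_(i <- s) phi i (f i).
Proof.
rewrite /fs_lift_fun; case: cid => t ht /= us hs.
have aux r1 r2 : uniq r1 -> uniq r2 -> {subset r1 <= r2} -> (forall i, i \notin r1 -> f i = 0) ->
    \sum_(i <- r1) phi i (f i) = \sum_(i <- r2) phi i (f i).
  move=> u1 u2 s12 h1; rewrite [RHS](bigID (mem r1)) /= [X in _ = _ + X]big1 => [|i /h1 ->//].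
  rewrite addr0 -[RHS]big_filter; apply: perm_big; apply: uniq_perm => //; first exact: filter_uniq.
  by move=> i; rewrite mem_filter /=; case: (boolP (i \in r1)) => // /s12.
pose r := undup (s ++ undup t).
rewrite (aux (undup t) r) ?undup_uniq //; first last.
- by move=> i; rewrite mem_undup; apply: ht.
- by move=> i it; rewrite mem_undup mem_cat it orbT.
rewrite (aux s r) ?undup_uniq // => i is_.
by rewrite mem_undup mem_cat is_.
Qed.

Fact fs_lift_linear : linear fs_lift_fun.
Proof.
move=> a f g; have [s us hs] := fs_suppU f; have [t ut ht] := fs_suppU g.
pose r := undup (s ++ t); have ur : uniq r by apply: undup_uniq.
have hr i : i \notin r -> f i = 0 /\ g i = 0.
  by rewrite mem_undup mem_cat negb_or => /andP[/hs ? /ht ?].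
rewrite !(@fs_lift_eq _ r) //; try by move=> i /hr[? ?].
  rewrite scaler_sumr -big_split /=; apply: eq_bigr => i _.
  by rewrite phil.
by move=> i /hr[e1 e2]; rewrite fs_addE fs_scaleE e1 e2 scaler0 addr0.
Qed.
HB.instance Definition _ := GRing.isSemilinear.Build R fsum N _ fs_lift_fun
  (GRing.semilinear_linear fs_lift_linear).
Definition fs_lift : {linear fsum -> N} := fs_lift_fun.

Lemma fs_lift_inj i m : fs_lift (fs_inj i m) = phi i m.
Proof.
rewrite [LHS](@fs_lift_eq _ [:: i]) // ?big_seq1 ?fs_injE ?eqxx //= => j.
by rewrite inE => /negPf ->.
Qed.

End Lift.

End FinSupp.

Section Restrict.
Variables (F : fieldType) (C : falgType F).

(** Restriction of scalars to [F], on a new type so that its module structure does not compete with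
    the one over [C^c]. *)
Definition rs (M : lmodType C^c) : Type := M.
Section RS.
Variable M : lmodType C^c.
HB.instance Definition _ := GRing.Zmodule.copy (rs M) M.
Definition rs_scale (a : F) (x : rs M) : rs M := ((a%:A : C) : C^c) *: (x : M).
Fact rs_scaleA a b x : rs_scale a (rs_scale b x) = rs_scale (a * b) x.
Proof. by rewrite /rs_scale scalerA; congr (_ *: _); rewrite /= /GRing.mul /= -scalerAl mul1r scalerA mulrC. Qed.
Fact rs_scale1 : left_id 1 rs_scale. Proof. by move=> x; rewrite /rs_scale scale1r [LHS]scale1r. Qed.
Fact rs_scaleDr : right_distributive rs_scale +%R. Proof. by move=> a x y; rewrite /rs_scale [LHS]scalerDr. Qed.
Fact rs_scaleDl x : {morph rs_scale^~ x : a b / a + b}.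
Proof. by move=> a b; rewrite /rs_scale scalerDl [LHS]scalerDl. Qed.
HB.instance Definition _ := GRing.Zmodule_isLmodule.Build F (rs M) rs_scaleA rs_scale1 rs_scaleDr rs_scaleDl.
Lemma rs_scaleE a (x : rs M) : a *: x = ((a%:A : C) : C^c) *: (x : M). Proof. by []. Qed.
End RS.

Section RSmap.
Variables (M N : lmodType C^c) (f : {linear M -> N}).
Definition rs_map_fun (x : rs M) : rs N := f x.
Fact rs_map_linear : linear rs_map_fun.
Proof. by move=> a x y; rewrite /rs_map_fun !rs_scaleE linearP. Qed.
HB.instance Definition _ := GRing.isSemilinear.Build F (rs M) (rs N) _ rs_map_fun
  (GRing.semilinear_linear rs_map_linear).
Definition rs_map : {linear rs M -> rs N} := rs_map_fun.
End RSmap.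

Definition dgpar (X : dgmod C) (b : bool) (x : rs X) :=
  forall i : int, odd `|i|%N != b -> dg_comp X i x = 0.

Lemma odd_absz_add1 (i : int) : odd `|(i + 1)%R|%N = ~~ odd `|i|%N.
Proof. by case: i => [n|[|n]] /=; rewrite ?addn1 //=; lia. Qed.

Lemma odd_absz_sub1 (i : int) : odd `|(i - 1)%R|%N = ~~ odd `|i|%N.
Proof. by rewrite -[in RHS](subrK 1 i) odd_absz_add1 negbK. Qed.

Section DGC.
Variable X : dgmod C.

Lemma dg_comp0 (x : X) : (forall i, dg_comp X i x = 0) -> x = 0.
Proof. by move=> h; have [s [_ ->]] := dg_comp_sum x; rewrite big1. Qed.

Fact dgpar_sub b : lsub (@dgpar X b).
Proof.
split=> [i _|a x y hx hy i ib]; first exact: linear0.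
by rewrite rs_scaleE linearP hx // hy // scaler0 addr0.
Qed.

Fact dgpar_dec b (x : rs X) : exists x0 x1, [/\ dgpar b x0, dgpar (~~ b) x1 & x = x0 + x1].
Proof.
have [s [_ ex]] := dg_comp_sum (x : X).
exists (\sum_(i <- s | odd `|i|%N == b) dg_comp X i x), (\sum_(i <- s | odd `|i|%N != b) dg_comp X i x).
split; last by rewrite [LHS]ex [LHS](bigID (fun i : int => odd `|i|%N == b)).
  move=> i ib; rewrite linear_sum big1 // => j jb; rewrite dg_comp_comp.
  have [e|//] := eqVneq i j; by rewrite e jb in ib.
move=> i ib; rewrite linear_sum big1 // => j jb; rewrite dg_comp_comp.
have [e|//] := eqVneq i j; by move: jb ib; rewrite e; case: odd; case: b.
Qed.

Fact dgpar_uniq b (x : rs X) : dgpar b x -> dgpar (~~ b) x -> x = 0.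
Proof.
move=> h1 h2; apply: dg_comp0 => i.
by have [e|/h1//] := eqVneq (odd `|i|%N) b; apply: h2; rewrite e; case: b {h1 e}.
Qed.

Lemma dg_comp_dif i (x : X) : dg_comp X i (dg_dif X x) = dg_dif X (dg_comp X (i - 1) x).
Proof. by rewrite -dg_dif_deg subrK. Qed.

Fact dgpar_dif b (x : rs X) : dgpar b x -> dgpar (~~ b) (rs_map (dg_dif X) x).
Proof.
move=> h i ib; rewrite [LHS]dg_comp_dif h ?linear0 // odd_absz_sub1.
by move: ib; case: odd; case: b h.
Qed.

Definition dgc : scplx F :=
  @SCplx F (rs X) (@dgpar X) (rs_map (dg_dif X)) dgpar_sub dgpar_dec dgpar_uniq dgpar_dif
    (@dg_dif_dif _ X).

End DGC.
End Restrict.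

(** * Homotopies, quasi-isomorphisms and direct sums of dg modules *)

Section DGBasics.
Variable C : nzRingType.
Implicit Types X Y Z : dgmod C.

Lemma homogeneous_comp X i j (x : X) : homogeneous j x ->
  dg_comp X i x = if i == j then x else 0.
Proof. by move=> <-; rewrite dg_comp_comp. Qed.

Lemma comp_homogeneous X i (x : X) : homogeneous i (dg_comp X i x).
Proof. by rewrite /homogeneous dg_comp_comp eqxx. Qed.

Lemma dghom_comp X Y Z (f : {linear X -> Y}) (g : {linear Y -> Z}) :
  is_dghom f -> is_dghom g -> is_dghom (g \o f : {linear X -> Z}).
Proof. by move=> [f1 f2] [g1 g2]; split=> [i|] x /=; rewrite ?f1 ?g1 ?f2 ?g2. Qed.

Lemma dghom_zero X Y : is_dghom (\0 : {linear X -> Y}).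
Proof. by split=> [i|] x /=; rewrite linear0. Qed.

Lemma dghom_id X : is_dghom (idfun : {linear X -> X}).
Proof. by []. Qed.

Lemma qis_id X : is_qis (idfun : {linear X -> X}).
Proof.
split=> // y dy; exists y => //; exists 0.
by rewrite linear0 /= subrr.
Qed.

Lemma homotopic_refl X Y (f : {linear X -> Y}) : homotopic f f.
Proof.
exists (\0 : {linear X -> Y}); split=> [i|] x /=; first by rewrite linear0.
by rewrite subrr linear0 addr0.
Qed.

Lemma homotopic_compr X Y Z (f g : {linear X -> Y}) (a : {linear Z -> X}) :
  is_dghom a -> homotopic f g ->
  homotopic (f \o a : {linear Z -> Y}) (g \o a : {linear Z -> Y}).
Proof.
move=> [a1 a2] [h [h1 h2]]; exists (h \o a : {linear Z -> Y}); split=> [i|] x /=.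
  by rewrite a1 h1.
by rewrite h2 a2.
Qed.

Lemma qis_homotopic X Y (f g : {linear X -> Y}) : is_dghom g -> homotopic f g ->
  is_qis f -> is_qis g.
Proof.
move=> hg [h [h1 h2]] [hf fi fs]; split=> //.
  move=> x dx [y gy]; apply: fi => //; exists (y + dg_dif Y (h x) - dg_dif Y (h x) + h x).
  by rewrite addrK linearD -gy addrC; apply/eqP; rewrite -subr_eq h2 dx linear0 addr0.
move=> y dy; have [x dx [y' ey]] := fs y dy; exists x => //; exists (y' - h x).
rewrite linearB -ey; have := h2 x; rewrite dx linear0 addr0 => <-.
by rewrite opprB addrACA addrC addrA subrK addrC.
Qed.

(** The lift and the primitive given by [is_qis] have no degree; their components in degrees [i] and
    [i - 1] do the work because [t] and the differentials respect the grading. *)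
Lemma qis_cocycle X Y (t : {linear X -> Y}) i y : is_qis t -> homogeneous i y ->
  dg_dif Y y = 0 -> exists x y', [/\ homogeneous i x, dg_dif X x = 0,
    homogeneous (i - 1) y' & y - t x = dg_dif Y y'].
Proof.
move=> [[t1 t2] _ ts] hy dy; have [x dx [y' ey]] := ts y dy.
exists (dg_comp X i x), (dg_comp Y (i - 1) (- y')); split.
- exact: comp_homogeneous.
- by rewrite -dg_dif_deg dx linear0.
- exact: comp_homogeneous.
by rewrite -dg_dif_deg subrK linearN -ey linearN linearB -t1 hy opprB.
Qed.

Section DirectSum.
Variables (M : lmodType C^c) (I : choiceType) (deg : I -> int).
Notation V := (fsum M I).

Fact dv_comp_subproof n (f : V) : exists s : seq I, forall i, i \notin s ->
  (if deg i == n then f i else 0) = 0.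
Proof. by have [s hs] := fs_supp f; exists s => i /hs ->; case: eqP. Qed.
Definition dv_comp_fun n f : V := FSum (dv_comp_subproof n f).
Fact dv_comp_linear n : linear (dv_comp_fun n).
Proof.
move=> a f g; apply: fsumP => i /=; case: eqP => _ //.
by rewrite scaler0 addr0.
Qed.
HB.instance Definition _ n := GRing.isSemilinear.Build C^c V V _ (dv_comp_fun n)
  (GRing.semilinear_linear (dv_comp_linear n)).
Definition dv_comp n : {linear V -> V} := dv_comp_fun n.
Lemma dv_compE n f i : dv_comp n f i = if deg i == n then f i else 0. Proof. by []. Qed.

Fact dv_comp_comp i j x : dv_comp i (dv_comp j x) = if i == j then dv_comp j x else 0.
Proof.
apply: fsumP => k; rewrite !dv_compE.
have [->|ij] := eqVneq i j; first by rewrite dv_compE; case: eqP.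
by have [->|//] := eqVneq (deg k) i; rewrite (negPf ij).
Qed.

Fact dv_comp_sum x : exists s : seq int, uniq s /\ x = \sum_(i <- s) dv_comp i x.
Proof.
have [s hs] := fs_supp x; exists (undup (map deg s)); split; first exact: undup_uniq.
apply: fsumP => k; rewrite fs_sumE; have [ks|ks] := boolP (deg k \in undup (map deg s)).
  rewrite (bigD1_seq (deg k)) ?undup_uniq //= eqxx big1 ?addr0 // => j /negPf jk.
  by rewrite eq_sym jk.
rewrite hs; last by apply: contraNN ks => ks; rewrite mem_undup map_f.
rewrite big_seq big1 // => i is_; rewrite dv_compE; case: eqP => // e.
by move: ks; rewrite e is_.
Qed.

Fact dv_dif_deg i x : dv_comp (i + 1) ((\0 : {linear V -> V}) x) =
  (\0 : {linear V -> V}) (dv_comp i x).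
Proof. by rewrite /= linear0. Qed.

(** The sum of copies of [M], the [i]-th one in degree [deg i], with zero differential. For [M] a
    minimal right ideal these are the models of all dg modules. *)
Definition dgV : dgmod C := DGMod dv_comp_comp dv_comp_sum dv_dif_deg (fun=> erefl).

Lemma fs_inj_homogeneous i m : homogeneous (X := dgV) (deg i) (fs_inj M i m).
Proof.
apply: fsumP => j; rewrite dv_compE fs_injE; have [->|_] := eqVneq j i; first by rewrite eqxx.
by case: eqP.
Qed.

Lemma dv_inj_comp n i m : dg_comp dgV n (fs_inj M i m) = if n == deg i then fs_inj M i m else 0.
Proof. exact: (homogeneous_comp n (fs_inj_homogeneous i m)). Qed.

Lemma dghom_lift X (phi : I -> M -> X) (phil : forall i, linear (phi i)) :
  (forall i m, homogeneous (deg i) (phi i m)) -> (forall i m, dg_dif X (phi i m) = 0) ->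
  is_dghom (X := dgV) (fs_lift phil).
Proof.
move=> h1 h2; split=> [n|] f.
  have [s us hs] := fs_suppU f.
  have hs' i : i \notin s -> dv_comp n f i = 0 by move=> /hs e; rewrite dv_compE e; case: eqP.
  rewrite [RHS](congr1 _ (fs_lift_eq phil us hs)) [LHS](fs_lift_eq phil us hs') linear_sum.
  apply: eq_bigr => i _; rewrite (homogeneous_comp n (h1 i _)) dv_compE eq_sym.
  by case: eqP => _ //; apply: linear_fun0.
rewrite [LHS]linear0; have [s us hs] := fs_suppU f.
by rewrite [fs_lift _ _](fs_lift_eq phil us hs) linear_sum big1.
Qed.

Lemma homotopic_lift X (phi psi chi : I -> M -> X) (phil : forall i, linear (phi i))
    (psil : forall i, linear (psi i)) (chil : forall i, linear (chi i)) :
  (forall i m, homogeneous (deg i - 1) (chi i m)) ->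
  (forall i m, phi i m - psi i m = dg_dif X (chi i m)) ->
  homotopic (X := dgV) (fs_lift phil) (fs_lift psil).
Proof.
move=> h1 h2; exists (fs_lift chil); split=> [n|] f.
  have [s us hs] := fs_suppU f.
  have hs' i : i \notin s -> dv_comp n f i = 0 by move=> /hs e; rewrite dv_compE e; case: eqP.
  rewrite [RHS](congr1 _ (fs_lift_eq chil us hs)) [LHS](fs_lift_eq chil us hs') linear_sum.
  apply: eq_bigr => i _; rewrite (homogeneous_comp _ (h1 i _)) (inj_eq (addIr _)) dv_compE eq_sym.
  by case: eqP => _ //; apply: linear_fun0.
rewrite linear0 addr0; have [s us hs] := fs_suppU f.
rewrite [fs_lift phil _](fs_lift_eq phil us hs) [fs_lift psil _](fs_lift_eq psil us hs).
rewrite [fs_lift chil _](fs_lift_eq chil us hs) [RHS]linear_sum -sumrB.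
by apply: eq_bigr => i _; rewrite h2.
Qed.

End DirectSum.

Section Shift.
Variables (M : lmodType C^c) (g : int).
Definition sh_comp (i : int) : {linear M -> M} :=
  if i == g then (idfun : {linear M -> M}) else (\0 : {linear M -> M}).
Fact sh_comp_comp i j x : sh_comp i (sh_comp j x) = if i == j then sh_comp j x else 0.
Proof.
rewrite /sh_comp; have [->|ij] := eqVneq i j; first by case: (j == g).
have [i0|//] := eqVneq i g; have [j0|//] := eqVneq j g.
by rewrite i0 j0 eqxx in ij.
Qed.
Fact sh_comp_sum x : exists s : seq int, uniq s /\ x = \sum_(i <- s) sh_comp i x.
Proof. by exists [:: g]; rewrite big_seq1 /sh_comp eqxx. Qed.
Fact sh_dif_deg i x : sh_comp (i + 1) ((\0 : {linear M -> M}) x) =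
  (\0 : {linear M -> M}) (sh_comp i x).
Proof. by rewrite /= linear0. Qed.
Definition dg_shift : dgmod C := DGMod sh_comp_comp sh_comp_sum sh_dif_deg (fun=> erefl).

Lemma sh_compE i x : dg_comp dg_shift i x = if i == g then x else 0.
Proof. by rewrite /= /sh_comp; case: eqP. Qed.

End Shift.

Lemma dgV_dsum (M : lmodType C^c) (I : choiceType) (deg : I -> int) :
  is_dsum (Y_ := fun i => dg_shift M (deg i)) (Y := dgV M deg) (fun i => fs_inj M i).
Proof.
split.
- move=> i; split=> [n|] x; last by rewrite linear0.
  by rewrite [RHS]dv_inj_comp sh_compE; case: eqP => _ //; rewrite linear0.
- move=> y; have [s us hs] := fs_suppU y; exists s, (fun i => y i); split=> //.
  exact: fs_expand.
- move=> s x us e i is_; have := congr1 (fun f : fsum M I => f i) e.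
  rewrite fs_sumE (bigD1_seq i) //= eqxx big1 ?addr0 // => j /negPf ij.
  by rewrite eq_sym ij.
Qed.

End DGBasics.

(** * Presentations by shifts of the minimal right ideal *)

Section Presentation.
Variables (F : fieldType) (C : falgType F) (U : {vspace C}).
Hypotheses (hS : simple_alg C) (hU : (U * {:C} <= U)%VS) (minU : minimal_right_ideal U).
Variable eps : C.
Hypotheses (epsU : eps \in U) (eps0 : eps != 0) (epsM : eps * eps = eps).
Hypothesis epsl : forall u, u \in U -> eps * u = u.
Notation M := (rideal hU).
Implicit Types X Y : dgmod C.

Definition act (X : dgmod C) (c : C) (x : X) : X := (c : C^c) *: x.

Lemma actA X c d (x : X) : act c (act d x) = act (d * c) x.
Proof. exact: scalerA. Qed.

(** Right multiplication of [x] by [u]. As [U] equals [eps C], every module map from [U] is of this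
    kind, with [x] the image of [eps]. *)
Definition gen_fun X (x : X) (u : M) : X := act (vsval u) x.
Lemma gen_linear X (x : X) : linear (gen_fun x).
Proof.
move=> a u v; rewrite /gen_fun /act [RHS]addrC -[a *: _]/((a : C^c) *: _) scalerA addrC -scalerDl.
by [].
Qed.

Section Family.
Variables (X : dgmod C) (I : choiceType) (deg : I -> int) (x : I -> X).
Definition Phi : {linear dgV M deg -> X} := fs_lift (fun i => @gen_linear X (x i)).

Lemma Phi_inj i u : Phi (fs_inj M i u) = act (vsval u) (x i).
Proof. exact: fs_lift_inj. Qed.

Lemma Phi_sum (f : fsum M I) (s : seq I) : uniq s -> (forall i, i \notin s -> f i = 0) ->
  Phi f = \sum_(i <- s) act (vsval (f i)) (x i).
Proof. exact: (fs_lift_eq (fun i => @gen_linear X (x i))). Qed.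

End Family.

Lemma act_homogeneous X i c (x : X) : homogeneous i x -> homogeneous i (act c x).
Proof. by move=> h; rewrite /homogeneous /act linearZ h. Qed.

Lemma act_dif X c (x : X) : dg_dif X (act c x) = act c (dg_dif X x).
Proof. exact: linearZ. Qed.

Lemma Phi_hom X (I : choiceType) (deg : I -> int) (x : I -> X) :
  (forall i, homogeneous (deg i) (x i)) -> (forall i, dg_dif X (x i) = 0) ->
  is_dghom (Phi deg x).
Proof.
move=> h1 h2; apply: dghom_lift => i m; first exact: act_homogeneous.
by rewrite /gen_fun act_dif h2 /act scaler0.
Qed.

Lemma Phi_homotopic X (I : choiceType) (deg : I -> int) (x x' y : I -> X) :
  (forall i, homogeneous (deg i - 1) (y i)) ->
  (forall i, x i - x' i = dg_dif X (y i)) ->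
  homotopic (Phi deg x) (Phi deg x').
Proof.
move=> h1 h2; apply: (homotopic_lift _ _ (fun i => gen_linear (y i))) => i m.
  exact: act_homogeneous.
by rewrite /gen_fun act_dif -h2 /act scalerBr.
Qed.

Lemma Phi_comp X Y (f : {linear X -> Y}) (I : choiceType) (deg : I -> int) (x : I -> X) :
  f \o Phi deg x =1 Phi deg (f \o x).
Proof.
move=> v; have [s us hs] := fs_suppU (v : fsum M I).
rewrite [LHS](congr1 f (Phi_sum deg x us hs)) [RHS](Phi_sum deg (f \o x) us hs) linear_sum.
by apply: eq_bigr => i _; rewrite /act linearZ.
Qed.

End Presentation.

Section Presentation.
Variables (F : fieldType) (C : falgType F) (U : {vspace C}).
Hypotheses (hS : simple_alg C) (hU : (U * {:C} <= U)%VS) (minU : minimal_right_ideal U).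
Implicit Types X Y : dgmod C.
Notation M := (rideal hU).

Definition presents X (I : choiceType) (deg : I -> int) (x : I -> X) :=
  [/\ forall i, homogeneous (deg i) (x i), forall i, dg_dif X (x i) = 0
    & is_qis (Phi hU deg x)].

Section Zorn.
Variable eps : C.
Hypotheses (epsU : eps \in U) (eps0 : eps != 0) (epsM : eps * eps = eps).
Variable X : dgmod C.

Let G (x : X) := [/\ exists i, homogeneous i x, dg_dif X x = 0 & act eps x = x].

(** Says that the map to the cohomology of [X] from the sum of copies of [U] indexed by [S] is
    injective. *)
Let uindep (S : set X) := forall (s : seq X) (u : X -> C), uniq s ->
  (forall x, x \in s -> S x) -> (forall x, u x \in U) ->
  (exists y, \sum_(x <- s) act (u x) x = dg_dif X y) -> {in s, forall x, u x = 0}.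

Let exists_maximal : exists S : set X, (forall x, S x -> G x) /\ uindep S /\
  forall z, G z -> ~ S z -> ~ uindep (S `|` [set z])%classic.
Proof.
pose P : set (set X) := fun S => (forall x, S x -> G x) /\ uindep S.
have [|S [[SG Su] hmax]] := @Zorn_bigcup X P.
  move=> A AP tot; split; first by move=> x [S /AP[h _] /h].
  move=> s u us sS uU hy.
  have [->//|[x0 x0s]] : s = [::] \/ exists x, x \in s.
    by case: s {us sS hy} => [|x s]; [left | right; exists x; rewrite mem_head].
  (* A relation involves finitely many elements of the union, and these lie in one member of the
     chain. *)
  have [S0 AS0 sS0] : exists2 S, A S & forall x, x \in s -> S x.
    have : forall r : seq X, {subset r <= s} -> exists2 S, A S & forall x, x \in r -> S x.
      elim=> [|x r IH] rs; first by have [S AS _] := sS _ x0s; exists S.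
      have [|S AS hr] := IH; first by move=> y yr; apply: rs; rewrite inE yr orbT.
      have [T AT Tx] := sS x (rs _ (mem_head _ _)).
      have [ST|TS] := tot S T AS AT.
        by exists T => // y; rewrite inE => /predU1P[->//|/hr/ST].
      by exists S => // y; rewrite inE => /predU1P[->|/hr//]; apply: TS.
    by apply.
  by have [_ h] := AP _ AS0; exact: (h s u us sS0 uU hy).
exists S; split=> //; split=> // z Gz Sz hz.
apply: (hmax (S `|` [set z])%classic).
  by split=> [x|h]; [left | apply: Sz; apply: h; right].
by split=> // x [/SG|->].
Qed.

(** Semisimplicity of the cohomology. By maximality of [S] every homogeneous cocycle fixed by [eps]
    lies in the submodule [Sp] spanned by [S] modulo boundaries. An arbitrary homogeneous cocycle is
    the sum of the [x a_i b_i], with each [x a_i] fixed by [eps], so it lies in [Sp] as well. *)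
Lemma presentation_exists_eps : exists (I : choiceType) (deg : I -> int) (x : I -> X),
  presents deg x.
Proof.
have [S [SG [Su hmax]]] := exists_maximal.
pose Sp (z : X) := exists s : seq (X * C), (forall p, p \in s -> S p.1 /\ p.2 \in U) /\
  exists y, z = \sum_(p <- s) act p.2 p.1 + dg_dif X y.
have SpD z z' : Sp z -> Sp z' -> Sp (z + z').
  move=> [s [hs [y ->]]] [s' [hs' [y' ->]]]; exists (s ++ s'); split.
    by move=> p; rewrite mem_cat => /orP[/hs|/hs'].
  by exists (y + y'); rewrite big_cat linearD addrACA.
have /minimal_right_idealP[Um _ _] := minU.
have SpM c z : Sp z -> Sp (act c z).
  move=> [s [hs [y ->]]]; exists [seq (p.1, p.2 * c) | p <- s]; split.
    by move=> _ /mapP[p /hs[h1 h2] ->]; split=> //=; apply: Um.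
  exists (act c y); rewrite act_dif big_map /act scalerDr scaler_sumr; congr (_ + _).
  by apply: eq_bigr => p _; rewrite -/(act c _) -/(act p.2 _) actA.
have Sp0 : Sp 0.
  by exists [::]; split=> //; exists 0; rewrite big_nil linear0 addr0.
have SpG z : G z -> Sp z.
  move=> Gz; have [Sz|/(hmax z Gz)] := pselect (S z).
    exists [:: (z, eps)]; split; first by move=> p; rewrite inE => /eqP ->.
    by exists 0; rewrite big_seq1 linear0 addr0 /=; case: Gz.
  move=> hn; apply: contrapT => nSp; apply: hn => s u us sS uU [y hy].
  have [zs|zs] := boolP (z \in s); last first.
    apply: (Su) => //; last by exists y.
    by move=> x xs; case: (sS x xs) => // e; move: zs; rewrite -e xs.
  have uz0 : u z = 0.
    (* A nonzero coefficient of [z] can be multiplied to [eps], and then [z = z eps] becomes a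
       combination of elements of [S] modulo boundaries. *)
    apply/eqP/negPn/negP => uz; apply: nSp.
    have [c uc] := minimal_divides minU epsU (uU z) uz.
    exists [seq (x, - (u x * c)) | x <- rem z s]; split.
      move=> _ /mapP[x xs ->] /=; rewrite memvN Um //; split=> //.
      have := mem_rem xs => /sS[//|e].
      by move: xs; rewrite e mem_rem_uniqF.
    exists (act c y); rewrite act_dif -hy big_map [\sum_(x <- s) _](big_rem z zs) /= /act scalerDr scaler_sumr.
    rewrite -/(act (u z) z) -/(act c _) actA uc; case: Gz => _ _ ->.
    rewrite addrCA -big_split /= big1 ?addr0 // => x _.
    by rewrite -/(act (u x) x) -/(act c (act _ _)) actA scaleNr addNr.
  move=> x xs; have [->//|xz] := eqVneq x z.
  have := @Su (rem z s) u; apply=> //.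
  - exact: rem_uniq.
  - move=> x' x's; have := mem_rem x's => /sS[//|e].
    by move: x's; rewrite e mem_rem_uniqF.
  - by exists y; rewrite -hy [RHS](big_rem z zs) /= uz0 /act scale0r add0r.
  - by rewrite mem_rem_uniq // !inE xz.
have SpZ z : dg_dif X z = 0 -> Sp z.
  have SpH i x : homogeneous i x -> dg_dif X x = 0 -> Sp x.
    move=> hx dx; have [r [a [b [[ab1 ha hb] _]]]] := dual_bases_exist hS minU epsU eps0 epsM.
    have -> : x = \sum_i act (b i) (act (a i) x).
      rewrite /act; under eq_bigr do rewrite scalerA.
      have e : \sum_i ((b i : C^c) * (a i : C^c)) = 1 by exact: ab1.
      by rewrite -scaler_suml e scale1r.
    elim/big_ind: _ => // j _; apply: SpM; apply: SpG; split.
    - by exists i; apply: act_homogeneous.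
    - by rewrite act_dif dx /act scaler0.
    - by rewrite actA ha.
  move=> dz; have [s [_ ->]] := dg_comp_sum z.
  elim/big_ind: _ => // i _; apply: (SpH i); first exact: comp_homogeneous.
  by rewrite -dg_dif_deg dz linear0.
pose T := {x : X | `[< S x >]}; pose I : choiceType := T.
have IS (i : T) : S (val i) by exact/asboolP/(valP i).
have /choice[deg hdeg] (i : T) : exists n, homogeneous n (val i) by case: (SG _ (IS i)).
have hd (i : T) : dg_dif X (val i) = 0 by case: (SG _ (IS i)).
exists I, deg, (fun i : T => val i); split=> //; split; first exact: Phi_hom.
  move=> f _ [y hy]; exists 0; rewrite linear0; apply: fsumP => i.
  have [s us hs] := fs_suppU (f : fsum M I).
  have [is_|/hs//] := boolP (i \in s).
  pose u (x : X) := if insub x is Some i then vsval ((f : fsum M I) (i : T)) else 0.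
  have uE (j : T) : u (val j) = vsval ((f : fsum M I) j) by rewrite /u valK.
  apply: val_inj; rewrite /= -uE; apply: (@Su (map (fun i : T => val i) s) u).
  - by rewrite map_inj_uniq //; exact: val_inj.
  - by move=> _ /mapP[j _ ->].
  - by move=> x; rewrite /u; case: insub => [j|]; rewrite ?subvsP ?mem0v.
  - exists y; rewrite -hy (Phi_sum _ _ us hs) big_map.
    by apply: eq_bigr => j _; rewrite uE.
  - exact: map_f.
move=> z /SpZ[s [hs [y ->]]].
suff [f hf] : exists f, Phi hU (deg : I -> int) (fun i : T => val i) f = \sum_(p <- s) act p.2 p.1.
  by exists f => //; exists (- y); rewrite hf linearN opprD addrA subrr add0r.
elim: s hs => [|p s IH] hs; first by exists 0; rewrite linear0 big_nil.
have [|f hf] := IH; first by move=> q qs; apply: hs; rewrite inE qs orbT.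
have [Sp1 Up2] := hs p (mem_head _ _).
have Ip : `[< S p.1 >] by apply/asboolP.
exists (fs_inj _ (exist _ p.1 Ip : I) (Subvs Up2 : M) + f).
by rewrite linearD hf big_cons Phi_inj.
Qed.
End Zorn.

Lemma presentation_exists X : exists (I : choiceType) (deg : I -> int) (x : I -> X),
  presents deg x.
Proof.
have [eps [epsU eps0 epsM _]] := minimal_idempotent hS minU.
exact: presentation_exists_eps epsU eps0 epsM X.
Qed.

Lemma presents_reindex X (I J : choiceType) (sg : I -> J) (deg : J -> int) (x : J -> X) :
  injective sg -> (forall j, exists i, sg i = j) -> presents deg x ->
  presents (deg \o sg) (x \o sg).
Proof.
move=> sgi sgs [h1 h2 [h3 h4 h5]]; split=> [i|i|]; rewrite /= ?h1 ?h2 //.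
have /choice[tau htau] := sgs.
have key (f : fsum M I) : exists g : fsum M J, Phi hU deg x g = Phi hU (deg \o sg) (x \o sg) f /\
    forall i, g (sg i) = f i.
  have [s us hs] := fs_suppU f.
  exists (\sum_(i <- s) fs_inj M (sg i) (f i)); split.
    rewrite linear_sum [RHS](Phi_sum _ _ us hs); apply: eq_bigr => i _.
    by rewrite Phi_inj.
  move=> i; rewrite fs_sumE; have [is_|is_] := boolP (i \in s).
    rewrite (bigD1_seq i) //= eqxx big1 ?addr0 // => j /negPf ij.
    by rewrite (inj_eq sgi) eq_sym ij.
  rewrite hs // big_seq big1 // => j js; rewrite fs_injE (inj_eq sgi).
  by case: eqP => // e; rewrite -e (negPf is_) in js.
split; first by apply: Phi_hom => i; rewrite /= ?h2.
  move=> f _ [y fy]; have [g [g1 g2]] := key f.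
  have [//||g' /= g0] := h4 g; first by exists y; rewrite g1.
  by exists 0; apply: fsumP => i; rewrite -g2 g0.
move=> y dy; have [g _ [y' gy]] := h5 y dy.
have fs : exists s : seq I, forall i, i \notin s -> (g : fsum M J) (sg i) = 0.
  have [s hs] := fs_supp (g : fsum M J); exists (map tau s) => i his; apply: hs.
  apply: contraNN his => his; apply/mapP; exists (sg i) => //.
  by apply: sgi; rewrite htau.
exists (FSum fs) => //; exists y'; rewrite -gy; congr (_ - _).
have [g' [<- g2]] := key (FSum fs); congr (Phi _ _ _ _); apply: fsumP => j.
by rewrite -(htau j) g2.
Qed.

End Presentation.

Lemma homotopic_eq (C : nzRingType) (X Y : dgmod C) (f f' g g' : {linear X -> Y}) :
  f =1 f' -> g =1 g' -> homotopic f g -> homotopic f' g'.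
Proof.
by move=> ef eg [h [h1 h2]]; exists h; split=> // x; rewrite -ef -eg.
Qed.

(** * Compact objects and finite presentations *)

Section Compact.
Variables (F : fieldType) (C : falgType F) (U : {vspace C}).
Hypotheses (hS : simple_alg C) (hU : (U * {:C} <= U)%VS) (minU : minimal_right_ideal U).
Implicit Types X Y : dgmod C.
Notation M := (rideal hU).
Notation Phi := (Phi hU).

(** Sums of shifts of [U] behave as projective objects: the generating cocycles are lifted through
    [t] one by one, each up to a boundary, and the primitives assemble into a homotopy. *)
Lemma Phi_lift X X' (t : {linear X' -> X}) (I : choiceType) (deg : I -> int) (x : I -> X) :
  is_qis t -> (forall i, homogeneous (deg i) (x i)) -> (forall i, dg_dif X (x i) = 0) ->
  exists x' : I -> X', [/\ forall i, homogeneous (deg i) (x' i), forall i, dg_dif X' (x' i) = 0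
    & homotopic (Phi deg x) (t \o Phi deg x' : {linear dgV M deg -> X})].
Proof.
move=> ht hx dx.
have /choice[x' hx'] i : exists x', exists y', [/\ homogeneous (deg i) x', dg_dif X' x' = 0,
    homogeneous (deg i - 1) y' & x i - t x' = dg_dif X y'].
  by apply: qis_cocycle.
have /choice[y' hy'] := hx'.
exists x'; split=> [i|i|]; try by case: (hy' i).
have := @Phi_homotopic _ _ _ hU _ _ deg x (t \o x') y'.
move=> /(_ _ _) H; apply: (homotopic_eq (f := Phi deg x) (g := Phi deg (t \o x'))) => //.
  by move=> v; rewrite -Phi_comp.
by apply: H => i; case: (hy' i).
Qed.

(** A morphism out of [X] in the derived category is determined by the images of the [n] generators,
    and each image meets finitely many of the summands [Y_ j]. *)
Lemma finite_presents_compact X n (deg : 'I_n -> int) (x : 'I_n -> X) :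
  presents hU deg x -> compact X.
Proof.
move=> [hx dx qx] I Y_ Y inj [injh injs injz].
have injU (s : seq I) (z : forall i, Y_ i) : uniq s -> \sum_(i <- s) inj i (z i) = 0 ->
    {in s, forall i, z i = 0} by apply: injz.
split.
  move=> X' t f [ht hf].
  have [x' [hx' dx' hom]] := Phi_lift ht hx dx.
  have hPx' : is_dghom (Phi deg x') by apply: Phi_hom.
  have qis' : is_qis (t \o Phi deg x' : {linear dgV M deg -> X}).
    by apply: qis_homotopic hom qx; apply: dghom_comp => //; case: ht.
  have /choice[sy hsy] i : exists sy : seq I * (forall j, Y_ j), uniq sy.1 /\
      f (x' i) = \sum_(j <- sy.1) inj j (sy.2 j).
    by have [s [y [us ey]]] := injs (f (x' i)); exists (s, y).
  (* The component of [f (x' i)] in [Y_ j], cut down to degree [deg i] to be homogeneous, and [0]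
     when [j] is not among the summands met. *)
  pose y j i : Y_ j := if j \in (sy i).1 then dg_comp (Y_ j) (deg i) ((sy i).2 j) else 0.
  have fx' i : f (x' i) = \sum_(j <- (sy i).1) inj j (y j i).
    rewrite -[x' i]hx' (hf.1) (hsy i).2 linear_sum /=; apply: eq_big_seq => j js.
    by rewrite /y js (injh j).1.
  have dy j i : dg_dif (Y_ j) (y j i) = 0.
    have [js|js] := boolP (j \in (sy i).1); last by rewrite /y (negPf js) linear0.
    apply: (injU (sy i).1 (fun j => dg_dif (Y_ j) (y j i)) (hsy i).1 _ j js).
    rewrite -[RHS](linear0 f) -(dx' i) (hf.2) fx' linear_sum.
    by apply: eq_bigr => j' _; rewrite (injh j').2.
  have hy j i : homogeneous (deg i) (y j i).
    by rewrite /y; case: ifP => _; [exact: comp_homogeneous | rewrite /homogeneous linear0].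
  pose s := undup (flatten [seq (sy i).1 | i <- enum 'I_n]).
  exists s, (dgV M deg), (t \o Phi deg x' : {linear dgV M deg -> X}), (fun j => Phi deg (y j)),
    (f \o Phi deg x' : {linear dgV M deg -> Y}).
  have us : uniq s by exact: undup_uniq.
  split=> //.
  - by move=> i; split=> //; apply: Phi_hom => j.
  - move=> v; have ev (Z : dgmod C) (z : 'I_n -> Z) :
        Phi deg z v = \sum_i act (vsval ((v : fsum M _) i)) (z i).
      rewrite [LHS](@Phi_sum _ _ _ hU _ _ deg z v (enum 'I_n)) ?enum_uniq ?big_enum //.
      by move=> i; rewrite mem_enum.
    rewrite /= ev linear_sum; under [RHS]eq_bigr => j _ do rewrite ev linear_sum.
    rewrite [RHS]exchange_big /=; apply: eq_bigr => i _.
    rewrite /act linearZ /= fx' scaler_sumr; under [RHS]eq_bigr => j _ do rewrite linearZ.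
    rewrite [RHS](bigID (mem (sy i).1)) /= [X in _ = _ + X]big1 ?addr0; last first.
      by move=> j /negPf js; rewrite /y js linear0 scaler0.
    rewrite -[RHS]big_filter; apply: perm_big; apply: uniq_perm; first exact: (hsy i).1.
      exact: filter_uniq.
    move=> j; rewrite mem_filter /=; have [js|//] := boolP (j \in (sy i).1).
    rewrite mem_undup; apply/esym/flattenP; exists (sy i).1 => //.
    by apply: map_f; rewrite mem_enum.
  exists (dgV M deg), (Phi deg x'), (idfun : {linear dgV M deg -> dgV M deg}); split=> //.
  - exact: homotopic_refl.
  - exact: homotopic_refl.
move=> s X' t g f us hg hf [Z [a [b [ha hb qa ht hfa]]]] j js.
have [z [hz dz hom]] := Phi_lift qa hx dx.
have hPz : is_dghom (Phi deg z) by apply: Phi_hom.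
have dght : is_dghom t by case: (hg j) => -[].
exists (dgV M deg), (a \o Phi deg z : {linear dgV M deg -> X'}),
  (b \o Phi deg z : {linear dgV M deg -> X'}); split.
- exact: dghom_comp.
- exact: dghom_comp.
- apply: (qis_homotopic _ hom qx).
  by apply: (dghom_comp hPz); apply: dghom_comp.
- exact: (homotopic_compr hPz ht).
case: hfa => h [h1 h2].
(* The homotopy writes [f (a (z i))] as a boundary in [Y]. Comparing components in the direct sum
   makes [g j (a (z i))] a boundary in [Y_ j]. *)
have /choice[y hy] i : exists y : Y_ j, homogeneous (deg i - 1) y /\ g j (a (z i)) = dg_dif (Y_ j) y.
  have [r [eta [ur eeta]]] := injs (h (z i)).
  have e : f (a (z i)) = dg_dif Y (h (z i)).
    have := h2 (z i); rewrite dz [h 0]linear0 addr0 => <-.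
    by rewrite /= subr0.
  pose w l := (if l \in s then g l (a (z i)) else 0) - (if l \in r then dg_dif (Y_ l) (eta l) else 0).
  have w0 : w j = 0.
    apply: (injU (undup (s ++ r)) w) => //; first exact: undup_uniq; last first.
      by rewrite mem_undup mem_cat js.
    rewrite /w; under eq_bigr do rewrite linearB.
    have aux (q : seq I) (v : forall l, Y_ l) : uniq q -> {subset q <= undup (s ++ r)} ->
        \sum_(l <- undup (s ++ r)) inj l (if l \in q then v l else 0) = \sum_(l <- q) inj l (v l).
      move=> uq qs; rewrite (bigID (mem q)) /= [X in _ + X]big1 ?addr0; last first.
        by move=> l /negPf ->; rewrite linear0.
      rewrite -big_filter (eq_big_seq (fun l => inj l (v l))); last first.
        by move=> l; rewrite mem_filter => /andP[/= ->].
      apply: perm_big; apply: uniq_perm => //; first exact/filter_uniq/undup_uniq.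
      by move=> l; rewrite mem_filter /=; case: (boolP (l \in q)) => //= /qs.
    rewrite sumrB !aux //; try by move=> l lq; rewrite mem_undup mem_cat lq ?orbT.
    rewrite -hf e eeta linear_sum; apply/eqP; rewrite subr_eq0; apply/eqP.
    by apply: eq_bigr => l _; rewrite (injh l).2.
  move: w0; rewrite /w js => /eqP; rewrite subr_eq0 => /eqP w0.
  exists (dg_comp (Y_ j) (deg i - 1) (if j \in r then eta j else 0)).
  split; first exact: comp_homogeneous.
  have gh : is_dghom (g j) by case: (hg j).
  have <- : dg_comp (Y_ j) (deg i) (g j (a (z i))) = g j (a (z i)).
    by rewrite -(gh.1) -(ha.1) hz.
  rewrite w0 -dg_dif_deg subrK.
  by case: ifP => _ //; rewrite !linear0.
have H := @Phi_homotopic _ _ _ hU _ _ deg (g j \o (a \o z)) (fun=> 0) y.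
apply: (homotopic_eq _ _ (H _ _)).
- by move=> v; rewrite -Phi_comp /=; congr (g j _); rewrite [RHS]Phi_comp.
- move=> v; have [q uq hq] := fs_suppU (v : fsum M _).
  by rewrite [LHS](Phi_sum deg _ uq hq) big1 // => i _; rewrite /act scaler0.
- by move=> i; case: (hy i).
- by move=> i; rewrite subr0; case: (hy i).
Qed.

(** Compactness, applied to the identity of the sum of shifts seen as a morphism from [X], makes it
    factor through a finite set [s] of summands. On the copy of [U] at an index outside [s] the
    identity would be zero, since the sum has zero differential. *)
Lemma compact_finite_index X (I : choiceType) (deg : I -> int) (x : I -> X) :
  presents hU deg x -> compact X -> exists e : seq I, forall i, i \in e.
Proof.
move=> [hx dx qx] cX.
have [cX1 _] := cX I (fun i => dg_shift M (deg i)) (dgV M deg) _ (dgV_dsum M deg).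
have [s [X'' [t' [g [f' [us hg hf' [Z [a [b [ha hb qa h1 h2]]]]]]]]]] :=
  cX1 (dgV M deg) (Phi deg x) idfun (conj qx (@dghom_id _ _)).
exists s => i; apply/negPn/negP => is_.
have [_ U0 _] := (minimal_right_idealP U).1 minU.
pose m : M := Subvs (memv_pick U).
have m0 : m != 0 by apply: contraNneq U0 => /(congr1 vsval) /= /eqP; rewrite vpick0.
pose v : dgV M deg := fs_inj M i m.
have [[p1 p2] p3 p4] := qx.
have [_ _ q3] := qa.
(* A cocycle [z] of the common denominator above [v]. In fact [a z = v], as the sum of shifts has no
   nonzero boundary. *)
have [|z dz [y' ey]] := q3 (Phi deg x v).
  by rewrite -p2 linear0.
have [//||x' /= ex'] := p3 (a z - v); first by exists y'; rewrite linearB.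
have az : a z = v by apply/eqP; rewrite -subr_eq0 ex'.
case: h2 => h [_ h2]; have := h2 z; rewrite dz [h 0]linear0 addr0 /= az hf' => e.
have := congr1 (fun f : fsum M I => f i) e.
rewrite fs_addE fs_oppE fs_sumE big_seq big1; last first.
  by move=> j js; rewrite fs_injE; case: eqP => // ij; rewrite ij js in is_.
rewrite subr0 /v fs_injE eqxx => m00.
by rewrite m00 eqxx in m0.
Qed.

Lemma finite_index X (I : choiceType) (deg : I -> int) (x : I -> X) (e : seq I) :
  presents hU deg x -> (forall i, i \in e) ->
  exists n (deg' : 'I_n -> int) (x' : 'I_n -> X), presents hU deg' x'.
Proof.
move=> hx he; pose s := undup e.
have us : uniq s by exact: undup_uniq.
exists (size s), (deg \o tnth (in_tuple s)), (x \o tnth (in_tuple s)).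
apply: presents_reindex hx.
  by have /tuple_uniqP h : uniq (in_tuple s) := us; exact: h.
move=> j; have /tnthP[i ->] : j \in in_tuple s by rewrite mem_undup.
by exists i.
Qed.

Lemma compact_finite_presents X : compact X ->
  exists n (deg : 'I_n -> int) (x : 'I_n -> X), presents hU deg x.
Proof.
move=> cX; have [I [deg [x hx]]] := presentation_exists hS hU minU X.
have [e he] := compact_finite_index hx cX.
exact: finite_index hx he.
Qed.

(** [is_qis] ignores degrees, so the lift [x] of a cycle of parity [b] may be mixed. Separating
    parities in the equation between [y] and the image of [x] shows that the part [x0] of parity [b]
    already works. *)
Lemma qis_scqis X Y (f : {linear X -> Y}) : is_qis f ->
  scqis (X := dgc X) (Y := dgc Y) (rs_map f).
Proof.
move=> [[f1 f2] f3 f4].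
have fh : schom (X := dgc X) (Y := dgc Y) (rs_map f).
  by split=> [b x hx i ib|x]; [rewrite -[LHS]f1 hx // linear0 | exact: f2].
split=> //.
  by move=> b x [_ dx] [y fy]; apply: f3 => //; exists y.
move=> b y [py dy]; have [x dx [y' ey]] := f4 y dy.
have [x0 [x1 [px0 px1 ex]]] := sc_par_dec (s := dgc X) b x.
have [y0 [y1 [py0 py1 ey']]] := sc_par_dec (s := dgc Y) (~~ b) y'.
have pdy0 : sc_par b (sc_dif (dgc Y) y0) by rewrite -[b]negbK; apply: sc_dif_par.
have pdy1 : sc_par (~~ b) (sc_dif (dgc Y) y1) by apply: sc_dif_par; rewrite -[b]negbK.
have dx0 : sc_dif (dgc X) x0 = 0.
  have e : sc_dif (dgc X) x0 = - sc_dif (dgc X) x1.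
    by apply/eqP; rewrite -subr_eq0 opprK -linearD -ex; apply/eqP.
  apply: (@sc_par_uniq _ (dgc X) b); last exact: sc_dif_par.
  rewrite e; apply: (lsubN (sc_par_sub (dgc X) b)).
  by rewrite -[b]negbK; apply: sc_dif_par.
exists x0 => //; exists (- y0); rewrite linearN.
have e : (y - rs_map f x0) + sc_dif (dgc Y) y0 = rs_map f x1 - sc_dif (dgc Y) y1.
  have grp (V : zmodType) (a1 a2 p q : V) : a1 + a2 - (p + q) - a1 + p = a2 - q.
    rewrite (addrC a1) -!addrA; congr (_ + _).
    by rewrite addrCA [a1 + _]addrA subrr add0r opprD addrAC addNr add0r.
  rewrite -[RHS](grp _ (rs_map f x0) _ (sc_dif (dgc Y) y0)); congr (_ - _ + _).
  by rewrite -!linearD -ex -ey' -[sc_dif _ _]ey opprB addrC subrK.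
have e0 : (y - rs_map f x0) + sc_dif (dgc Y) y0 = 0.
  apply: (@sc_par_uniq _ (dgc Y) b); last rewrite e.
    apply: (lsubD (sc_par_sub (dgc Y) b)) => //.
    by apply: (lsubB (sc_par_sub (dgc Y) b)) => //; apply: fh.1.
  by apply: (lsubB (sc_par_sub (dgc Y) (~~ b))) => //; apply: fh.1.
by apply/eqP; rewrite -addr_eq0 e0.
Qed.

Lemma fin_span_hdim X (t : seq (rs X)) : (forall x : rs X, spanm (fun y => y = 0) t x) ->
  forall b, exists n, hdim (dgc X) b n.
Proof.
move=> ht b; apply: (dimq_exists (t := t)); first exact: bdy_sub.
move=> x _; apply: spanm_trans (ht x); first exact/spanm_lsub/bdy_sub.
  by move=> y ->; case: (spanm_lsub t (bdy_sub (dgc X))).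
by move=> y; apply: mem_spanm; exact: bdy_sub.
Qed.

Lemma rs_ideal_span : exists t : seq (rs M), size t = \dim U /\
  indepm (fun y => y = 0) t /\ forall x : rs M, spanm (fun y => y = 0) t x.
Proof.
pose b := vbasis {: subvs_of U}.
have lsub0 := @lsub0 F (rs M).
have scE (a : F) (x : subvs_of U) : (a *: (x : rs M)) = (a *: x : subvs_of U) :> M.
  by apply: val_inj; rewrite /= -scalerAr mulr1.
have sumE (c : nat -> F) (n : nat) (s : seq (subvs_of U)) : \sum_(i < n) c i *: (s`_i : rs M) =
   (\sum_(i < n) c i *: s`_i : subvs_of U) :> M.
  by elim/big_rec2: _ => // i x y _ ->; rewrite scE.
exists b; split; first by rewrite size_tuple dimvf.
split.
  apply/indepmP => // c hc0 i hi.
  have {hc0} hc : (\sum_(i < size b) c i *: b`_i : subvs_of U) = 0 := etrans (esym (sumE _ _ _)) hc0.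
  move: hi hc; rewrite size_tuple => hi hc.
  have /freeP/(_ (fun i => c i) hc (Ordinal hi)) := basis_free (vbasisP {:subvs_of U}).
  by [].
move=> x; apply/spanmP.
pose c n := if insub n is Some i then coord b i (x : subvs_of U) else 0.
exists c; apply/eqP; rewrite subr_eq0; apply/eqP.
rewrite [RHS](sumE c (size b) b) /c.
rewrite [in LHS](coord_vbasis (memvf (x : subvs_of U))) size_tuple.
by apply: eq_bigr => i _; rewrite valK.
Qed.

End Compact.

(** * The Euler characteristic on K_0 *)

Section Classes.
Variables (F : fieldType) (C : falgType F).
Implicit Types X Y : dgmod C.

(** The default is [0] when the cohomology has no finite dimension; otherwise [eulerE] shows that
    the choice made by [xget] is harmless. *)
Definition euler X : int := xget 0 [set z | exists n0 n1 : nat,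
  [/\ hdim (dgc X) false n0, hdim (dgc X) true n1 & z = n0%:Z - n1%:Z]]%classic.

Lemma eulerE X n0 n1 : hdim (dgc X) false n0 -> hdim (dgc X) true n1 -> euler X = n0%:Z - n1%:Z.
Proof.
move=> h0 h1; rewrite /euler; have : [set z | exists n0 n1 : nat,
  [/\ hdim (dgc X) false n0, hdim (dgc X) true n1 & z = n0%:Z - n1%:Z]]%classic (n0%:Z - n1%:Z).
  by exists n0, n1.
move=> /(xgetI 0)[m0 [m1 [k0 k1 ->]]].
by rewrite (hdim_uniq h0 k0) (hdim_uniq h1 k1).
Qed.

Fixpoint chi (x : K0 C) : int := match x with
  | K0_class X _ => euler X
  | K0_zero => 0
  | K0_opp x => - chi x
  | K0_add x y => chi x + chi y
  end.

Fixpoint K0_nat (n : nat) (x : K0 C) : K0 C :=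
  if n is n'.+1 then K0_add x (K0_nat n' x) else K0_zero C.

Lemma chi_nat n x : chi (K0_nat n x) = n%:Z * chi x.
Proof. by elim: n => [|n IH] /=; rewrite ?mul0r // IH intS mulrDl mul1r. Qed.

Lemma K0_cancel (x y z : K0 C) : K0_eq (K0_add x z) (K0_add y z) -> K0_eq x y.
Proof.
have aux (w : K0 C) : K0_eq w (K0_add (K0_add w z) (K0_opp z)).
  apply: K0_trans (K0_addA _ _ _); apply: K0_trans (K0_add_congr (K0_refl w) (K0_addC (K0_opp z) z)).
  apply: K0_trans (K0_add_congr (K0_refl w) (K0_sym (K0_addN z))).
  by apply: K0_trans (K0_addC _ _); apply: K0_sym; apply: K0_add0.
move=> h; apply: K0_trans (aux x) _; apply: K0_trans (K0_sym (aux y)).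
exact: K0_add_congr h (K0_refl _).
Qed.

Lemma K0_addACA (x y z t : K0 C) :
  K0_eq (K0_add (K0_add x y) (K0_add z t)) (K0_add (K0_add x z) (K0_add y t)).
Proof.
apply: K0_trans (K0_addA _ _ _); apply: K0_trans (K0_sym (K0_addA _ _ _)) _.
apply: K0_add_congr (K0_refl _) _.
apply: K0_trans (K0_addA _ _ _) _; apply: K0_trans (K0_sym (K0_addA _ _ _)).
exact: K0_add_congr (K0_addC _ _) (K0_refl _).
Qed.

Lemma K0_natD m n x : K0_eq (K0_nat (m + n) x) (K0_add (K0_nat m x) (K0_nat n x)).
Proof.
elim: m => [|m IH] /=; first by apply: K0_sym; apply: K0_add0.
by apply: K0_trans (K0_addA _ _ _); apply: K0_add_congr IH; apply: K0_refl.
Qed.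

End Classes.

(** * K_0 is generated by the class of a minimal right ideal *)

Section Classification.
Variables (F : fieldType) (C : falgType F) (U : {vspace C}).
Hypotheses (hS : simple_alg C) (hU : (U * {:C} <= U)%VS) (minU : minimal_right_ideal U).
Implicit Types X Y : dgmod C.
Notation M := (rideal hU).

Lemma dgV_hdim n (deg : 'I_n -> int) b : exists m, hdim (dgc (dgV M deg)) b m.
Proof.
have [t [_ [_ ht]]] := rs_ideal_span hU.
pose r (i : 'I_n) := map (rs_map (fs_inj M i)) t.
apply: (@fin_span_hdim _ _ (dgV M deg) (flatten [seq r i | i <- enum 'I_n])) => x.
have -> : x = \sum_(i <- enum 'I_n) (fs_inj M i ((x : fsum M 'I_n) i) : rs (dgV M deg)).
  by apply: fs_expand; rewrite ?enum_uniq // => i; rewrite mem_enum.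
rewrite big_seq; apply: (lsub_sum _ (spanm_lsub _ (lsub0 _))) => i _.
have /(spanm_map (f := rs_map (fs_inj M i)) (B' := fun y => y = 0)) h := ht ((x : fsum M 'I_n) i : rs M).
apply: (spanm_subset (lsub0 _) _ (h _)); last by move=> _ ->; rewrite linear0.
by move=> y yr; apply/flattenP; exists (r i) => //; apply: map_f; rewrite mem_enum.
Qed.

Lemma shift_hdim g b : exists m, hdim (dgc (dg_shift M g)) b m.
Proof.
have [t [_ [_ ht]]] := rs_ideal_span hU.
exact: (@fin_span_hdim _ _ (dg_shift M g) t).
Qed.

Lemma compact_hdim X b : compact X -> exists m, hdim (dgc X) b m.
Proof.
move=> /(compact_finite_presents hS hU minU)[n [deg [x [_ _ qx]]]].
have [m hm] := dgV_hdim deg b; exists m.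
by apply/(hdim_qis b m (qis_scqis qx)).
Qed.

Lemma infinite_uniq (I : eqType) n : ~ (exists e : seq I, forall i, i \in e) ->
  exists s : seq I, uniq s /\ size s = n.
Proof.
move=> he; elim: n => [|n [s [us sn]]]; first by exists [::].
have /existsNP[i /negP is_] : ~ (forall i, i \in s) by move=> h; apply: he; exists s.
by exists (i :: s); rewrite /= is_ us sn.
Qed.

(** In a presentation each index contributes a class obtained from [vpick U], and these classes are
    independent in cohomology. More than [n0 + n1] indices are impossible, so the presentation is
    finite. *)
Lemma hdim_compact X n0 n1 : hdim (dgc X) false n0 -> hdim (dgc X) true n1 -> compact X.
Proof.
move=> [t0 [s0 q0 i0 h0]] [t1 [s1 q1 i1 h1]].
have [I [deg [x hx]]] := presentation_exists hS hU minU X.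
suff [e he] : exists e : seq I, forall i, i \in e.
  by have [n [deg' [x' hx']]] := finite_index hx he; apply: finite_presents_compact hx'.
apply: contrapT => /(infinite_uniq (n0 + n1).+1)[s [us sn]].
have [_ U0 _] := (minimal_right_idealP U).1 minU.
have [hx1 hx2 [[hq1 hq2] hq3 hq4]] := hx.
have hB := bdy_sub (dgc X).
pose v i : rs X := act (vpick U) (x i).
suff : (size (map v s) <= size (t0 ++ t1))%N.
  by rewrite size_map size_cat s0 s1 sn ltnn.
apply: (@steinitz _ _ (bdy (X := dgc X))) => //.
  apply/indepm_mapP => // c [y hy] i is_.
  pose m : M := Subvs (memv_pick U).
  have e : Phi hU deg x (\sum_(i <- s) fs_inj M i ((((c i)%:A : C) : C^c) *: m)) = \sum_(i <- s) c i *: v i.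
    rewrite linear_sum; apply: eq_bigr => j _; rewrite Phi_inj rs_scaleE /v -/(act _ _) actA.
    by [].
  have [//||y' /= ey] := hq3 (\sum_(i <- s) fs_inj M i ((((c i)%:A : C) : C^c) *: m)).
    by exists y; rewrite e.
  have := congr1 (fun f : fsum M I => f i) ey.
  rewrite fs_sumE (bigD1_seq i) //= eqxx big1 ?addr0; last first.
    by move=> j /negPf ij; rewrite eq_sym ij.
  move=> /(congr1 vsval) /= /eqP; rewrite -scalerAr mulr1 scaler_eq0 vpick0 (negPf U0) orbF.
  by move/eqP.
move=> _ /mapP[i _ ->].
have dv : sc_dif (dgc X) (v i) = 0 by rewrite [LHS]act_dif hx2 /act scaler0.
have [x0 [x1 [px0 px1 ex]]] := sc_par_dec (s := dgc X) false (v i).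
have dx0 : sc_dif (dgc X) x0 = 0.
  apply: (@sc_par_uniq _ (dgc X) true); first exact: (sc_dif_par (s := dgc X) (b := false)).
  have -> : sc_dif (dgc X) x0 = - sc_dif (dgc X) x1.
    by apply/eqP; rewrite -addr_eq0 -linearD -ex; apply/eqP.
  by apply: (lsubN (sc_par_sub (dgc X) false)); exact: (sc_dif_par (s := dgc X) (b := true)).
have dx1 : sc_dif (dgc X) x1 = 0.
  by move: dv; rewrite ex linearD dx0 add0r.
rewrite ex; apply: lsubD; first exact: spanm_lsub.
  apply: (spanm_subset hB _ (h0 _ (conj px0 dx0))) => y; by rewrite mem_cat => ->.
by apply: (spanm_subset hB _ (h1 _ (conj px1 dx1))) => y; rewrite mem_cat orbC => ->.
Qed.

(** Beyond the group laws, quasi-isomorphisms preserve cohomology and short exact sequences are the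
    case of [ses_euler]. *)
Lemma chi_eq (x y : K0 C) : K0_eq x y -> chi x = chi y.
Proof.
elim=> {x y} //=; try by move=> *; congruence.
- by move=> x y z; rewrite addrA.
- by move=> x y; rewrite addrC.
- by move=> x; rewrite add0r.
- by move=> x; rewrite addNr.
- move=> X Y cX cY f hf; have [n0 h0] := compact_hdim false cX; have [n1 h1] := compact_hdim true cX.
  rewrite (eulerE h0 h1); symmetry; apply: eulerE.
    by apply/(hdim_qis _ _ (qis_scqis hf)).
  by apply/(hdim_qis _ _ (qis_scqis hf)).
move=> X Y Z cX cY cZ f g hf hg fi gs ex.
have [x0 hx0] := compact_hdim false cX; have [x1 hx1] := compact_hdim true cX.
have [y0 hy0] := compact_hdim false cY; have [y1 hy1] := compact_hdim true cY.
have [z0 hz0] := compact_hdim false cZ; have [z1 hz1] := compact_hdim true cZ.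
rewrite (eulerE hx0 hx1) (eulerE hy0 hy1) (eulerE hz0 hz1).
have sch X' Y' (h : {linear X' -> Y'}) : is_dghom h -> schom (X := dgc X') (Y := dgc Y') (rs_map h).
  by move=> [h1 h2]; split=> [b x hx i ib|x]; [rewrite -[LHS]h1 hx // linear0 | exact: h2].
have := @ses_euler _ (dgc X) (dgc Y) (dgc Z) (rs_map f) (rs_map g) (sch _ _ _ hf) (sch _ _ _ hg) fi gs ex
  x0 x1 y0 y1 z0 z1 hx0 hx1 hy0 hy1 hz0 hz1.
by lia.
Qed.

Lemma shift_compact g : compact (dg_shift M g).
Proof.
have [n0 h0] := shift_hdim g false; have [n1 h1] := shift_hdim g true.
exact: hdim_compact h0 h1.
Qed.

Lemma ideal_compact : compact (dg_deg0 M).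
Proof. have [n0 h0] := shift_hdim 0 false; have [n1 h1] := shift_hdim 0 true.
exact: (@hdim_compact (dg_deg0 M) n0 n1). Qed.

Lemma euler_ideal : euler (dg_deg0 M) = (\dim U)%:Z.
Proof.
have [t [st [it ht]]] := rs_ideal_span hU.
rewrite (@eulerE _ _ (dg_deg0 M) (\dim U) 0) ?subr0 //; last first.
  exists [::]; split=> //= x [px _]; exists 0; rewrite linear0.
  exact: (px 0 isT).
have bd0 (x : rs M) : x = 0 <-> bdy (X := dgc (dg_deg0 M)) x.
  by split=> [->|[y ->]]; [exists 0; rewrite linear0|].
exists t; split=> //.
- move=> x _; split=> // i oi; have i0 : i != 0 by apply: contraNneq oi => ->.
  by rewrite /= /deg0_comp (negPf i0).
- have := it; elim: (t) => [//|y s IH] /= [/IH h1 h2]; split=> // h3; apply: h2.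
  by apply: eq_spanm h3 => z; rewrite -bd0.
by move=> x _; apply: eq_spanm (ht x).
Qed.

Let U0 : K0 C := K0_class ideal_compact.

(** The condition that [x] is [p - q] times the class of [U], written without subtraction; [normalP]
    shows that it always holds. *)
Definition normal_class (x : K0 C) := exists p q : nat,
  K0_eq (K0_add x (K0_nat q U0)) (K0_nat p U0).

Lemma normal_eq x y : K0_eq x y -> normal_class x -> normal_class y.
Proof.
move=> e [p [q h]]; exists p, q; apply: K0_trans h.
by apply: K0_add_congr (K0_refl _); apply: K0_sym.
Qed.

Lemma normal_add x y : normal_class x -> normal_class y -> normal_class (K0_add x y).
Proof.
move=> [p [q h]] [p' [q' h']]; exists (p + p')%N, (q + q')%N.
apply: K0_trans (K0_add_congr (K0_refl _) (K0_natD _ _ _)) _.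
apply: K0_trans (K0_addACA _ _ _ _) _; apply: K0_trans (K0_sym (K0_natD _ _ _)).
exact: K0_add_congr.
Qed.

Lemma normal_opp x : normal_class x -> normal_class (K0_opp x).
Proof.
move=> [p [q h]]; exists q, p.
apply: K0_trans (K0_add_congr (K0_refl _) (K0_sym h)) _.
apply: K0_trans (K0_addA _ _ _) _.
by apply: K0_trans (K0_add_congr (K0_addN _) (K0_refl _)) (K0_add0 _).
Qed.

Lemma normal_zero : normal_class (K0_zero C).
Proof. by exists 0%N, 0%N; apply: K0_add0. Qed.

Lemma normal_U0 : normal_class U0.
Proof. by exists 1%N, 0%N; apply: K0_refl. Qed.

Section Cone.
Variable g : int.
Notation N := (M * M)%type.
(** Grading of the cone of the identity of [M]: the first factor sits in degree [g + 1], the second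
    in degree [g], and the differential carries the second onto the first, so that the cone is
    acyclic. *)
Definition cone_comp_fun (i : int) (p : N) : N :=
  (if i == g + 1 then p.1 else 0, if i == g then p.2 else 0).
Fact cone_comp_linear i : linear (cone_comp_fun i).
Proof.
move=> a p q; rewrite /cone_comp_fun; congr (_, _) => /=; case: eqP => _ //=;
  by rewrite scaler0 addr0.
Qed.
HB.instance Definition _ i := GRing.isSemilinear.Build C^c N N _ (cone_comp_fun i)
  (GRing.semilinear_linear (cone_comp_linear i)).
Definition cone_comp i : {linear N -> N} := cone_comp_fun i.
Definition cone_dif_fun (p : N) : N := (p.2, 0).
Fact cone_dif_linear : linear cone_dif_fun.
Proof. by move=> a p q; congr (_, _); rewrite /= scaler0 addr0. Qed.
HB.instance Definition _ := GRing.isSemilinear.Build C^c N N _ cone_dif_fun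
  (GRing.semilinear_linear cone_dif_linear).
Definition cone_dif : {linear N -> N} := cone_dif_fun.
Fact cone_comp_comp i j p : cone_comp i (cone_comp j p) = if i == j then cone_comp j p else 0.
Proof.
rewrite /= /cone_comp_fun /=; have [->|ij] := eqVneq i j.
  by congr (_, _); case: eqP.
congr (_, _); first have [ei|//] := eqVneq i (g + 1); last have [ei|//] := eqVneq i g.
  by rewrite -ei eq_sym (negPf ij).
by rewrite -ei eq_sym (negPf ij).
Qed.
Fact cone_comp_sum p : exists s : seq int, uniq s /\ p = \sum_(i <- s) cone_comp i p.
Proof.
exists [:: g + 1; g]; have ne : (g + 1 == g) = false by lia.
split; first by rewrite /= inE ne.
rewrite big_cons big_seq1 /= /cone_comp_fun !eqxx ne eq_sym ne.
by case: p => u v; congr (_, _); rewrite /= ?addr0 ?add0r.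
Qed.
Fact cone_dif_deg i p : cone_comp (i + 1) (cone_dif p) = cone_dif (cone_comp i p).
Proof.
rewrite /= /cone_comp_fun /cone_dif_fun /= (inj_eq (addIr _)).
by congr (_, _); case: eqP.
Qed.
Fact cone_dif_dif p : cone_dif (cone_dif p) = 0. Proof. by []. Qed.
Definition cone : dgmod C := DGMod cone_comp_comp cone_comp_sum cone_dif_deg cone_dif_dif.

Definition empty_dg : dgmod C := dgV M (fun _ : 'I_0 => 0).

Lemma empty_dg0 (x : empty_dg) : x = 0.
Proof. by apply: fsumP => -[]. Qed.

Lemma cone_qis : is_qis (\0 : {linear empty_dg -> cone}).
Proof.
split; first exact: dghom_zero.
  by move=> x _ _; exists 0; apply: empty_dg0.
move=> [u v] [/= v0]; exists 0; first by [].
exists (0, - u); rewrite /= sub0r v0 /cone_dif_fun /=.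
by congr (_, _); rewrite /= oppr0.
Qed.

Lemma empty_dg_compact : compact empty_dg.
Proof.
have [n0 h0] := dgV_hdim (fun _ : 'I_0 => 0) false.
have [n1 h1] := dgV_hdim (fun _ : 'I_0 => 0) true.
exact: hdim_compact h0 h1.
Qed.

Lemma cone_compact : compact cone.
Proof.
have [n0 h0] := dgV_hdim (fun _ : 'I_0 => 0) false.
have [n1 h1] := dgV_hdim (fun _ : 'I_0 => 0) true.
by apply: (@hdim_compact cone n0 n1); apply/(hdim_qis _ _ (qis_scqis cone_qis)).
Qed.

(** The sequence of identity maps of the zero module is exact, so its class equals twice itself. *)
Lemma empty_class : K0_eq (K0_class empty_dg_compact) (K0_zero C).
Proof.
apply: (@K0_cancel _ _ _ _ (K0_class empty_dg_compact)).
apply: K0_trans (K0_sym (K0_add0 _)); apply: K0_sym.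
apply: (@K0_ses _ _ _ _ _ _ _ (idfun : {linear empty_dg -> empty_dg}) idfun) => //.
  by move=> z; exists z.
move=> y; split=> [_|_]; last exact: empty_dg0.
by exists y.
Qed.

Lemma cone_class : K0_eq (K0_class cone_compact) (K0_zero C).
Proof. exact: K0_trans (K0_sym (K0_qis empty_dg_compact _ cone_qis)) empty_class. Qed.

(** The cone is an extension of [M] in degree [g] by [M] in degree [g + 1], and its class is zero;
    moving [M] by one degree thus changes the sign of its class. *)
Lemma shift_succ_class :
  K0_eq (K0_add (K0_class (shift_compact (g + 1))) (K0_class (shift_compact g))) (K0_zero C).
Proof.
apply: K0_trans cone_class; apply: K0_sym.
have fl : linear (fun u : M => (u, 0) : N).
  by move=> a x y; congr (_, _); rewrite /= scaler0 addr0.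
pose f : {linear dg_shift M (g + 1) -> cone} :=
  HB.pack (fun u : M => (u, 0) : N) (GRing.isSemilinear.Build _ _ _ _ _ (GRing.semilinear_linear fl)).
have gl : linear (fun p : N => p.2) by [].
pose h : {linear cone -> dg_shift M g} :=
  HB.pack (fun p : N => p.2) (GRing.isSemilinear.Build _ _ _ _ _ (GRing.semilinear_linear gl)).
apply: (@K0_ses _ _ _ _ _ _ _ f h).
- split=> [i|] x.
    by rewrite /= /cone_comp_fun /sh_comp /=; congr (_, _); case: eqP => // _; case: eqP.
  by [].
- split=> [i|] x //.
  by rewrite /= /sh_comp; case: eqP.
- by move=> x y [].
- by move=> z; exists (0, z).
move=> [u v]; split=> [/= v0|[x [_ ->]]] //.
by exists u; rewrite [v]v0.
Qed.

End Cone.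

Lemma normal_shift g : normal_class (K0_class (shift_compact g)).
Proof.
have N0 : normal_class (K0_class (shift_compact 0)).
  apply: normal_eq normal_U0.
  exact: (@K0_qis _ (dg_deg0 M) (dg_shift M 0) _ _ idfun (@qis_id _ (dg_deg0 M))).
have succ i : normal_class (K0_class (shift_compact i)) -> normal_class (K0_class (shift_compact (i + 1))).
  move=> /normal_opp; apply: normal_eq.
  apply: (@K0_cancel _ _ _ _ (K0_class (shift_compact i))).
  exact: K0_trans (K0_addN _) (K0_sym (shift_succ_class i)).
have pred i : normal_class (K0_class (shift_compact (i + 1))) -> normal_class (K0_class (shift_compact i)).
  move=> /normal_opp; apply: normal_eq.
  apply: (@K0_cancel _ _ _ _ (K0_class (shift_compact (i + 1)))).
  apply: K0_trans (K0_addN _) (K0_sym _).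
  exact: K0_trans (K0_addC _ _) (shift_succ_class i).
elim/int_rect: g => [//|n IH|n IH]; first by rewrite -addn1 PoszD; apply: succ.
apply: pred; suff -> : (- Posz n.+1 + 1 = - Posz n)%R by [].
by lia.
Qed.

Section DGVSplit.
Variables (n : nat) (deg : 'I_n.+1 -> int).
Let V' := dgV M (fun i : 'I_n => deg (lift ord_max i)).
Let V := dgV M deg.

Fact ext_subproof (v : fsum M 'I_n) : exists s : seq 'I_n.+1, forall j, j \notin s ->
  (if unlift ord_max j is Some i then v i else 0) = 0.
Proof. by exists (enum 'I_n.+1) => j; rewrite mem_enum. Qed.
Definition ext_fun (v : V') : V := FSum (ext_subproof v).
Lemma ext_linear : linear ext_fun.
Proof.
move=> a v w; apply: fsumP => j /=; case: unlift => [i|]; first by [].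
by rewrite scaler0 addr0.
Qed.

Lemma dgV_split (cV' : compact V') (cV : compact V) :
  K0_eq (K0_class cV) (K0_add (K0_class cV') (K0_class (shift_compact (deg ord_max)))).
Proof.
pose f : {linear V' -> V} := HB.pack ext_fun
  (GRing.isSemilinear.Build _ _ _ _ _ (GRing.semilinear_linear ext_linear)).
have gl : linear (fun v : V => (v : fsum M _) ord_max) by [].
pose h : {linear V -> dg_shift M (deg ord_max)} := HB.pack (fun v : V => (v : fsum M _) ord_max)
  (GRing.isSemilinear.Build _ _ _ _ _ (GRing.semilinear_linear gl)).
have fE (v : V') i : (f v : fsum M _) (lift ord_max i) = (v : fsum M _) i by rewrite /= liftK.
apply: (@K0_ses _ _ _ _ _ _ _ f h).
- split=> [i|] v; apply: fsumP => j /=; last by case: unliftP.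
  by case: unliftP => [k ->|] //=; case: eqP.
- split=> [i|] v //=; rewrite /sh_comp eq_sym; by case: eqP.
- by move=> v w e; apply: fsumP => i; rewrite -!fE e.
- move=> z; exists (fs_inj M ord_max z); by rewrite /= eqxx.
move=> v; split=> [v0|[w ->]]; last by rewrite /= unlift_none.
have hs : exists s : seq 'I_n, forall i, i \notin s -> (v : fsum M _) (lift ord_max i) = 0.
  by exists (enum 'I_n) => i; rewrite mem_enum.
exists (FSum hs : V'); apply: fsumP => j /=.
by case: unliftP => [i ->|->].
Qed.
End DGVSplit.

Lemma dgV_compact n (deg : 'I_n -> int) : compact (dgV M deg).
Proof.
have [n0 h0] := dgV_hdim deg false; have [n1 h1] := dgV_hdim deg true.
exact: hdim_compact h0 h1.
Qed.

Lemma normal_dgV n (deg : 'I_n -> int) : normal_class (K0_class (dgV_compact deg)).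
Proof.
elim: n deg => [|n IH] deg.
  apply: normal_eq normal_zero; apply: K0_trans (K0_sym empty_class) _.
  have q : is_qis (\0 : {linear empty_dg -> dgV M deg}).
    split; first exact: dghom_zero.
      by move=> x _ _; exists 0; apply: empty_dg0.
    by move=> y _; exists 0 => //; exists 0; apply: fsumP => -[].
  exact: K0_qis q.
apply: normal_eq (K0_sym (dgV_split (dgV_compact _) (dgV_compact deg))) _.
exact: normal_add (IH _) (normal_shift _).
Qed.

Lemma normalP x : normal_class x.
Proof.
elim: x => [X cX||x|x hx y]; [|exact: normal_zero|exact: normal_opp|exact: normal_add].
have [n [deg [z [_ _ qz]]]] := compact_finite_presents hS hU minU cX.
exact: normal_eq (K0_qis _ _ qz) (normal_dgV deg).
Qed.

Lemma dim_ideal_gt0 : (0 < \dim U)%N.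
Proof. by have [_ h _] := (minimal_right_idealP U).1 minU; rewrite lt0n dimv_eq0. Qed.

Lemma chi_normal x p q : K0_eq (K0_add x (K0_nat q U0)) (K0_nat p U0) ->
  chi x = (p%:Z - q%:Z) * (\dim U)%:Z.
Proof. by move=> /chi_eq /=; rewrite !chi_nat /= euler_ideal mulrBl => <-; rewrite addrK. Qed.

(** By [normalP] both classes are integer multiples of the class of [U], whose Euler characteristic
    [\dim U] is nonzero. *)
Lemma chi_inj (x y : K0 C) : chi x = chi y -> K0_eq x y.
Proof.
have [p [q hx]] := normalP x; have [p' [q' hy]] := normalP y.
rewrite (chi_normal hx) (chi_normal hy) => /(mulIf _) e.
have {}e : (p + q' = p' + q)%N by have := e _; have := dim_ideal_gt0; lia.
apply: (@K0_cancel _ _ _ _ (K0_nat (q + q') U0)).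
have addE z r s t : K0_eq (K0_add z (K0_nat r U0)) (K0_nat t U0) ->
    K0_eq (K0_add z (K0_nat (r + s) U0)) (K0_nat (t + s) U0).
  move=> h; apply: K0_trans (K0_add_congr (K0_refl _) (K0_natD _ _ _)) _.
  apply: K0_trans (K0_addA _ _ _) _; apply: K0_trans (K0_sym (K0_natD _ _ _)).
  exact: K0_add_congr h (K0_refl _).
apply: K0_trans (addE _ _ q' _ hx) _; rewrite e [(q + q')%N]addnC.
exact: K0_sym (addE _ _ q _ hy).
Qed.

Lemma chi_dvd (x : K0 C) : exists m : int, chi x = m * (\dim U)%:Z.
Proof. by have [p [q /chi_normal ->]] := normalP x; exists (p%:Z - q%:Z). Qed.

Lemma has_classP X (a : K0 C) : compact X -> has_class X a <-> euler X = chi a.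
Proof.
move=> cX; split=> [[cX' /chi_eq//]|e].
by exists cX; apply: chi_inj.
Qed.

End Classification.

Section IndexIso.
Variables (F : fieldType) (C : falgType F).
Hypothesis hC : central_simple C.
Variable delta : nat.
Hypothesis dimC : \dim {:C} = (delta * delta)%N.

Let hZ : central_alg C. Proof. by case/central_simpleP: hC. Qed.
Let hS : simple_alg C. Proof. by case/central_simpleP: hC. Qed.

Lemma dim_minimal_right_ideal (U : {vspace C}) : minimal_right_ideal U ->
  \dim U = (delta * ind C)%N.
Proof.
have [d0 e0 h] := ind_dims hZ hS; move/h=> ->; congr (_ * _)%N.
have e : (d0 * d0 = delta * delta)%N by rewrite -e0.
by nia.
Qed.

Lemma ideal_has_class (U : {vspace C}) (hU : (U * {:C} <= U)%VS) (a : K0 C) :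
  minimal_right_ideal U ->
  has_class (dg_deg0 (rideal hU)) a <-> chi a = (delta * ind C)%N%:Z.
Proof.
move=> mU; rewrite -(dim_minimal_right_ideal mU) -(euler_ideal hU).
have c := ideal_compact hS hU mU.
by split=> [/(has_classP hS hU mU _ c)|e]; last apply/(has_classP hS hU mU _ c).
Qed.

Lemma delta_gt0 : (0 < delta)%N.
Proof.
have : (0 < \dim {:C})%N by rewrite dimvf FalgType_proper.
by rewrite dimC; case: (delta).
Qed.

(** By additivity the value on [ind C] decides: it is the class of [U], with Euler characteristic
    [delta * ind C]. Hence the class of [phi m] does not depend on the choice of [phi]. *)
Lemma ind_iso_chi (phi : int -> K0 C) (m : int) : ind_iso_K0 phi ->
  (Posz (ind C) %| m)%Z -> chi (phi m) = m * delta%:Z.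
Proof.
have [U mU] := minimal_right_ideal_exists C.
have hU : (U * {:C} <= U)%VS by case: mU.
move=> [h1 _ _ h4] /dvdzP[q ->].
have h0 : chi (phi 0) = 0.
  have := chi_eq hS hU mU (h1 0 0 (dvdz0 _) (dvdz0 _)); rewrite /= addr0 => e.
  by apply: (addrI (chi (phi 0))); rewrite -e addr0.
have hD (i j : int) : chi (phi ((i + j) * ind C)) = chi (phi (i * ind C)) + chi (phi (j * ind C)).
  have hij := h1 (i * ind C) (j * ind C) (dvdz_mull _ (dvdzz _)) (dvdz_mull _ (dvdzz _)).
  by have := chi_eq hS hU mU hij; rewrite mulrDl.
have hI : chi (phi ((1 : int) * ind C)) = (delta * ind C)%N%:Z.
  by rewrite mul1r; apply/(ideal_has_class hU _ mU); apply: h4.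
have hN (n : nat) : chi (phi (n%:Z * ind C)) = n%:Z * ind C * delta%:Z.
  elim: n => [|n IH]; first by rewrite !mul0r.
  rewrite intS hD hI IH PoszM; ring.
case: q => n; first exact: hN.
rewrite NegzE; have := hD (- n.+1%:Z) n.+1; rewrite addNr mul0r h0 hN => /esym/eqP.
by rewrite addr_eq0 => /eqP ->; rewrite -!mulNr.
Qed.

(** The witness sends [m] to [m / ind C] times the class of a minimal right ideal; off the multiples
    of [ind C] the quotient is rounded, which is harmless. *)
Lemma ind_iso_exists : exists phi : int -> K0 C, ind_iso_K0 phi.
Proof.
have [U mU] := minimal_right_ideal_exists C.
have hU : (U * {:C} <= U)%VS by case: mU.
have cU := ideal_compact hS hU mU.
pose u := K0_class cU.
have eu : chi u = (delta * ind C)%N%:Z by rewrite -(dim_minimal_right_ideal mU) -(euler_ideal hU).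
pose kz (q : int) : K0 C := match q with Posz n => K0_nat n u | Negz n => K0_opp (K0_nat n.+1 u) end.
have ekz q : chi (kz q) = q * (delta * ind C)%N%:Z.
  by case: q => n; rewrite /kz -?eu ?chi_nat // NegzE mulNr -chi_nat.
exists (fun m => kz (m %/ ind C)%Z).
have ephi m : (Posz (ind C) %| m)%Z -> chi (kz (m %/ ind C)%Z) = m * delta%:Z.
  by move=> dm; rewrite ekz PoszM [delta%:Z * _]mulrC mulrA divzK.
have d0 : delta%:Z != 0 by have := delta_gt0; lia.
split.
- move=> m n dm dn; apply: (chi_inj hS hU mU); rewrite /= !ephi ?mulrDl //.
  exact: rpredD.
- by move=> m n dm dn /(chi_eq hS hU mU); rewrite !ephi // => /(mulIf d0).
- move=> x; have [q eq] := chi_dvd hS hU mU x.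
  exists (q * ind C); first by rewrite dvdz_mull.
  apply: (chi_inj hS hU mU); rewrite ephi ?dvdz_mull // eq (dim_minimal_right_ideal mU) PoszM.
  by ring.
move=> U' hU' mU'; apply/(ideal_has_class hU' _ mU'); rewrite ephi ?dvdzz //.
by rewrite PoszM mulrC.
Qed.

End IndexIso.

(** * Galois descent *)

Section Trace.
Variables (k : fieldType) (L : splittingFieldType k).
Hypothesis hL : galois 1 {:L}.
Notation G := (gal_of {:L}).

Lemma galT : ('Gal({:L} / 1) = [set: G])%g.
Proof. by apply/setP => x; rewrite inE gal_kHom ?sub1v // k1AHom. Qed.

Lemma gal_fixed_base (a : L) : (forall rho : G, rho a = a) -> exists t : k, a = t%:A.
Proof.
move=> h; have : a \in fixedField ('Gal({:L} / 1))%g.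
  by apply/fixedFieldP; rewrite ?memvf.
by move/galois_fixedField: hL => -> /vlineP.
Qed.

Lemma gal_base (rho : G) (t : k) : rho t%:A = t%:A.
Proof. by rewrite linearZ rmorph1. Qed.

(* By independence of characters the matrix (rho(e_i)) has a right inverse. *)
Lemma gal_dual_bases : exists n (e c : 'I_n -> L),
  forall rho : G, \sum_i c i * rho (e i) = (rho == 1%g)%:R.
Proof.
pose n := \dim {:L}; pose e (i : 'I_n) := (vbasis {:L})`_i.
pose A := \matrix_(i < #|{: G}|, j < n) (enum_val i : G) (e j).
have /row_freeP[B AB] : row_free A.
  rewrite -kermx_eq0; apply/eqP/row_matrixP => i0; rewrite row0.
  set r := row _ _; have rA : r *m A = 0 by rewrite /r -row_mul mulmx_ker row0.
  have h (a : L) : a \in {:L}%VS -> \sum_(x : G) r 0 (enum_rank x) * x a = 0.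
    move=> _; rewrite (coord_vbasis (memvf a)).
    transitivity (\sum_j coord (vbasis {:L}) j a *: \sum_(x : G) r 0 (enum_rank x) * x (e j)).
      under [RHS]eq_bigr do rewrite scaler_sumr.
      rewrite [RHS]exchange_big /=; apply: eq_bigr => x _.
      by rewrite linear_sum mulr_sumr; apply: eq_bigr => j _; rewrite linearZ /= scalerAr.
    apply: big1 => j _; have /matrixP/(_ 0 j) := rA; rewrite !mxE => e0.
    rewrite (reindex _ (onW_bij _ (enum_val_bij _))) /=.
    rewrite (eq_bigr (fun i => r 0 i * A i j)) ?e0 ?scaler0 // => i _.
    by rewrite enum_valK [A _ _]mxE.
  have := gal_independent h; move=> h'.
  by apply/matrixP => i j; rewrite (ord1 i) [RHS]mxE -(enum_valK j) h'.
exists n, e, (fun i => B i (enum_rank (1%g : G))) => rho.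
have /matrixP/(_ (enum_rank rho) (enum_rank (1%g : G))) := AB.
rewrite !mxE (inj_eq enum_rank_inj) => <-; apply: eq_bigr => j _.
by rewrite [A _ _]mxE enum_rankK mulrC.
Qed.

Section Descent.
Variables (V : lmodType L) (gal : G -> V -> V).
Hypothesis galP : forall rho (a : L) x y, gal rho (a *: x + y) = rho a *: gal rho x + gal rho y.
Hypothesis galM : forall rho s x, gal s (gal rho x) = gal (rho * s)%g x.
Hypothesis gal1 : forall x, gal 1%g x = x.

Lemma galD rho x y : gal rho (x + y) = gal rho x + gal rho y.
Proof. by have := galP rho 1 x y; rewrite rmorph1 !scale1r. Qed.

Lemma gal0 rho : gal rho 0 = 0.
Proof. by apply: (addrI (gal rho 0)); rewrite -galD !addr0. Qed.

Lemma galZ rho a x : gal rho (a *: x) = rho a *: gal rho x.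
Proof. by have := galP rho a x 0; rewrite gal0 !addr0. Qed.

Lemma gal_sum rho (I : Type) (r : seq I) (P : pred I) (f : I -> V) :
  gal rho (\sum_(i <- r | P i) f i) = \sum_(i <- r | P i) gal rho (f i).
Proof.
by elim/big_rec2: _ => [|i x y _ <-]; [exact: gal0 | exact: galD].
Qed.

Definition gtr v := \sum_rho gal rho v.

Lemma gtrB x y : gtr (x - y) = gtr x - gtr y.
Proof.
rewrite /gtr -sumrB; apply: eq_bigr => rho _; apply/eqP; rewrite eq_sym subr_eq.
by rewrite -galD subrK.
Qed.

Lemma gtr_sum (I : Type) (r : seq I) (f : I -> V) :
  gtr (\sum_(i <- r) f i) = \sum_(i <- r) gtr (f i).
Proof.
by rewrite /gtr exchange_big /=; apply: eq_bigr => rho _; rewrite gal_sum.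
Qed.

Lemma gtr_fixed rho v : gal rho (gtr v) = gtr v.
Proof.
rewrite /gtr gal_sum [RHS](reindex_inj (mulIg rho)).
by apply: eq_bigr => s _; rewrite galM.
Qed.

(** Galois descent in explicit form: [V] is spanned over [L] by traces, which are fixed vectors. *)
Lemma gtr_expand n (e c : 'I_n -> L) v :
  (forall rho : G, \sum_i c i * rho (e i) = (rho == 1%g)%:R) ->
  v = \sum_i c i *: gtr (e i *: v).
Proof.
move=> h; transitivity (\sum_(rho : G) (\sum_i c i * rho (e i)) *: gal rho v).
  under eq_bigr do rewrite h.
  rewrite (bigD1 1%g) //= eqxx scale1r gal1 big1 ?addr0 // => rho /negPf ->.
  by rewrite scale0r.
under eq_bigr do rewrite scaler_suml.
rewrite exchange_big /=; apply: eq_bigr => i _; rewrite /gtr scaler_sumr.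
by apply: eq_bigr => rho _; rewrite galZ scalerA.
Qed.

Lemma gtr_scale_fixed (a : L) w : (forall rho, gal rho w = w) ->
  gtr (a *: w) = (\sum_(rho : G) rho a) *: w.
Proof.
by move=> hw; rewrite /gtr scaler_suml; apply: eq_bigr => rho _; rewrite galZ hw.
Qed.

End Descent.

Definition trL (a : L) := \sum_(rho : G) rho a.

Lemma trL_base a : exists t : k, trL a = t%:A.
Proof.
apply: gal_fixed_base => s; rewrite /trL rmorph_sum [RHS](reindex_inj (mulIg s)).
by apply: eq_bigr => rho _; rewrite galM ?memvf.
Qed.

Lemma trL_expand n (e c : 'I_n -> L) a :
  (forall rho : G, \sum_i c i * rho (e i) = (rho == 1%g)%:R) ->
  a = \sum_i c i * trL (e i * a).
Proof.
move=> h; apply: (@gtr_expand L^o (fun rho x => rho x)) h => //.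
- by move=> rho b x y; rewrite rmorphD rmorphM.
- by move=> x; rewrite gal_id.
Qed.

(** The trace is not identically zero, for otherwise the expansion of [1] through the dual bases
    would vanish. Its values lie in [k], so a nonzero one can be rescaled to [1]. *)
Lemma trL_eq1 : exists a, trL a = 1.
Proof.
have [n [e [c h]]] := gal_dual_bases.
have [i hi] : exists i, trL (e i * 1) != 0.
  apply: contrapT => hn; have := oner_neq0 L; rewrite (trL_expand 1 h) big1 ?eqxx // => i _.
  by have [->|h'] := eqVneq (trL (e i * 1)) 0; [rewrite mulr0 | case: hn; exists i].
have [t ht] := trL_base (e i * 1).
have t0 : t != 0 by apply: contraNneq hi; rewrite ht => ->; rewrite scale0r.
exists (t^-1 *: (e i * 1)); rewrite /trL.
under eq_bigr do rewrite linearZ /=.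
by rewrite -scaler_sumr -/(trL _) ht scalerA mulVf ?scale1r.
Qed.

Section HdimDescent.
Variables (V : scplx L) (W : scplx k) (inc : W -> V) (gal : G -> V -> V).
Hypothesis galP : forall rho (a : L) x y, gal rho (a *: x + y) = rho a *: gal rho x + gal rho y.
Hypothesis galM' : forall rho s x, gal s (gal rho x) = gal (rho * s)%g x.
Hypothesis gal1 : forall x, gal 1%g x = x.
Hypothesis incP : forall a x y, inc (a *: x + y) = a%:A *: inc x + inc y.
Hypothesis inc_inj : injective inc.
Hypothesis inc_fix : forall v, (exists w, inc w = v) <-> forall rho, gal rho v = v.
Hypothesis inc_dif : forall w, inc (sc_dif W w) = sc_dif V (inc w).
Hypothesis inc_par : forall b w, sc_par b w -> sc_par b (inc w).

Let incD x y : inc (x + y) = inc x + inc y.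
Proof. by have := incP 1 x y; rewrite !scale1r. Qed.
Let inc0 : inc 0 = 0.
Proof. by apply: (addrI (inc 0)); rewrite -incD !addr0. Qed.
Let incZ a x : inc (a *: x) = a%:A *: inc x.
Proof. by have := incP a x 0; rewrite inc0 !addr0. Qed.
Let inc_sum (I : Type) (r : seq I) (f : I -> W) : inc (\sum_(i <- r) f i) = \sum_(i <- r) inc (f i).
Proof. by elim/big_rec2: _ => [|i x y _ <-]; [exact: inc0 | exact: incD]. Qed.
Let inc_gal rho w : gal rho (inc w) = inc w.
Proof. by move: rho; apply/inc_fix; exists w. Qed.

Let inc_par_inv b w : sc_par b (inc w) -> sc_par b w.
Proof.
move=> pw; have [w0 [w1 [p0 p1 e]]] := sc_par_dec b w.
suff w10 : w1 = 0 by rewrite e w10 addr0.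
apply: inc_inj; rewrite inc0; apply: (@sc_par_uniq _ V b); last exact: inc_par.
have -> : inc w1 = inc w - inc w0 by rewrite e incD addrC addKr.
by apply: (lsubB (sc_par_sub V b)) => //; exact: inc_par.
Qed.

(** Cohomological form of [V = L \otimes_k W]. Compatibility of [gal] with the differential and with
    parities is deduced from the fact that the image of [inc] spans [V] over [L]. *)
Lemma hdim_descent b n : hdim V b n -> hdim W b n.
Proof.
have [N [e [c hec]]] := gal_dual_bases.
have gexp v := @gtr_expand V gal galP gal1 N e c v hec.
have /choice[rt hrt] (v : V) : exists w, inc w = gtr gal v.
  by apply/inc_fix => rho; apply: (gtr_fixed galP galM').
have gdif rho v : gal rho (sc_dif V v) = sc_dif V (gal rho v).
  rewrite [v]gexp linear_sum !(gal_sum galP) linear_sum; apply: eq_bigr => i _.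
  by rewrite linearZ /= !(galZ galP) linearZ /= -hrt -inc_dif !inc_gal inc_dif.
(* The traces of the [e i *: v] are split by parity in [W]; the parts of the wrong parity add up to
   zero because [v] has parity [b]. *)
have gpar rho v : sc_par b v -> sc_par b (gal rho v).
  move=> pv; have /choice[w hw] i : exists w : W * W,
      [/\ sc_par b w.1, sc_par (~~ b) w.2 & rt (e i *: v) = w.1 + w.2].
    by have [w0 [w1 [? ? ?]]] := sc_par_dec b (rt (e i *: v)); exists (w0, w1).
  have ev : v = \sum_i c i *: inc (w i).1 + \sum_i c i *: inc (w i).2.
    rewrite -big_split [LHS]gexp; apply: eq_bigr => i _ /=.
    by rewrite -scalerDr -incD -hrt; case: (hw i) => _ _ ->.
  have p1 : sc_par b (\sum_i c i *: inc (w i).1).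
    apply: (lsub_sum _ (sc_par_sub V b)) => i _; apply: (lsubZ _ (sc_par_sub V b)).
    by apply: inc_par; case: (hw i).
  have p2 : sc_par (~~ b) (\sum_i c i *: inc (w i).2).
    apply: (lsub_sum _ (sc_par_sub V _)) => i _; apply: (lsubZ _ (sc_par_sub V _)).
    by apply: inc_par; case: (hw i).
  have z2 : \sum_i c i *: inc (w i).2 = 0.
    apply: (@sc_par_uniq _ V b) p2.
    have -> : \sum_i c i *: inc (w i).2 = v - \sum_i c i *: inc (w i).1.
      by rewrite {1}ev addrC addKr.
    exact: (lsubB (sc_par_sub V b)).
  rewrite ev z2 addr0 (gal_sum galP); apply: (lsub_sum _ (sc_par_sub V b)) => i _.
  rewrite (galZ galP) inc_gal; apply: (lsubZ _ (sc_par_sub V b)).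
  by apply: inc_par; case: (hw i).
have gcyc v : cyc b v -> cyc b (gtr gal v).
  move=> [pv dv]; split.
    by apply: (lsub_sum _ (sc_par_sub V b)) => rho _; apply: gpar.
  rewrite /gtr linear_sum big1 // => rho _; rewrite -gdif dv.
  exact: (gal0 galP).
have rcyc v : cyc b v -> cyc b (rt v).
  move=> /gcyc; rewrite -hrt => -[p d]; split; first exact: inc_par_inv.
  by apply: inc_inj; rewrite inc0 inc_dif.
have icyc w : cyc b w -> cyc b (inc w).
  by move=> [p d]; split; [exact: inc_par | rewrite -inc_dif d inc0].
have gtrdif v : gtr gal (sc_dif V v) = sc_dif V (gtr gal v).
  by rewrite /gtr linear_sum; apply: eq_bigr => rho _; rewrite gdif.
have [a1 ha1] := trL_eq1.
have /choice[tk htk] := trL_base.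
move=> hV; have [s [sn qs is_ hs]] := hV.
have cycZ (a : L) (v : V) : cyc b v -> cyc b (a *: v) by move=> h; apply: (lsubZ _ (cyc_sub V b)).
(* the traces of L-multiples of a spanning family span over k *)
pose ws := [seq rt (e i *: x) | i <- enum 'I_N, x <- s].
have wsP w : w \in ws -> cyc b w.
  by move=> /allpairsP[[i x] [_ /= /qs xs ->]]; apply/rcyc/cycZ.
have [m hW] : exists m, hdim W b m.
  apply: (dimq_exists (t := ws)); first exact: bdy_sub.
  move=> w cw; have : spanm (bdy (X := V)) (map inc ws) (inc w).
    apply: (spanm_trans (spanm_lsub _ (bdy_sub V))) (hs _ (icyc _ cw)).
      by move=> y; apply: spanm_sub; exact: bdy_sub.
    move=> x xs; rewrite [x]gexp.
    apply: (lsub_sum _ (spanm_lsub _ (bdy_sub V))) => i _.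
    apply: (lsubZ _ (spanm_lsub _ (bdy_sub V))); rewrite -hrt.
    apply/mem_spanm/map_f; first exact: bdy_sub.
    by apply/allpairsP; exists (i, x); rewrite mem_enum.
  move=> /spanmP[lam [v ev]]; rewrite size_map in ev.
  (* Coefficients [lam] in [L] are moved to [k] by multiplying with [a1] and taking traces, which
     fixes [inc w] since [a1] has trace [1]. *)
  apply/spanmP; exists (fun i => tk (a1 * lam i)); exists (rt (a1 *: v)); apply: inc_inj.
  rewrite inc_dif hrt -gtrdif linearZ /= -ev scalerBr (gtrB galP) (gtr_scale_fixed galP) // -/(trL _) ha1 scale1r.
  apply: (addIr (inc (\sum_(i < size ws) tk (a1 * lam i) *: ws`_i))); rewrite -incD subrK.
  rewrite scaler_sumr (gtr_sum galP) inc_sum -addrA [X in _ + X]addrC -sumrB big1 ?addr0 // => i _.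
  by rewrite (nth_map 0) // scalerA (gtr_scale_fixed galP) // -/(trL _) htk incZ subrr.
rewrite -(_ : m = n) //; apply: hdim_uniq hV.
have [t [<- qt it ht]] := hW.
exists (map inc t); split; first by rewrite size_map.
- by move=> _ /mapP[w /qt/icyc ? ->].
- apply/indepmP; first exact: bdy_sub.
  move=> lam [v ev] j; rewrite size_map => jt; rewrite size_map in ev.
  (* Multiplying the relation by [e i] and taking traces gives one with coefficients in [k]. When
     all the [trL (e i * lam j)] vanish, so does [lam j]. *)
  have key i : trL (e i * lam j) = 0.
    rewrite htk; have /indepmP := it => /(_ (bdy_sub W) (fun j => tk (e i * lam j))) -> //.
      by rewrite scale0r.
    exists (rt (e i *: v)); apply: inc_inj; rewrite inc_dif hrt -gtrdif linearZ /= -ev.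
    rewrite scaler_sumr (gtr_sum galP) inc_sum; apply: eq_bigr => j' _.
    by rewrite (nth_map 0) // scalerA (gtr_scale_fixed galP) // -/(trL _) htk incZ.
  by rewrite (trL_expand (lam j) hec) big1 // => i _; rewrite key mulr0.
move=> v cv; rewrite [v]gexp; apply: (lsub_sum _ (spanm_lsub _ (bdy_sub V))) => i _.
apply: (lsubZ _ (spanm_lsub _ (bdy_sub V))); rewrite -hrt.
have /spanmP[lam [w ew]] := ht _ (rcyc _ (cycZ (e i) _ cv)).
apply/spanmP; exists (fun j => (lam j)%:A), (inc w); rewrite -inc_dif -ew size_map.
apply: (addIr (\sum_(i < size t) (lam i)%:A *: (map inc t)`_i)); rewrite subrK.
rewrite (eq_bigr (fun j : 'I_(size t) => inc (lam j *: t`_j))) => [|j _].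
  by rewrite -inc_sum -incD subrK.
by rewrite (nth_map 0) // incZ.
Qed.
End HdimDescent.
End Trace.

Lemma vbasis_dimq (F : fieldType) (V : vectType F) :
  dimq (fun _ : V => True) (fun x => x = 0) (\dim {:V}).
Proof.
pose b := vbasis {:V}; exists b; split=> //; first by rewrite size_tuple.
  apply/indepmP; first exact: lsub0.
  move=> c hc i hi; move: hi hc; rewrite size_tuple => hi hc.
  by have /freeP/(_ (fun i => c i) hc (Ordinal hi)) := basis_free (vbasisP {:V}).
move=> x _; apply/spanmP.
pose c n := if insub n is Some i then coord b i x else 0.
exists c; apply/eqP; rewrite subr_eq0; apply/eqP.
rewrite [in LHS](coord_vbasis (memvf x)) size_tuple.
by apply: eq_bigr => i _; rewrite /c valK.
Qed.

Section TrivialComplex.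
Variables (F : fieldType) (V : vectType F).
(** A vector space as an even complex with zero differential, so that plain dimension counts are
    instances of [hdim_descent]. *)
Definition triv_par (b : bool) (x : V) := b -> x = 0.
Fact triv_par_sub b : lsub (triv_par b).
Proof. by split=> // a x y hx hy hb; rewrite hx // hy // scaler0 addr0. Qed.
Fact triv_par_dec b (x : V) : exists x0 x1, [/\ triv_par b x0, triv_par (~~ b) x1 & x = x0 + x1].
Proof.
by case: b; [exists 0, x; rewrite add0r | exists x, 0; rewrite addr0].
Qed.
Fact triv_par_uniq b (x : V) : triv_par b x -> triv_par (~~ b) x -> x = 0.
Proof. by case: b => [h _|_ h]; apply: h. Qed.
Fact triv_dif_par b (x : V) : triv_par b x -> triv_par (~~ b) ((\0 : {linear V -> V}) x).
Proof. by []. Qed.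
Definition triv : scplx F :=
  @SCplx F V triv_par (\0 : {linear V -> V}) triv_par_sub triv_par_dec triv_par_uniq
    triv_dif_par (fun=> erefl).

Lemma triv_hdim : hdim triv false (\dim {:V}).
Proof.
have [s [sn _ is_ hs]] := vbasis_dimq V.
have bd0 (x : V) : x = 0 <-> bdy (X := triv) x.
  by split=> [->|[y ->]]; [exists 0; rewrite linear0|].
exists s; split=> // [|x _].
  have := is_; elim: (s) => [//|y r IH] /= [/IH h1 h2]; split=> // h3; apply: h2.
  by apply: eq_spanm h3 => z; rewrite -bd0.
exact: eq_spanm (hs x I).
Qed.
End TrivialComplex.

(** * Maps semilinear in every slot of the tensor product *)

Section Multilinear.
Variables (k : fieldType) (l : fieldExtType k) (L : splittingFieldType k).
Variable iota : 'AHom(l, L).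
Notation G := (gal_of {:L}).
Notation GH := (cosetT iota).

Lemma updE (V : eqType) (v : {ffun GH -> V}) s x c : upd v s x c = if c == s then x else v c.
Proof. by rewrite ffunE. Qed.

Lemma upd_id (V : eqType) (v : {ffun GH -> V}) s : upd v s (v s) = v.
Proof. by apply/ffunP => c; rewrite updE; case: eqP => [->|]. Qed.

Lemma upd_upd (V : eqType) (v : {ffun GH -> V}) s x y : upd (upd v s x) s y = upd v s y.
Proof. by apply/ffunP => c; rewrite !updE; case: eqP. Qed.

Fact base_coset_subproof : (galH iota :* 1)%g \in rcosets (galH iota) [set: G].
Proof. by apply/rcosetsP; exists 1%g; rewrite ?inE. Qed.
Definition base_coset : GH := exist _ (galH iota :* 1)%g base_coset_subproof.

Section Msl.
Variables (N : lmodType l) (T : lmodType L) (f : {ffun GH -> N} -> T).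

Definition msl := forall (v : {ffun GH -> N}) (s : GH) (a : l) (x y : N),
  f (upd v s (a *: x + y)) = emb s a *: f (upd v s x) + f (upd v s y).

Hypothesis fm : msl.

Lemma msl0 v s : f (upd v s 0) = 0.
Proof.
have := fm v s 1 0 0; rewrite scaler0 addr0 rmorph1 scale1r.
by rewrite -{1}[f _]addr0 => /addrI.
Qed.

Lemma mslZ v s a x : f (upd v s (a *: x)) = emb s a *: f (upd v s x).
Proof. by have := fm v s a x 0; rewrite addr0 msl0 addr0. Qed.

Lemma mslD v s x y : f (upd v s (x + y)) = f (upd v s x) + f (upd v s y).
Proof. by have := fm v s 1 x y; rewrite rmorph1 !scale1r. Qed.

Lemma mslN v s x : f (upd v s (- x)) = - f (upd v s x).
Proof. by rewrite -[- x]scaleN1r mslZ rmorphN rmorph1 scaleN1r. Qed.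

Lemma msl_sum v s (I : Type) (r : seq I) (x : I -> N) :
  f (upd v s (\sum_(i <- r) x i)) = \sum_(i <- r) f (upd v s (x i)).
Proof. by elim/big_rec2: _ => [|i u w _ <-]; [exact: msl0 | exact: mslD]. Qed.

Lemma msl_eq0 (v : {ffun GH -> N}) (s : GH) : v s = 0 -> f v = 0.
Proof. by move=> e; rewrite -(upd_id v s) e msl0. Qed.

(** Distributivity over all slots, by induction on the set of slots already expanded. Index
    functions are pinned to a fixed [i0] on the other slots, so that the sum always runs over
    functions on the whole of [GH]. *)
Lemma msl_expand (I : finType) (c : GH -> I -> l) (y : GH -> I -> N) :
  f [ffun s => \sum_i c s i *: y s i] =
  \sum_(g : {ffun GH -> I}) (\prod_s emb s (c s (g s))) *: f [ffun s => y s (g s)].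
Proof.
have [i0|I0] := pickP (pred_of_simpl (@predT I)); last first.
  (* With no indices the right side is an empty sum, and the left side has a zero in the slot of
     [base_coset]. *)
  have s := base_coset; rewrite (@msl_eq0 _ s); last by rewrite ffunE big1 // => i; have := I0 i.
  by rewrite big1 // => g _; have := I0 (g s).
move=> _.
have main (r : seq GH) : uniq r -> forall v : {ffun GH -> N},
  f [ffun s => if s \in r then \sum_i c s i *: y s i else v s] =
  \sum_(g : {ffun GH -> I} | [forall s, (s \notin r) ==> (g s == i0)])
    (\prod_(s <- r) emb s (c s (g s))) *: f [ffun s => if s \in r then y s (g s) else v s].
  elim: r => [_ v|s0 r IH /= /andP[s0r ur] v].
    rewrite (eq_bigl (pred1 [ffun=> i0])); last first.
      move=> g; apply/forallP/eqP => [h|-> s]; last by rewrite ffunE eqxx implybT.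
      by apply/ffunP => s; have := h s; rewrite ffunE => /eqP.
    by rewrite big_pred1_eq big_nil scale1r; congr f.
  pose w := [ffun s => if s \in r then \sum_i c s i *: y s i else v s].
  have -> : [ffun s => if s \in s0 :: r then \sum_i c s i *: y s i else v s] =
      upd w s0 (\sum_i c s0 i *: y s0 i).
    by apply/ffunP => s; rewrite !ffunE inE; case: eqP => [->|].
  rewrite msl_sum.
  rewrite [RHS](partition_big (fun g : {ffun GH -> I} => g s0) xpredT) //=.
  apply: eq_bigr => i _; rewrite mslZ.
  have -> : upd w s0 (y s0 i) = [ffun s => if s \in r then \sum_i c s i *: y s i else upd v s0 (y s0 i) s].
    apply/ffunP => s; rewrite !ffunE; case: (eqVneq s s0) => [->|//].
    by rewrite (negPf s0r).
  rewrite IH // scaler_sumr.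
  (* Functions with value [i] at [s0] correspond to functions pinned to [i0] there. *)
  rewrite [RHS](reindex_onto (fun g => upd g s0 i) (fun g => upd g s0 i0)) /=; last first.
    move=> g /andP[_ /eqP <-]; rewrite upd_upd; exact: upd_id.
  apply: eq_big => g.
    rewrite updE eqxx eqxx andbT; apply/forallP/andP => [h|[/forallP h /eqP e] s].
      split; last first.
        apply/eqP; rewrite upd_upd -[RHS](upd_id _ s0); congr upd.
        by have := h s0; rewrite s0r => /eqP.
      apply/forallP => s; rewrite updE inE negb_or; apply/implyP => /andP[/negPf -> sr].
      by have := h s; rewrite sr.
    apply/implyP => sr; have := h s; rewrite inE negb_or sr andbT updE.
    have [->|//] := eqVneq s s0; move=> _.
    by rewrite -e upd_upd updE eqxx.
  move=> h; rewrite scalerA big_cons updE eqxx; congr (_ * _ *: f _).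
    apply: eq_big_seq => s sr; rewrite updE; case: eqP => // e.
    by rewrite e (negPf s0r) in sr.
  apply/ffunP => s; rewrite !ffunE inE; have [->|//] := eqVneq s s0.
  by rewrite (negPf s0r) /=.
have := main (enum {: GH}) (enum_uniq _) [ffun=> 0].
have e1 (h : GH -> N) : [ffun s => if s \in enum {: GH} then h s else [ffun=> 0 : N] s] = [ffun s => h s].
  by apply/ffunP => s; rewrite !ffunE mem_enum.
rewrite e1 => ->; apply: eq_big => [g|g _].
  by apply/forallP => s; rewrite mem_enum.
by rewrite big_enum e1.
Qed.

End Msl.
End Multilinear.

(** * Weil restriction of central simple algebras *)

Section Optens.
Variables (F : fieldType) (A B : falgType F).

Lemma optens_pure_linl a (x x' : A) (y : B) :
  optens_pure (a *: x + x') y = a *: optens_pure x y + optens_pure x' y.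
Proof.
apply/ffunP => p; apply: etrans (ffunE _ _) _; apply: esym; apply: etrans (ffunE _ _) _.
rewrite ![fun_of_fin _ _]ffunE /crd linearP /= mulrDl; congr (_ + _).
exact: mulrA.
Qed.

Lemma optens_pure_linr a (x : A) (y y' : B) :
  optens_pure x (a *: y + y') = a *: optens_pure x y + optens_pure x y'.
Proof.
apply/ffunP => p; apply: etrans (ffunE _ _) _; apply: esym; apply: etrans (ffunE _ _) _.
rewrite ![fun_of_fin _ _]ffunE /crd linearP /= mulrDr; congr (_ + _).
exact: mulrCA.
Qed.

Lemma optens_pureZl a (x : A) (y : B) : optens_pure (a *: x) y = a *: optens_pure x y.
Proof. exact: (linear_funZ (fun a x x' => optens_pure_linl a x x' y)). Qed.

Lemma optens_pureZr a (x : A) (y : B) : optens_pure x (a *: y) = a *: optens_pure x y.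
Proof. exact: (linear_funZ (fun a y y' => optens_pure_linr a x y y')). Qed.

Lemma optens_pure_suml (I : Type) (r : seq I) (P : pred I) (x : I -> A) (y : B) :
  optens_pure (\sum_(i <- r | P i) x i) y = \sum_(i <- r | P i) optens_pure (x i) y.
Proof. exact: (linear_fun_sum (fun a x x' => optens_pure_linl a x x' y)). Qed.

Lemma optens_pure_sumr (I : Type) (r : seq I) (P : pred I) (x : A) (y : I -> B) :
  optens_pure x (\sum_(i <- r | P i) y i) = \sum_(i <- r | P i) optens_pure x (y i).
Proof. exact: (linear_fun_sum (fun a y y' => optens_pure_linr a x y y')). Qed.

Definition opcoef (ij : 'I_(\dim {:A}) * 'I_(\dim {:B})) (z : optens A B) : F :=
  (z : {ffun _ -> F^o}) ij.

Lemma opcoef_linear ij a (z z' : optens A B) : opcoef ij (a *: z + z') = a * opcoef ij z + opcoef ij z'.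
Proof.
by rewrite /opcoef; apply: etrans (ffunE _ _) _; congr (_ + _); apply: etrans (ffunE _ _) _.
Qed.

Lemma opcoef_pure ij x y : opcoef ij (optens_pure x y) = crd ij.1 x * crd ij.2 y.
Proof. exact: ffunE. Qed.

Lemma optens_expand (z : optens A B) :
  z = \sum_ij opcoef ij z *: optens_pure (bas ij.1) (bas ij.2).
Proof.
apply/ffunP => p; rewrite -[RHS]/(opcoef p _).
have sumE (r : seq ('I_(\dim {:A}) * 'I_(\dim {:B}))) (f : _ -> optens A B) :
    opcoef p (\sum_(i <- r) f i) = \sum_(i <- r) opcoef p (f i).
  elim/big_rec2: _ => [|i x y _ <-]; first by rewrite /opcoef ffunE.
  by have := opcoef_linear p 1 (f i) y; rewrite scale1r mul1r.
rewrite sumE (bigD1 p) //= big1 ?addr0 => [|q qp].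
  have := opcoef_linear p (opcoef p z) (optens_pure (bas p.1) (bas p.2)) 0.
  rewrite addr0 => ->; rewrite opcoef_pure !crd_bas !eqxx mulr1 mulr1.
  by rewrite [opcoef p 0]ffunE addr0.
have := opcoef_linear p (opcoef q z) (optens_pure (bas q.1) (bas q.2)) 0.
rewrite addr0 => ->; rewrite opcoef_pure !crd_bas [opcoef p 0]ffunE addr0 -natrM mulnb.
by rewrite -xpair_eqE -!surjective_pairing (negPf qp) mulr0.
Qed.

Lemma dim_optens : \dim {: optens A B} = (\dim {:A} * \dim {:B})%N.
Proof.
rewrite [LHS](dim_ffun ('I_(\dim {:A}) * 'I_(\dim {:B}))%type F^o) card_prod !card_ord.
have -> : \dim {: F^o} = 1%N by rewrite dimvf.
by rewrite muln1.
Qed.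

End Optens.

Section AzumayaUnits.
Variables (F : fieldType) (B : falgType F).

(** Every linear [phi] is the sum over [i] and [j] of [co j (phi (E i))] times the rank-one map
    [x |-> co i x *: E j], so it is enough to write the rank-one maps as sandwiches. *)
Lemma azumaya_units (I : finType) (co : I -> B -> F) (E : I -> B) :
  (forall x, x = \sum_i co i x *: E i) ->
  (forall c f, exists s : seq (B * B), forall x, \sum_(p <- s) p.1 * x * p.2 = co c x *: E f) ->
  azumaya B.
Proof.
move=> hx hu phi phil.
have phi_sum (r : seq I) (a : I -> F) (y : I -> B) :
    phi (\sum_(i <- r) a i *: y i) = \sum_(i <- r) a i *: phi (y i).
  by elim/big_rec2: _ => [|i u v _ <-]; [exact: (linear_fun0 phil) | rewrite phil].
have /choice[S hS] (p : I * I) : exists s : seq (B * B), forall x,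
    \sum_(q <- s) q.1 * x * q.2 = co p.1 x *: E p.2 by apply: hu.
exists (flatten [seq [seq (co p.2 (phi (E p.1)) *: q.1, q.2) | q <- S p] | p <- enum {: I * I}]).
move=> x; rewrite big_flatten big_map big_enum /=.
under eq_bigr => p _.
  rewrite big_map; under eq_bigr => q _ do rewrite -scalerAl -scalerAl.
  rewrite -scaler_sumr hS scalerA.
  over.
rewrite -(pair_bigA _ (fun i j => (co j (phi (E i)) * co i x) *: E j)) /=.
rewrite {1}[x]hx phi_sum; apply: eq_bigr => i _.
rewrite {1}[phi (E i)]hx scaler_sumr; apply: eq_bigr => j _.
by rewrite scalerA mulrC.
Qed.

(** Sandwich expressions with both factors in the chosen basis and the coefficients apart; in this
    form they can be multiplied over tensor factors or carried through the embeddings [emb s]. *)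
Lemma azumaya_coef : azumaya B -> forall c f, exists lam : 'I_(\dim {:B}) * 'I_(\dim {:B}) -> F,
  forall x, \sum_p lam p *: (bas p.1 * x * bas p.2) = crd c x *: bas f.
Proof.
move=> hB c f; have phil : linear (fun x : B => crd c x *: bas f).
  by move=> a x y; rewrite /crd linearP /= scalerDl scalerA.
have [s hs] := hB _ phil.
exists (fun p => \sum_(q <- s) crd p.1 q.1 * crd p.2 q.2) => x; rewrite hs.
under eq_bigr do rewrite scaler_suml.
rewrite exchange_big /=; apply: eq_bigr => q _.
rewrite {2}(crd_expand q.1) {2}(crd_expand q.2) mulr_suml mulr_suml.
rewrite -(pair_bigA _ (fun i j => (crd i q.1 * crd j q.2) *: (bas i * x * bas j))) /=.
apply: eq_bigr => i _; rewrite mulr_sumr; apply: eq_bigr => j _.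
by rewrite -!scalerAl -scalerAr scalerA.
Qed.

End AzumayaUnits.

Lemma optens_azumaya (F : fieldType) (A B : falgType F) :
  azumaya A -> azumaya B -> azumaya (optens A B).
Proof.
move=> hA hB; apply: (azumaya_units (@optens_expand F A B)) => -[c c'] [f f'].
have [lam hl] := azumaya_coef hA c f; have [mu hm] := azumaya_coef hB c' f'.
(* On the first factor the opposite product reverses the order, so the right-hand element
   [bas p.1.2] stands on the left. *)
exists [seq (optens_pure (lam p.1 *: bas p.1.2) (mu p.2 *: bas p.2.1), optens_pure (bas p.1.1) (bas p.2.2))
       | p <- enum {: ('I_(\dim {:A}) * 'I_(\dim {:A})) * ('I_(\dim {:B}) * 'I_(\dim {:B}))}].
move=> z; rewrite big_map big_enum /=.
have pureP x y : \sum_p optens_pure (lam p.1 *: bas p.1.2) (mu p.2 *: bas p.2.1) * optens_pure x y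
    * optens_pure (bas p.1.1) (bas p.2.2) =
    (opcoef (c, c') (optens_pure x y)) *: optens_pure (bas f) (bas f') :> optens A B.
  rewrite opcoef_pure /= -scalerA -optens_pureZr -optens_pureZl -hl -hm optens_pure_suml.
  under [RHS]eq_bigr do rewrite optens_pure_sumr.
  rewrite (pair_bigA _ (fun i j => optens_pure (lam i *: (bas i.1 * x * bas i.2)) (mu j *: (bas j.1 * y * bas j.2)))) /=.
  apply: eq_bigr => p _; rewrite !optens_pureM.
  by congr optens_pure; rewrite ?scalerAl ?scalerAr ?mulrA // -?scalerAr -?scalerAl.
rewrite [in LHS](optens_expand z).
under eq_bigr do rewrite mulr_sumr mulr_suml.
rewrite exchange_big /=.
under eq_bigr => ij _.
  under eq_bigr do rewrite -scalerAr -scalerAl.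
  rewrite -scaler_sumr pureP scalerA.
  over.
rewrite -scaler_suml; congr (_ *: _); rewrite [in RHS](optens_expand z).
by rewrite (linear_fun_sum (opcoef_linear (c, c') : linear (opcoef (c, c') : _ -> F^o))) /=;
  apply: eq_bigr => ij _; rewrite (linear_funZ (opcoef_linear (c, c') : linear (opcoef (c, c') : _ -> F^o))).
Qed.

Section Cosets.
Variables (k : fieldType) (l : fieldExtType k) (L : splittingFieldType k).
Hypothesis hL : galois 1 {:L}.
Variable iota : 'AHom(l, L).
Notation G := (gal_of {:L}).
Notation GH := (cosetT iota).

(** The index of [H] in [G] is [[L : k] / [L : l]], since [H] is the Galois group of [L] over the
    image of [l]. *)
Lemma card_cosetT : #|{: GH}| = \dim {:l}.
Proof.
have -> : #|{: GH}| = #|[set: G] : galH iota|%g by rewrite card_sig.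
have cG : #|[set: G]| = \dim {:L} by rewrite -(galT L) -galois_dim // dimv1 divn1.
have hK : galois (limg iota) {:L} by apply: (galoisS (K := 1%AS)) hL; rewrite sub1v subvf.
have cH : #|galH iota| = \dim_(limg iota) {:L} by rewrite -(galois_dim hK).
rewrite -divgS ?subsetT //= cG cH.
have dl : \dim (limg iota) = \dim {:l}.
  by rewrite limg_dim_eq // (eqP (AHom_lker0 iota)) capv0.
have := field_dimS (subvf (iota @: fullv)%AS); rewrite /= => dv.
by rewrite divnA // mulKn ?adim_gt0 //= dl.
Qed.

Lemma cosetT_mulM (c : GH) rho s : Defs.coset_mul (Defs.coset_mul c rho) s = Defs.coset_mul c (rho * s)%g.
Proof. by apply: val_inj; rewrite /= rcosetM. Qed.

Lemma cosetT_mul1 (c : GH) : Defs.coset_mul c 1%g = c.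
Proof. by apply: val_inj; rewrite /= rcoset1. Qed.

Lemma permuteM (T : Type) rho s (v : {ffun GH -> T}) :
  permute s (permute rho v) = permute (rho * s)%g v.
Proof. by apply/ffunP => c; rewrite !ffunE cosetT_mulM invMg. Qed.

Lemma permute1 (T : Type) (v : {ffun GH -> T}) : permute 1%g v = v.
Proof. by apply/ffunP => c; rewrite !ffunE invg1 cosetT_mul1. Qed.

End Cosets.

Section WeilRestriction.
Variables (k : fieldType) (l : fieldExtType k) (L : splittingFieldType k).
Hypothesis hL : galois 1 {:L}.
Variable iota : 'AHom(l, L).
Notation G := (gal_of {:L}).
Notation GH := (cosetT iota).
Variable A : falgType l.
Notation I := 'I_(\dim {:A}).
Notation T := (tensA iota A).
Notation V := {ffun {ffun GH -> I} -> L^o}.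

Notation tpure := (@tensA_pure k l L iota A).

(** [tensA] is typed as an algebra over [k]; this is its scaling by [L], borrowed from the functions
    with values in [L]. *)
Definition tsc (a : L) (t : T) : T := a *: (t : V).

Lemma tscE a t f : (tsc a t : V) f = a * (t : V) f. Proof. exact: ffunE. Qed.

Lemma tsc_mull a t u : tsc a t * u = tsc a (t * u).
Proof.
apply/ffunP => f; rewrite scalg_mulE tscE [(t * u : V) f]scalg_mulE mulr_sumr.
apply: eq_bigr => i _; rewrite mulr_sumr; apply: eq_bigr => j _.
by rewrite tscE !mulrA.
Qed.

Lemma tsc_mulr a t u : t * tsc a u = tsc a (t * u).
Proof.
apply/ffunP => f; rewrite scalg_mulE tscE [(t * u : V) f]scalg_mulE mulr_sumr.
apply: eq_bigr => i _; rewrite mulr_sumr; apply: eq_bigr => j _.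
by rewrite tscE !mulrA [a * _]mulrC.
Qed.

Lemma tpureE v f : (tpure v : V) f = \prod_s emb s (crd (f s) (v s)).
Proof. exact: ffunE. Qed.

Lemma tensA_pure_msl : msl (T := V) tpure.
Proof.
move=> v s a x y; apply/ffunP => f.
transitivity (emb s a * (tpure (upd v s x) : V) f + (tpure (upd v s y) : V) f); last first.
  by apply/esym; apply: etrans (ffunE _ _) _; congr (_ + _); exact: ffunE.
rewrite !tpureE ![\prod_s0 _](bigD1 s) //= !updE !eqxx.
have e z : \prod_(i | i != s) emb i (crd (f i) (upd v s z i)) = \prod_(i | i != s) emb i (crd (f i) (v i)).
  by apply: eq_bigr => i /negPf is_; rewrite updE is_.
rewrite !e /crd linearP rmorphD rmorphM mulrDl; congr (_ + _).
by rewrite mulrA.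
Qed.

Definition tbas (f : {ffun GH -> I}) : T := tpure [ffun s => bas (f s)].

Lemma tbasE f g : (tbas f : V) g = (f == g)%:R.
Proof.
rewrite tpureE; under eq_bigr do rewrite ffunE crd_bas.
have [->|neq] := eqVneq f g; first by rewrite big1 // => s _; rewrite eqxx rmorph1.
have /existsP[s bfs] : [exists s, f s != g s].
  apply: contraNT neq; rewrite negb_exists => /forallP h.
  by apply/eqP/ffunP => s; apply/eqP; rewrite -[_ == _]negbK.
by rewrite (bigD1 s) //= (negPf bfs) rmorph0 mul0r.
Qed.

Lemma tensA_expand (t : T) : t = \sum_f tsc ((t : V) f) (tbas f).
Proof.
apply/ffunP => g; have sumE (r : seq {ffun GH -> I}) (F : _ -> T) :
    (\sum_(f <- r) F f : T) g = \sum_(f <- r) (F f : V) g :> L.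
  elim/big_rec2: _ => [|f x y _ <-]; first exact: ffunE.
  exact: ffunE.
rewrite [RHS]sumE (bigD1 g) //= tscE tbasE eqxx mulr1 big1 ?addr0 // => f /negPf fg.
by rewrite tscE tbasE fg mulr0.
Qed.

Lemma tensA_galP rho (a : L) (x y : V) :
  tensA_gal rho (a *: x + y : V) = (rho a *: (tensA_gal rho x : V) + tensA_gal rho y : V).
Proof.
by apply/ffunP => f; rewrite !ffunE rmorphD rmorphM.
Qed.

Lemma tensA_galM rho s (x : V) : tensA_gal s (tensA_gal rho x) = tensA_gal (rho * s)%g x.
Proof. by apply/ffunP => f; rewrite !ffunE permuteM -invMg galM ?memvf. Qed.

Lemma tensA_gal_id (x : V) : tensA_gal 1%g x = x.
Proof. by apply/ffunP => f; rewrite !ffunE invg1 permute1 gal_id. Qed.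

Notation R := (Rnc iota A).

Lemma Rnc_fixed (t : T) : (exists r : R, vsval r = t) <-> forall rho, tensA_gal rho t = t.
Proof.
split=> [[r <-]|/tensA_invP h]; first by apply/tensA_invP; exact: (subvsP r).
by exists (Subvs h).
Qed.

(** Galois descent for the vector space [tensA], whose [L]-basis is indexed by the functions from
    [G/H] to a basis of [A]. *)
Lemma dim_Rnc : \dim {:R} = (\dim {:A} ^ \dim {:l})%N.
Proof.
have hV := triv_hdim (V : vectType L).
have hW := triv_hdim (R : vectType k).
have := @hdim_descent k L hL (triv V) (triv R) (fun r : R => vsval r : V) (@tensA_gal _ _ _ iota A)
  tensA_galP tensA_galM tensA_gal_id.
move=> /(_ _ _ _ _ _ false _ hV) H.
have {}H : hdim (triv R) false (\dim {: V}).
  apply: H.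
  - move=> a x y; rewrite linearP; congr (_ + _).
    by apply/ffunP => f; rewrite !ffunE -[RHS]scalerAl mul1r.
  - exact: val_inj.
  - exact: Rnc_fixed.
  - by move=> w; apply/ffunP => f; rewrite !ffunE.
  - by move=> b w hw hb; rewrite hw // linear0.
rewrite (hdim_uniq hW H) dim_ffun card_ffun card_ord (card_cosetT hL).
have -> : \dim {: L^o} = 1%N by rewrite dimvf.
by rewrite muln1.
Qed.

(** Tensoring the sandwich expressions of rank-one maps on [A], one for each slot with coefficients
    embedded by [emb s], gives the rank-one maps of the tensor product: it is Azumaya over [L]. *)
Lemma tensA_units : azumaya A -> forall c f, exists s : seq (T * T), forall x : T,
  \sum_(p <- s) p.1 * x * p.2 = tsc ((x : V) c) (tbas f).
Proof.
move=> hA c f.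
have /choice[lam hlam] (s : GH) := azumaya_coef hA (c s) (f s).
pose X (g : {ffun GH -> I * I}) : T := tsc (\prod_s emb s (lam s (g s))) (tpure [ffun s => bas (g s).1]).
pose Y (g : {ffun GH -> I * I}) : T := tpure [ffun s => bas (g s).2].
exists [seq (X g, Y g) | g <- enum {: {ffun GH -> I * I}}] => x.
rewrite big_map big_enum /=.
have pureP (v : {ffun GH -> A}) : \sum_g X g * tpure v * Y g =
    tsc ((tpure v : V) c) (tbas f).
  transitivity (tpure [ffun s => \sum_p lam s p *: (bas p.1 * v s * bas p.2)] : V).
    rewrite (msl_expand tensA_pure_msl); apply: eq_bigr => g _.
    rewrite !tsc_mull !tensA_pureM -[RHS]/(tsc _ (tpure _)); congr (tsc _ (tpure _)).
    by apply/ffunP => s; rewrite !ffunE.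
  (* Sums with one term let [msl_expand] pull the scalars out of all slots at once. *)
  transitivity (tpure [ffun s => \sum_(i : 'I_1) crd (c s) (v s) *: bas (f s)] : V).
    congr tpure; apply/ffunP => s.
    by rewrite !ffunE hlam big_ord1.
  rewrite (msl_expand tensA_pure_msl) (bigD1 [ffun=> ord0]) //= [X in _ + X]big1 ?addr0; last first.
    by move=> g /negP[]; apply/eqP/ffunP => s; rewrite ffunE [g s]ord1.
  by rewrite -[LHS]/(tsc _ (tpure _)) tpureE; congr (tsc _ (tpure _)).
rewrite [in LHS](tensA_expand x).
under eq_bigr do rewrite mulr_sumr mulr_suml.
rewrite exchange_big /=.
under eq_bigr => h _.
  under eq_bigr do rewrite tsc_mulr tsc_mull.
  rewrite -(scaler_sumr (V := V)) pureP.
  over.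
rewrite (bigD1 c) //= big1 ?addr0 => [|h /negPf hc].
  by apply/ffunP => g; rewrite !tscE !tbasE eqxx mul1r.
by apply/ffunP => g; rewrite !tscE !tbasE hc mul0r mulr0 ffunE.
Qed.

End WeilRestriction.

Section WeilCSA.
Variables (k : fieldType) (l : fieldExtType k) (L : splittingFieldType k).
Hypothesis hL : galois 1 {:L}.
Variable iota : 'AHom(l, L).
Notation G := (gal_of {:L}).
Variable A : falgType l.
Notation I := 'I_(\dim {:A}).
Notation T := (tensA iota A).
Notation V := {ffun {ffun (cosetT iota) -> I} -> L^o}.
Notation R := (Rnc iota A).
Notation gtr := (gtr (V := V) (@tensA_gal _ _ _ iota A)).

Lemma tsc_tsc a b (t : T) : tsc a (tsc b t) = tsc (a * b) t.
Proof. exact: (@scalerA L V). Qed.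

Lemma tsc1 (t : T) : tsc 1 t = t.
Proof. exact: (@scale1r L V). Qed.

Lemma tsc_sum a (J : Type) (r : seq J) (P : pred J) (f : J -> T) :
  tsc a (\sum_(i <- r | P i) f i) = \sum_(i <- r | P i) tsc a (f i).
Proof. exact: (@scaler_sumr L V). Qed.

Lemma tsc_base (a : k) (t : T) : tsc a%:A t = a *: t.
Proof. by apply/ffunP => f; rewrite tscE [RHS]ffunE -[RHS]mulr_algl. Qed.

Lemma Rnc_val1 : vsval (1 : R) = 1 :> T.
Proof.
suff -> : vsval (1 : R) = algid (tensA_inv_aspace iota A).
  by apply/eqP; rewrite algid_eq1; apply/tensA_invP => rho; exact: tensA_gal1.
by [].
Qed.

Lemma Rnc_gal rho (r : R) : tensA_gal rho (vsval r) = vsval r.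
Proof. by move: rho; apply/tensA_invP; exact: (subvsP r). Qed.

Lemma Rnc_gtr (t : T) : exists r : R, vsval r = gtr t.
Proof.
by apply/Rnc_fixed => rho; apply: (gtr_fixed (V := V) (@tensA_galP _ _ _ iota A) (@tensA_galM _ _ _ iota A)).
Qed.

Lemma Rnc_span (t : T) : exists s : seq (L * R), t = \sum_(p <- s) tsc p.1 (vsval p.2).
Proof.
have [N [e [c hec]]] := gal_dual_bases L.
have /choice[r hr] i : exists r : R, vsval r = gtr (tsc (e i) t) by exact: Rnc_gtr.
exists [seq (c i, r i) | i <- enum 'I_N]; rewrite big_map big_enum /=.
rewrite {1}[t](gtr_expand (V := V) (@tensA_galP _ _ _ iota A) (@tensA_gal_id _ _ _ iota A) t hec).
by apply: eq_bigr => i _; rewrite hr.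
Qed.

Lemma coef_neq0 (t : T) : t != 0 -> exists f, (t : V) f != 0.
Proof.
move=> t0; apply: contrapT => /forallNP h; case/negP: t0; apply/eqP.
suff e : (t : V) = 0 by exact: e.
apply/ffunP => f; rewrite [RHS]ffunE; apply/eqP.
by have /negP := h f; rewrite negbK.
Qed.

(** Central: [z] commutes with all of [tensA], which [R] spans over [L], so the sandwiches force [z]
    to be a scalar of [L], and invariance puts it in [k]. Simple: a nonzero ideal [P] spans over [L]
    an ideal [LP], which contains [1] by the sandwiches; a trace returns [1] to [P]. *)
Lemma Rnc_central_simple : azumaya A -> central_simple R.
Proof.
move=> hA; have units := @tensA_units _ _ _ iota A hA.
apply/central_simpleP; split.
  move=> z hz.
  have hzT (t : T) : vsval z * t = t * vsval z.
    have [s ->] := Rnc_span t; rewrite mulr_sumr mulr_suml; apply: eq_bigr => p _.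
    rewrite tsc_mulr tsc_mull; congr (tsc _ _).
    exact: (congr1 vsval (hz p.2)).
  have [f0 hf0] : exists f, ((1 : T) : V) f != 0.
    exact: coef_neq0 (oner_neq0 T).
  (* The sandwich for [x |-> x_f0 e_f], applied to [1] and to [z], shows that [u] times [z e_f]
     equals [z_f0 e_f]; this gives the scalar [lam]. *)
  pose u : L := ((1 : T) : V) f0; have u0 : u != 0 := hf0.
  pose lam : L := u^-1 * (vsval z : V) f0.
  have zb (f : {ffun cosetT iota -> I}) : vsval z * tbas f = tsc lam (tbas f).
    have [s hs] := units f0 f; have := hs (vsval z); have := hs 1.
    move=> h1 h2; have e : vsval z * \sum_(p <- s) p.1 * 1 * p.2 = \sum_(p <- s) p.1 * vsval z * p.2.
      by rewrite mulr_sumr; apply: eq_bigr => p _; rewrite mulr1 mulrA hzT.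
    move: e; rewrite h1 h2 tsc_mulr => /(congr1 (fun t : T => tsc (u^-1) t)).
    by rewrite !tsc_tsc mulVf // tsc1.
  have zT (t : T) : vsval z * t = tsc lam t.
    rewrite (tensA_expand t) mulr_sumr tsc_sum; apply: eq_bigr => f _.
    by rewrite tsc_mulr zb !tsc_tsc mulrC.
  have zE : vsval z = tsc lam 1 by rewrite -zT mulr1.
  have [|a ha] := gal_fixed_base hL (a := lam).
    move=> rho; have e := Rnc_gal rho z.
    have e1 : tsc (rho lam) 1 = tsc lam 1 :> T.
      rewrite -[in RHS]zE -e zE -[in LHS](@tensA_gal1 _ _ _ iota A rho).
      exact: (esym (galZ (V := V) (@tensA_galP _ _ _ iota A) rho lam (1 : T))).
    by have /ffunP/(_ f0) := e1; rewrite !tscE; apply: mulIf.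
  exists a; apply: val_inj; rewrite /= zE ha tsc_base.
  by congr (_ *: _); rewrite -Rnc_val1.
move=> P hP hPm c c0 Pc.
pose LP (t : T) := exists s : seq (L * R), (forall p, p \in s -> P p.2) /\
  t = \sum_(p <- s) tsc p.1 (vsval p.2).
have LP0 : LP 0 by exists [::]; split=> //; rewrite big_nil.
have LPD t u : LP t -> LP u -> LP (t + u).
  move=> [s [hs ->]] [s' [hs' ->]]; exists (s ++ s'); rewrite big_cat; split=> // p.
  by rewrite mem_cat => /orP[/hs|/hs'].
have LP1 a r : P r -> LP (tsc a (vsval r)).
  by move=> Pr; exists [:: (a, r)]; rewrite big_seq1; split=> // p; rewrite inE => /eqP ->.
have LPMl u t : LP t -> LP (u * t).
  move=> [s [hs ->]]; have [s1 ->] := Rnc_span u.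
  rewrite mulr_suml; apply: (big_ind LP) => // p _.
  rewrite mulr_sumr big_seq; apply: (big_ind LP) => // q qs.
  rewrite tsc_mull tsc_mulr tsc_tsc; apply: (LP1 _ (p.2 * q.2)).
  by rewrite -[_ * q.2]mulr1; apply/hPm/hs.
have LPMr w t : LP t -> LP (t * w).
  move=> [s [hs ->]]; have [s1 ->] := Rnc_span w.
  rewrite mulr_suml big_seq; apply: (big_ind LP) => // p ps.
  rewrite mulr_sumr; apply: (big_ind LP) => // q _.
  rewrite tsc_mull tsc_mulr tsc_tsc; apply: (LP1 _ (p.2 * q.2)).
  by rewrite -[p.2]mul1r; apply/hPm/hs.
have LPM u t w : LP t -> LP (u * t * w) by move=> h; apply/LPMr/LPMl.
have LPsc a t : LP t -> LP (tsc a t).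
  by move=> h; rewrite -[t]mul1r -tsc_mull -[_ * t]mulr1; apply: LPM.
have [f0 hf0] : exists f, (vsval c : V) f != 0.
  by apply: coef_neq0; apply: contraNneq c0 => e; apply/eqP/val_inj.
have LPb (f : {ffun cosetT iota -> I}) : LP (tbas f).
  have [s hs] := units f0 f; pose u : L := (vsval c : V) f0; have u0 : u != 0 := hf0.
  rewrite -[tbas f]tsc1 -(mulVf u0) -tsc_tsc; apply: LPsc; rewrite -hs.
  apply: (big_ind LP) => // p _; apply: LPM.
  by rewrite -[vsval c]tsc1; apply: LP1.
have [s [hs e1]] : LP 1.
  by rewrite (tensA_expand 1); apply: (big_ind LP) => // f _; apply: LPsc.
have [a1 ha1] := trL_eq1 hL.
have /choice[tk htk] := trL_base hL.
have P1 : P 1.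
  (* [1] is the trace of [a1], and taking traces in the expression of [1] as an element of [LP],
     multiplied by [a1], turns the coefficients into elements of [k]. *)
  have -> : 1 = \sum_(p <- s) tk (a1 * p.1) *: p.2 :> R.
    have e2 : gtr (tsc a1 1) = 1 :> T.
      have h := @gtr_scale_fixed _ _ V _ (@tensA_galP _ _ _ iota A) a1 (1 : T) (@tensA_gal1 _ _ _ iota A).
      by rewrite [LHS]h -/(trL _) ha1 [LHS]scale1r.
    apply: val_inj; rewrite [LHS]Rnc_val1 -e2 e1 tsc_sum linear_sum.
    rewrite (gtr_sum (V := V) (@tensA_galP _ _ _ iota A)); apply: eq_bigr => p _.
    rewrite tsc_tsc; have h := @gtr_scale_fixed _ _ V _ (@tensA_galP _ _ _ iota A) (a1 * p.1) (vsval p.2) (fun rho => Rnc_gal rho p.2).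
    by rewrite [LHS]h -/(trL _) htk [LHS]tsc_base linearZ.
  rewrite big_seq; apply: lsub_sum => // p ps; apply: lsubZ => //; exact: hs.
by move=> x; rewrite -[x]mulr1 -[_ * 1]mulr1; apply: hPm.
Qed.

End WeilCSA.

Definition mklin (R : pzRingType) (M N : lmodType R) (f : M -> N) (fl : linear f) : {linear M -> N} :=
  HB.pack f (GRing.isSemilinear.Build _ _ _ _ f (GRing.semilinear_linear fl)).

(** * Contractions onto the cohomology *)

Section GeneralizedInverse.
Variables (F : fieldType) (V W : lmodType F) (d : {linear V -> W}).

(** [Zorn_bigcup] also asks for the union of the empty chain, and the empty set is not the graph of
    a linear map; adjoining [(0, 0)] makes it one. *)
Let adj0 (A : set (W * V)) : set (W * V) := fun p => p = (0, 0) \/ A p.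
Let lin (A : set (W * V)) := forall a x y, A x -> A y -> A (a *: x.1 + y.1, a *: x.2 + y.2).
(** Graphs of linear maps to [V] from subspaces of [W] that are sections of [d] on the part of their
    domain inside the image of [d]. *)
Let good (A : set (W * V)) := [/\ lin A, forall v, A (0, v) -> v = 0
  & forall w v, A (w, v) -> (exists u, w = d u) -> d v = w].

Let good0 : good (adj0 set0).
Proof.
split=> [a x y [->|//] [->|//]|v [[]//|//]|w v [[-> ->] _|//]].
  by rewrite /= !scaler0 !addr0; left.
by rewrite linear0.
Qed.

(* Zorn on the graphs of partial sections of d *)
Lemma generalized_inverse : exists g : {linear W -> V}, forall v, d (g (d v)) = d v.
Proof.
have [|A [Ag hmax]] := @Zorn_bigcup _ (fun A => good (adj0 A)).
  move=> B Bg tot; set C := (\bigcup_(X in B) X)%classic.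
  have two x y : adj0 C x -> adj0 C y ->
      exists X, [/\ good (adj0 X), adj0 X x, adj0 X y & forall p, adj0 X p -> adj0 C p].
    have sub X p : B X -> adj0 X p -> adj0 C p by move=> BX [->|Xp]; [left | right; exists X].
    move=> [->|[X BX Xx]] [->|[Y BY Yy]].
    - by exists set0; split=> //; [left | left | move=> p [->|//]; left].
    - exists Y; split; [exact: Bg | by left | by right | by move=> p; apply: sub].
    - exists X; split; [exact: Bg | by right | by left | by move=> p; apply: sub].
    - have [XY|YX] := tot X Y BX BY.
        by exists Y; split; [exact: Bg | right; apply: XY | right | move=> p; apply: sub].
      by exists X; split; [exact: Bg | right | right; apply: YX | move=> p; apply: sub].
  split.
  - by move=> a x y Cx Cy; have [X [[Xl _ _] Xx Xy]] := two x y Cx Cy; apply; apply: Xl.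
  - by move=> v Cv; have [X [[_ X0 _] Xx _ _]] := two _ _ Cv Cv; apply: X0.
  - by move=> w v Cv; have [X [[_ _ Xd] Xx _ _]] := two _ _ Cv Cv; apply: Xd.
have A0 : A (0, 0).
  apply: contrapT => nA; apply: (hmax (adj0 A)).
    by split=> [p Ap|h]; [right | apply/nA/h; left].
  have e p : adj0 (adj0 A) p -> adj0 A p by move=> [->|//]; left.
  have [Al Av Ad] := Ag; split=> [a x y /e Ax /e Ay|v /e|w v /e]; [|exact: Av|exact: Ad].
  by right; apply: Al.
have {Ag}[Al Av Ad] : good A.
  have e p : adj0 A p -> A p by move=> [->|].
  have [Al Av Ad] := Ag; split=> [a x y Ax Ay|v Ax|w v Ax].
  - by apply/e/Al; right.
  - by apply: Av; right.
  - by apply: Ad; right.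
have dom w : exists v, A (w, v).
  apply: contrapT => hw.
  have w_notin c v : A (c *: w, v) -> c = 0.
    move=> h; apply/eqP/negPn/negP => c0; apply: hw; exists (c^-1 *: v).
    by have := Al c^-1 _ _ h A0; rewrite /= !addr0 scalerA mulVf // scale1r.
  (* The value [v0] at the new vector [w]. If [w + w1 = d u1] with [w1] already in the domain, then
     [u1 - v1] serves; otherwise no new element of the image of [d] enters the domain, and [0] will
     do. *)
  have [v0 hv0] : exists v0, forall c w' v', A (w', v') -> (exists u, c *: w + w' = d u) ->
      d (c *: v0 + v') = c *: w + w'.
    have [[w1 [v1 [u1 [A1 e1]]]]|hn] := pselect (exists w1 v1 u1, A (w1, v1) /\ w + w1 = d u1).
      exists (u1 - v1) => c w' v' A2 [u eu].
      have h : d (- c *: v1 + v') = - c *: w1 + w'.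
        apply: (Ad _ _ (Al (- c) _ _ A1 A2)); exists (u - c *: u1) => /=.
        rewrite linearB linearZ /= -eu -e1 scalerDr.
        by rewrite opprD addrACA subrr add0r scaleNr addrC.
      rewrite scalerBr -addrA -scaleNr linearD linearZ /= -e1 h scalerDr -addrA; congr (_ + _).
      by rewrite addrA -scalerDl subrr scale0r add0r.
    exists 0 => c w' v' A2 [u eu]; rewrite scaler0 add0r.
    have [c0|c0] := eqVneq c 0.
      by move: eu; rewrite c0 scale0r add0r => eu; apply: Ad A2 _; exists u.
    case: hn; exists (c^-1 *: w'), (c^-1 *: v'), (c^-1 *: u); split.
      by have := Al c^-1 _ _ A2 A0; rewrite /= !addr0.
    by rewrite linearZ /= -eu scalerDr scalerA mulVf // scale1r.
  pose B : set (W * V) := fun p => exists c q, A q /\ p = (c *: w + q.1, c *: v0 + q.2).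
  have AB p : A p -> B p by move=> Ap; exists 0, p; rewrite !scale0r !add0r; case: (p) Ap.
  apply: (hmax B).
    split=> [//|hB]; apply: hw; exists v0; apply: hB; exists 1, (0, 0).
    by rewrite /= !scale1r !addr0.
  have e p : adj0 B p -> B p by move=> [->|//]; apply: AB.
  split.
  - move=> a x y /e[c [q [Aq ->]]] /e[c' [q' [Aq' ->]]]; right.
    exists (a * c + c'), (a *: q.1 + q'.1, a *: q.2 + q'.2); split; first exact: Al.
    by rewrite /= !scalerDr !scalerA !scalerDl addrACA [X in (_, X)]addrACA.
  - move=> v /e[c [q [Aq [e1 e2]]]].
    have c0 : c = 0.
      have h : q.1 = - c *: w by apply/eqP; rewrite scaleNr -addr_eq0 addrC -e1.
      by apply/eqP; rewrite -oppr_eq0; apply/eqP/(w_notin _ q.2); rewrite -h; case: (q) Aq.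
    move: e1 e2; rewrite c0 !scale0r !add0r => e1 ->; apply: Av; rewrite e1.
    by case: (q) Aq.
  - move=> w' v' /e[c [q [Aq [-> ->]]]]; apply: hv0.
    by case: (q) Aq.
have /choice[g hg] := dom.
have gl : linear g.
  move=> a x y; apply/eqP; rewrite -subr_eq0; apply/eqP/Av.
  have := Al (-1) _ _ (Al a _ _ (hg x) (hg y)) (hg (a *: x + y)).
  by rewrite /= !scaleN1r addNr [X in (_, X)]addrC.
exists (mklin gl) => v.
by apply: (Ad _ _ (hg (d v))); exists v.
Qed.
End GeneralizedInverse.

(* A deformation retraction of X onto the span of lifts xx of a homology basis *)
Record retract (F : fieldType) (X : scplx F) := Retract {
  rt_J : finType;
  rt_p : rt_J -> bool;
  rt_x : rt_J -> X;
  rt_xi : rt_J -> {linear X -> F^o};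
  rt_om : {linear X -> X};
  rt_h : {linear X -> X};
  rt_x_cyc : forall j, cyc (rt_p j) (rt_x j);
  rt_xi_x : forall i j, rt_xi i (rt_x j) = (i == j)%:R;
  rt_xi_dif : forall j x, rt_xi j (sc_dif X x) = 0;
  rt_homotopy : forall x, x - \sum_j rt_xi j x *: rt_x j = sc_dif X (rt_h x) + rt_h (sc_dif X x);
  rt_om_om : forall x, rt_om (rt_om x) = x;
  rt_om_par : forall b x, sc_par b x -> rt_om x = (-1) ^+ b *: x;
  rt_om_dif : forall x, rt_om (sc_dif X x) = - sc_dif X (rt_om x);
  rt_om_h : forall x, rt_om (rt_h x) = - rt_h (rt_om x) }.

Lemma hdim_family (F : fieldType) (X : scplx F) b n : hdim X b n ->
  exists x : 'I_n -> X, [/\ forall i, cyc b (x i),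
    forall c, bdy (\sum_i c i *: x i) -> forall i, c i = 0
    & forall z, cyc b z -> exists c, bdy (z - \sum_i c i *: x i)].
Proof.
move=> [s [sn qs is_ hs]]; subst n; exists (fun i => s`_i); split.
- by move=> i; apply/qs/mem_nth.
- move=> c hc i; have /(indepmP _ (bdy_sub X)) h := is_.
  have := h (fun m => if insub m is Some j then c j else 0) _ i (ltn_ord i).
  rewrite valK; apply; congr (bdy _): hc; apply: eq_bigr => j _.
  by rewrite valK.
- by move=> z /hs/spanmP[c hc]; exists (fun i : 'I_(size s) => c i).
Qed.

Section RetractExists.
Variables (F : fieldType) (X : scplx F).
Notation d := (sc_dif X).

Lemma parity_projector : exists p : {linear X -> X},
  forall b x, sc_par b x -> p x = if b then 0 else x.
Proof.
have /boolp.choice[f hf] : forall x : X, exists y, sc_par false y /\ sc_par true (x - y).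
  move=> x; have [x0 [x1 [h0 h1 ->]]] := sc_par_dec false x; exists x0.
  by rewrite addrC addKr.
have f_uniq x y : sc_par false y -> sc_par true (x - y) -> f x = y.
  move=> h1 h2; have [h3 h4] := hf x; apply/eqP; rewrite -subr_eq0; apply/eqP.
  apply: (@sc_par_uniq _ X false); first exact: (lsubB (sc_par_sub X false)).
  have -> : f x - y = (x - y) - (x - f x) by rewrite opprB [RHS]addrC addrA subrK.
  exact: (lsubB (sc_par_sub X true)).
have fl : linear f.
  move=> a x y; apply: f_uniq; have [h1 h2] := hf x; have [h3 h4] := hf y.
    by have [_ h] := sc_par_sub X false; apply: h.
  rewrite opprD addrACA -scalerBr.
  by have [_ h] := sc_par_sub X true; apply: h.
exists (mklin fl) => -[] x hx; apply: f_uniq; rewrite ?subr0 ?subrr //.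
  by case: (sc_par_sub X false).
by case: (sc_par_sub X true).
Qed.

Lemma sc_par_ind (P : X -> Prop) : (forall x y, P x -> P y -> P (x + y)) ->
  (forall b x, sc_par b x -> P x) -> forall x, P x.
Proof.
move=> hD hP x; have [x0 [x1 [h0 h1 ->]]] := sc_par_dec false x.
by apply: hD; [apply: hP h0 | apply: hP h1].
Qed.

Lemma sc_par0 b : sc_par (s := X) b 0.
Proof. by case: (sc_par_sub X b). Qed.

Lemma sc_dif_parP b (x y : X) : sc_par b x -> sc_par (~~ b) y -> d (x + y) = 0 ->
  d x = 0.
Proof.
move=> px py; rewrite linearD => e; apply: (@sc_par_uniq _ X b).
  have -> : d x = - d y by apply/eqP; rewrite -addr_eq0 e.
  by apply: (lsubN (sc_par_sub X b)); rewrite -[b]negbK; apply: sc_dif_par.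
exact: sc_dif_par.
Qed.

Section Odd.
Variables (p : {linear X -> X}).
Hypothesis hp : forall b x, sc_par b x -> p x = if b then 0 else x.

Let q : {linear X -> X} := idfun \- p.
Let om : {linear X -> X} := p \- q.

Let hq b x : sc_par b x -> q x = if b then x else 0.
Proof. by move=> /hp e; rewrite /q /= e; case: b {e}; rewrite ?subr0 ?subrr. Qed.

Let p_par x : sc_par false (p x).
Proof.
apply: (sc_par_ind (P := fun x => sc_par false (p x))) => {x}.
  by move=> x y hx hy; rewrite linearD; apply: (lsubD (sc_par_sub X _)).
by move=> b x hx; rewrite (hp hx); case: b hx => // _; apply: sc_par0.
Qed.

Let q_par x : sc_par true (q x).
Proof.
apply: (sc_par_ind (P := fun x => sc_par true (q x))) => {x}.
  by move=> x y hx hy; rewrite linearD; apply: (lsubD (sc_par_sub X _)).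
by move=> b x hx; rewrite (hq hx); case: b hx => // _; apply: sc_par0.
Qed.

Lemma parity_operator : exists om : {linear X -> X}, 
  forall b x, sc_par b x -> om x = (-1) ^+ b *: x.
Proof.
exists om => b x hx; change (p x - q x = (-1) ^+ b *: x).
rewrite (hq hx) (hp hx); case: b {hx}; last by rewrite subr0 scale1r.
by rewrite sub0r expr1 scaleN1r.
Qed.

(** Only the parity-reversing part of a generalized inverse is kept. The part preserving parity
    contributes to [d (g (d x))] in the wrong parity only, so the identity survives. *)
Lemma odd_generalized_inverse : exists g : {linear X -> X},
  (forall b x, sc_par b x -> sc_par (~~ b) (g x)) /\ forall x, d (g (d x)) = d x.
Proof.
have [g hg] := generalized_inverse d.
pose g' : {linear X -> X} := (q \o g \o p) \+ (p \o g \o q).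
have g'E b x : sc_par b x -> g' x = if b then p (g x) else q (g x).
  move=> hx; change (q (g (p x)) + p (g (q x)) = if b then p (g x) else q (g x)).
  rewrite (hp hx) (hq hx).
  by case: b {hx}; rewrite !linear0 ?addr0 ?add0r.
have qE x : g x = p (g x) + q (g x) by rewrite /q /= addrC subrK.
clearbody g'; exists g'; split=> [b x hx|]; first by rewrite (g'E b) //; case: b {hx}.
apply: sc_par_ind => [x y hx hy|b x hx]; first by rewrite !linearD hx hy.
have hd := sc_dif_par hx; rewrite (g'E _ _ hd).
apply/eqP; rewrite -subr_eq0 -linearB; apply/eqP.
case: b hx hd => hx hd; rewrite /=.
  apply: (@sc_dif_parP true _ (p (g (d x)))).
  - by apply: (lsubB (sc_par_sub X true)) => //; apply: q_par.
  - exact: p_par.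
  - by rewrite addrAC -(addrC (p _)) -qE linearB hg subrr.
apply: (@sc_dif_parP false _ (q (g (d x)))).
- by apply: (lsubB (sc_par_sub X false)) => //; apply: p_par.
- exact: q_par.
- by rewrite addrAC -qE linearB hg subrr.
Qed.
End Odd.

Lemma parity_operator_odd (om f : {linear X -> X}) :
  (forall b x, sc_par b x -> om x = (-1) ^+ b *: x) ->
  (forall b x, sc_par b x -> sc_par (~~ b) (f x)) ->
  forall x, om (f x) = - f (om x).
Proof.
move=> hom hf; apply: sc_par_ind => [x y hx hy|b x hx].
  by rewrite !linearD hx hy.
rewrite (hom _ _ (hf _ _ hx)) (hom _ _ hx) linearZ /= -scaleNr.
by case: b {hx}; rewrite ?expr0 ?expr1 ?opprK.
Qed.

Lemma bdy_par_split b u v : sc_par b u -> sc_par (~~ b) v -> bdy (u + v) -> bdy (X := X) u.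
Proof.
move=> pu pv [y ey]; have [y0 [y1 [p0 p1 e]]] := sc_par_dec b y; exists y1.
apply/eqP; rewrite -subr_eq0; apply/eqP; apply: (@sc_par_uniq _ X b).
  by apply: (lsubB (sc_par_sub X b)) => //; rewrite -[b]negbK; apply: sc_dif_par.
have -> : u - d y1 = d y0 - v.
  by apply/eqP; rewrite subr_eq addrAC -subr_eq opprK ey e linearD.
by apply: (lsubB (sc_par_sub X (~~ b))) => //; apply: sc_dif_par.
Qed.

(** A generalized inverse contracts [X] onto a space of cycles, which is then moved onto the span of
    chosen representatives; uniqueness of coordinates in cohomology makes them linear in [x]. *)
Lemma retract_exists n0 n1 : hdim X false n0 -> hdim X true n1 ->
  exists r : retract X, #|[pred j | ~~ rt_p (r := r) j]| = n0 /\
    #|[pred j | rt_p (r := r) j]| = n1.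
Proof.
move=> /hdim_family[x0 [c0 i0 s0]] /hdim_family[x1 [c1 i1 s1]].
pose J : finType := ('I_n0 + 'I_n1)%type.
pose pj (j : J) : bool := if j is inl _ then false else true.
pose xj (j : J) : X := match j with inl i => x0 i | inr i => x1 i end.
have xj_cyc j : cyc (pj j) (xj j) by case: j.
have bigJ (c : J -> F) : \sum_j c j *: xj j =
    \sum_i c (inl i) *: x0 i + \sum_i c (inr i) *: x1 i.
  by rewrite big_sumType.
have par_sum b n (x : 'I_n -> X) c : (forall i, cyc b (x i)) -> sc_par b (\sum_i c i *: x i).
  move=> h; apply: (lsub_sum _ (sc_par_sub X b)) => i _.
  by apply: (lsubZ _ (sc_par_sub X b)); case: (h i).
have xj_free c : bdy (\sum_j c j *: xj j) -> forall j, c j = 0.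
  rewrite bigJ => hc [] i.
    by apply: (i0 (fun i => c (inl i))); apply: bdy_par_split hc; [apply: par_sum c0 | apply: par_sum c1].
  by apply: (i1 (fun i => c (inr i))); rewrite addrC in hc; apply: bdy_par_split hc; [apply: par_sum c1 | apply: par_sum c0].
have [p hp] := parity_projector.
have [om om_par] := parity_operator hp.
have [g [g_odd dgd]] := odd_generalized_inverse hp.
(* It satisfies [1 - pi = d g + g d] and [d pi = pi d = 0]. Its values are cycles, but need not lie
   in the span of the [xj]. *)
pose pi : {linear X -> X} := (idfun \- (d \o g)) \- (g \o d).
have piE x : pi x = x - d (g x) - g (d x) by [].
clearbody pi.
have pi_par b x : sc_par b x -> sc_par b (pi x).
  move=> hx; rewrite piE; apply: (lsubB (sc_par_sub X b)); [apply: (lsubB (sc_par_sub X b)) => //|].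
    by rewrite -[b]negbK; apply/sc_dif_par/g_odd.
  by rewrite -[b]negbK; apply/g_odd/sc_dif_par.
have d_pi x : d (pi x) = 0 by rewrite piE !linearB /= sc_dif_dif dgd subr0 subrr.
have pi_d x : pi (d x) = 0 by rewrite piE sc_dif_dif linear0 dgd subr0 subrr.
have ex_par b x : sc_par b x -> exists c : J -> F,
    bdy (pi x - \sum_j c j *: xj j) /\ forall j, pj j != b -> c j = 0.
  move=> hx; case: b hx => hx.
    have [c hc] := s1 (pi x) (conj (pi_par _ _ hx) (d_pi x)).
    exists (fun j => if j is inr i then c i else 0); split; last by case.
    by rewrite bigJ /= [X in _ - (X + _)]big1 ?add0r // => i _; rewrite scale0r.
  have [c hc] := s0 (pi x) (conj (pi_par _ _ hx) (d_pi x)).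
  exists (fun j => if j is inl i then c i else 0); split; last by case.
  by rewrite bigJ /= [X in _ - (_ + X)]big1 ?addr0 // => i _; rewrite scale0r.
have /boolp.choice[xi hxi] : forall x, exists c : J -> F, bdy (pi x - \sum_j c j *: xj j).
  apply: sc_par_ind => [x y [c hc] [c' hc']|b x /ex_par[c [hc _]]]; last by exists c.
  exists (fun j => c j + c' j); rewrite linearD /=.
  rewrite (eq_bigr (fun j => c j *: xj j + c' j *: xj j)) => [|j _]; last exact: scalerDl.
  by rewrite big_split opprD addrACA; apply: (lsubD (bdy_sub X)).
have xi_uniq x c : bdy (pi x - \sum_j c j *: xj j) -> forall j, xi x j = c j.
  move=> hc j; apply/eqP; rewrite -subr_eq0; apply/eqP.
  apply: (xj_free (fun j => xi x j - c j)).
  rewrite (eq_bigr (fun j => xi x j *: xj j - c j *: xj j)) => [|i _]; last exact: scalerBl.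
  rewrite sumrB -[X in X - _](subrK (pi x)) -addrA; apply: (lsubD (bdy_sub X)) => //.
  by rewrite -opprB; apply: (lsubN (bdy_sub X)).
have xil j : linear (fun x => xi x j : F^o).
  move=> a x y; apply: (xi_uniq _ (fun j => a * xi x j + xi y j)).
  rewrite linearP /= (eq_bigr (fun j => a *: (xi x j *: xj j) + xi y j *: xj j)); last first.
    by move=> i _; rewrite scalerDl scalerA.
  rewrite big_split -scaler_sumr opprD addrACA -scalerBr.
  exact: (lsubD (bdy_sub X) (lsubZ _ (bdy_sub X) (hxi x)) (hxi y)).
pose xil' j : {linear X -> F^o} := mklin (xil j).
pose pi' x := \sum_j xi x j *: xj j.
have pi'l : linear pi'.
  move=> a x y; rewrite /pi' scaler_sumr -big_split; apply: eq_bigr => j _ /=.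
  by rewrite (xil j) scalerDl scalerA.
have pi'_par b x : sc_par b x -> sc_par b (pi' x).
  move=> hx; have [c [hc c0']] := ex_par _ _ hx; apply: (lsub_sum _ (sc_par_sub X b)) => j _.
  rewrite (xi_uniq _ _ hc); have [<-|/c0' ->] := eqVneq (pj j) b.
    by apply: (lsubZ _ (sc_par_sub X _)); case: (xj_cyc j).
  by rewrite scale0r; apply: sc_par0.
(* [pi x] and [pi' x] differ by a boundary and [d g d = d], so the second summand of [h] contributes
   exactly [pi x - pi' x] to [d h]. *)
pose h : {linear X -> X} := g \+ (g \o (pi \- mklin pi'l)).
have hE x : h x = g x + g (pi x - pi' x) by [].
clearbody h.
have h_odd b x : sc_par b x -> sc_par (~~ b) (h x).
  move=> hx; rewrite hE; apply: (lsubD (sc_par_sub X _)); first exact: g_odd.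
  by apply: g_odd; apply: (lsubB (sc_par_sub X _)); [apply: pi_par | apply: pi'_par].
have xi_d j x : xi (d x) j = 0.
  apply: (xi_uniq _ (fun=> 0)); rewrite pi_d big1 ?subr0 => [|i _]; last exact: scale0r.
  by exists 0; rewrite linear0.
have hom x : x - pi' x = d (h x) + h (d x).
  have [y ey] := hxi x.
  have e0 : pi' (d x) = 0 by rewrite /pi' big1 // => j _; rewrite xi_d scale0r.
  rewrite !hE pi_d e0 subr0 linear0 addr0 linearD /= ey dgd -ey piE.
  by rewrite [RHS]addrAC -(addrA x) -opprD [RHS]addrA [X in _ = X - _]addrC subrK.
have xix i j : xil' i (xj j) = (i == j)%:R.
  apply: (xi_uniq _ (fun i => (i == j)%:R)).
  rewrite (bigD1 j) //= eqxx scale1r big1 ?addr0 => [|m /negPf->]; last exact: scale0r.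
  have [_ dx] := xj_cyc j; exists (- g (xj j)); rewrite piE dx linear0 subr0.
  by rewrite linearN addrAC subrr add0r.
have omom x : om (om x) = x.
  move: x; apply: sc_par_ind => [x y hx hy|b x hx]; first by rewrite !linearD hx hy.
  by rewrite (om_par _ _ hx) linearZ /= (om_par _ _ hx) scalerA -signr_addb addbb scale1r.
have omd := parity_operator_odd om_par (@sc_dif_par _ X).
have omh := parity_operator_odd om_par h_odd.
exists (@Retract F X J pj xj xil' om h xj_cyc xix (fun j x => xi_d j x) hom omom om_par omd omh).
have cJ (P : pred J) : #|P| = (\sum_(i < n0) P (inl i) + \sum_(i < n1) P (inr i))%N.
  by rewrite -sum1_card big_mkcond big_sumType /=.
by split; rewrite cJ /= !sum_nat_const !card_ord ?muln0 ?muln1 ?addn0.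
Qed.
End RetractExists.

(** * The tensor product of the conjugates of a complex *)

(* L acts on T through rho *)
Section Twist.
Variables (k : fieldType) (L : splittingFieldType k).
Definition twist (rho : gal_of {:L}) (T : lmodType L) : Type := T.
Variables (rho : gal_of {:L}) (T : lmodType L).
Notation tw := (twist rho T).
HB.instance Definition _ := GRing.Zmodule.copy tw T.
Definition twist_scale (a : L) (x : tw) : tw := rho a *: (x : T).
Fact twist_scaleA a b x : twist_scale a (twist_scale b x) = twist_scale (a * b) x.
Proof. by rewrite /twist_scale scalerA rmorphM. Qed.
Fact twist_scale1 : left_id 1 twist_scale.
Proof. by move=> x; rewrite /twist_scale rmorph1 scale1r. Qed.
Fact twist_scaleDr : right_distributive twist_scale +%R.
Proof. by move=> a x y; rewrite /twist_scale [LHS]scalerDr. Qed.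
Fact twist_scaleDl x : {morph twist_scale^~ x : a b / a + b}.
Proof. by move=> a b; rewrite /twist_scale rmorphD [LHS]scalerDl. Qed.
HB.instance Definition _ := GRing.Zmodule_isLmodule.Build L tw
  twist_scaleA twist_scale1 twist_scaleDr twist_scaleDl.
End Twist.

Section Koszul.
Variables (k : fieldType) (l : fieldExtType k) (L : splittingFieldType k).
Variable iota : 'AHom(l, L).

Notation G := (gal_of {:L}).
Notation GH := (cosetT iota).

(** The Koszul sign is multiplicative: pairs inverted by [r] and put back in order by [s] are
    counted twice on the left and not at all for [r * s], which leaves the parity unchanged. *)
Lemma koszulM (deg : GH -> int) (r s : G) :
  exists m, (koszul r deg + koszul s (fun c => deg (Defs.coset_mul c r^-1%g)) =
    koszul (r * s)%g deg + m.*2)%N.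
Proof.
pose w (p q : GH) := (`|deg p| * `|deg q|)%N.
pose lt (p q : GH) : bool := before p q.
pose rm (c : GH) := Defs.coset_mul c r.
pose rs (c : GH) := Defs.coset_mul c (r * s)%g.
have k2 : koszul s (fun c => deg (Defs.coset_mul c r^-1%g)) =
    (\sum_p \sum_q (lt (rm p) (rm q) && lt (rs q) (rs p)) * w p q)%N.
  rewrite /koszul [LHS](reindex_inj (can_inj (coset_mulK r))); apply: eq_bigr => p _.
  rewrite [LHS](reindex_inj (can_inj (coset_mulK r))) big_mkcond; apply: eq_bigr => q _.
  rewrite !coset_mulK /lt /rm /rs.
  have e c : Defs.coset_mul (Defs.coset_mul c r) s = Defs.coset_mul c (r * s)%g.
    by apply: val_inj; rewrite /= -rcosetM.
  by rewrite !e; case: ifP => _; rewrite ?mul1n ?mul0n.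
have k1 g : koszul g deg = (\sum_p \sum_q (lt p q && lt (Defs.coset_mul q g) (Defs.coset_mul p g)) * w p q)%N.
  apply: eq_bigr => p _; rewrite big_mkcond; apply: eq_bigr => q _.
  by case: ifP => _; rewrite ?mul1n ?mul0n.
rewrite k2 !k1 -/rm -/rs.
(* The pairs in the sum for [s] are ordered after applying [r]; they are gathered on [lt p q], the
   order used by the other sums. *)
have half (F : GH -> GH -> bool) : (forall p, F p p = false) ->
    (\sum_p \sum_q F p q * w p q = \sum_p \sum_q (lt p q * (F p q + F q p)) * w p q)%N.
  move=> F0.
  transitivity (\sum_p \sum_q (lt p q * F p q) * w p q + \sum_p \sum_q (lt q p * F p q) * w p q)%N.
    rewrite -big_split; apply: eq_bigr => p _; rewrite -big_split; apply: eq_bigr => q _ /=.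
    rewrite -mulnDl -mulnDl; have [->|pq] := eqVneq p q; first by rewrite F0 muln0.
    suff -> : (lt p q + lt q p = 1)%N by rewrite mul1n.
    rewrite /lt /before; case: ltngtP => // /val_inj/enum_rank_inj e.
    by rewrite e eqxx in pq.
  rewrite [X in (_ + X)%N]exchange_big -big_split; apply: eq_bigr => p _.
  rewrite -big_split; apply: eq_bigr => q _ /=.
  by rewrite [w q p]mulnC -/(w p q) -mulnDl -mulnDr.
have lt_asym p q : p != q -> lt p q = ~~ lt q p.
  move=> pq; rewrite /lt /before; case: ltngtP => // /val_inj/enum_rank_inj e.
  by rewrite e eqxx in pq.
have ltpp p : lt p p = false by rewrite /lt /before ltnn.
rewrite (half (fun p q => lt (rm p) (rm q) && lt (rs q) (rs p))); last by move=> p; rewrite ltpp.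
exists (\sum_p \sum_q (lt p q && lt (rm q) (rm p) && ~~ lt (rs q) (rs p)) * w p q)%N.
rewrite -muln2 big_distrl -!big_split; apply: eq_bigr => p _ /=.
rewrite big_distrl -!big_split; apply: eq_bigr => q _ /=.
rewrite -[X in _ = (_ + X)%N]mulnA [(w p q * 2)%N]mulnC [X in _ = (_ + X)%N]mulnA -!mulnDl; congr (_ * _)%N.
have [->|pq] := eqVneq p q; first by rewrite !ltpp.
have inj g : Defs.coset_mul p g != Defs.coset_mul q g :> GH.
  by apply: contraNneq pq => /(can_inj (coset_mulK g)) ->.
rewrite (lt_asym _ _ (inj r)) (lt_asym _ _ (inj (r * s)%g)) -/(rm q) -/(rs q) -/(rm p) -/(rs p).
by case: (lt p q); case: (lt (rm q) (rm p)); case: (lt (rs q) (rs p)).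
Qed.

Lemma koszul1 (deg : GH -> int) : koszul 1%g deg = 0%N.
Proof.
rewrite /koszul big1 // => p _; rewrite big1 // => q.
have e (c : GH) : Defs.coset_mul c 1%g = c by apply: val_inj; rewrite /= rcoset1.
by rewrite !e /before; case: ltngtP.
Qed.
End Koszul.

Section TensorPower.
Variables (k : fieldType) (l : fieldExtType k) (L : splittingFieldType k).
Variable iota : 'AHom(l, L).
Notation G := (gal_of {:L}).
Notation GH := (cosetT iota).
Variables (C : falgType l) (M : dgmod C) (T : lmodType L).
Notation N := (rs M).
Variable pure : {ffun GH -> N} -> T.
Hypothesis pure_msl : msl pure.
Hypothesis pure_map : forall (S : lmodType L) (f : {ffun GH -> N} -> S), msl f ->
  exists g : {linear T -> S}, forall v, g (pure v) = f v.
Hypothesis pure_ext : forall (S : lmodType L) (g g' : {linear T -> S}),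
  (forall v, g (pure v) = g' (pure v)) -> g =1 g'.

Definition mhom (deg : GH -> int) (v : {ffun GH -> N}) : Prop :=
  forall s, homogeneous (X := M) (deg s) (v s).

(** Grading, differential and Galois action are specified on homogeneous pure tensors only;
    splitting the slots one after another into homogeneous components shows that these suffice. *)
Lemma pure_hom_ext (S : lmodType L) (g g' : {linear T -> S}) :
  (forall deg v, mhom deg v -> g (pure v) = g' (pure v)) -> g =1 g'.
Proof.
move=> e; apply: pure_ext.
suff main (r : seq GH) (v : {ffun GH -> N}) :
    (forall s, s \notin r -> exists n, homogeneous (X := M) n (v s)) -> g (pure v) = g' (pure v).
  by move=> v; apply: (main (enum {: GH})) => s; rewrite mem_enum.
elim: r v => [v hv|s r IH v hv].
  have /boolp.choice[deg hdeg] : forall s, exists n, homogeneous (X := M) n (v s).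
    by move=> s; apply: hv.
  exact: (e deg).
have [q [_ eq]] := dg_comp_sum (v s : M).
rewrite -(upd_id v s) [X in upd v s X]eq (msl_sum pure_msl) !linear_sum.
apply: eq_bigr => n _; apply: IH => c cr; rewrite updE.
have [_|cs] := eqVneq c s; first by exists n; apply: comp_homogeneous.
by apply: hv; rewrite inE negb_or cs.
Qed.

Section Galois.
Variable gal : G -> T -> T.
Hypothesis galP : forall rho (a : L) x y, gal rho (a *: x + y) = rho a *: gal rho x + gal rho y.
Hypothesis gal_pure : forall rho deg v, mhom deg v ->
  gal rho (pure v) = (-1) ^+ koszul rho deg *: pure (permute rho v).

Lemma tens_galM r s (t : T) : gal s (gal r t) = gal (r * s)%g t.
Proof.
(* Both sides are semilinear for [r * s]; with values in the twisted module they become linear and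
   can be compared on pure tensors. *)
have l1 : linear (fun t => gal s (gal r t) : twist (r * s)%g T).
  by move=> a x y; rewrite !galP -galM ?memvf.
have l2 : linear (fun t => gal (r * s)%g t : twist (r * s)%g T).
  by move=> a x y; rewrite galP.
apply: (pure_hom_ext (g := mklin l1) (g' := mklin l2)) => deg v hv.
change (gal s (gal r (pure v)) = gal (r * s)%g (pure v)).
have hv' : mhom (fun c => deg (Defs.coset_mul c r^-1%g)) (permute r v).
  by move=> c; rewrite ffunE; apply: hv.
rewrite (gal_pure r hv) (galZ galP) (gal_pure s hv') (gal_pure _ hv) permuteM.
rewrite scalerA; congr (_ *: _); rewrite rmorphXn rmorphN rmorph1 -exprD.
have [m ->] := koszulM deg r s.
by rewrite exprD -muln2 mulnC exprM sqrrN !expr1n mulr1.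
Qed.

Lemma tens_gal1 (t : T) : gal 1%g t = t.
Proof.
have l1 : linear (fun t => gal 1%g t : T) by move=> a x y; rewrite galP gal_id.
apply: (pure_hom_ext (g := mklin l1) (g' := idfun)) => deg v hv.
change (gal 1%g (pure v) = pure v).
by rewrite (gal_pure _ hv) koszul1 expr0 scale1r permute1.
Qed.
End Galois.

(** The expansion of [1] in [C], taken in every slot, acts as the identity of the tensor product. It
    is stated in coordinates because that is how [tr_incl_act] describes the action on [W]. *)
Lemma tens_act1 (I J : finType) (c : I -> l) (c' : J -> l) (P : I -> J -> C)
  (act : {ffun GH -> I} -> {ffun GH -> J} -> {linear T -> T}) :
  \sum_i \sum_j (c i * c' j) *: P i j = 1 ->
  (forall f g v, act f g (pure v) = pure [ffun s => ((P (f s) (g s) : C^c) *: (v s : M) : N)]) ->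
  forall t, \sum_(f : {ffun GH -> I}) \sum_(g : {ffun GH -> J}) ((\prod_s emb s (c (f s))) * \prod_s emb s (c' (g s))) *: act f g t = t.
Proof.
move=> e hact.
pose F t := \sum_(f : {ffun GH -> I}) \sum_(g : {ffun GH -> J}) ((\prod_s emb s (c (f s))) * \prod_s emb s (c' (g s))) *: act f g t.
have Fl : linear F.
  move=> b u v; rewrite scaler_sumr -big_split; apply: eq_bigr => i _ /=.
  rewrite scaler_sumr -big_split; apply: eq_bigr => j _ /=.
  by rewrite linearP scalerDr !scalerA mulrC.
apply: (pure_ext (g := mklin Fl) (g' := idfun)) => v.
change (F (pure v) = pure v); rewrite /F.
have {2}-> : v = [ffun s => \sum_i c i *: \sum_j c' j *: ((P i j : C^c) *: (v s : M) : N)].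
  apply/ffunP => s; rewrite ffunE.
  transitivity (((\sum_i \sum_j (c i * c' j) *: P i j) : C^c) *: (v s : M)).
    by rewrite e [RHS]scale1r.
  rewrite [LHS]scaler_suml; apply: eq_bigr => i _.
  rewrite [LHS]scaler_suml scaler_sumr; apply: eq_bigr => j _.
  rewrite !rs_scaleE !scalerA; apply: (f_equal (fun z : C^c => z *: (v s : M))).
  change ((c i * c' j) *: P i j = P i j * (((c' j)%:A : C) * ((c i)%:A : C))).
  by rewrite mulr_algr -scalerAr mulr_algr scalerA.
rewrite (msl_expand pure_msl); apply: eq_bigr => f _.
rewrite (msl_expand pure_msl (fun=> c') (fun s j => ((P (f s) j : C^c) *: (v s : M) : N))) scaler_sumr.
by apply: eq_bigr => g _; rewrite hact scalerA.
Qed.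

End TensorPower.

Section SlotOperators.
Variables (k : fieldType) (l : fieldExtType k) (L : splittingFieldType k).
Variable iota : 'AHom(l, L).
Notation GH := (cosetT iota).
Variables (N : lmodType l) (T : lmodType L) (pure : {ffun GH -> N} -> T).
Hypothesis pure_msl : msl pure.

Lemma pure_scale (c : GH -> l) (y : GH -> N) :
  pure [ffun s => c s *: y s] = (\prod_s emb s (c s)) *: pure [ffun s => y s].
Proof.
transitivity (pure [ffun s => \sum_(i < 1) c s *: y s]).
  by congr pure; apply/ffunP => s; rewrite !ffunE big_ord1.
rewrite (msl_expand pure_msl (fun s _ => c s) (fun s _ => y s)).
rewrite (big_pred1 [ffun=> ord0]) // => g; apply/esym/eqP/ffunP => s.
by rewrite ffunE (ord1 (g s)).
Qed.

Hypothesis pure_map : forall (S : lmodType L) (f : {ffun GH -> N} -> S), msl f ->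
  exists g : {linear T -> S}, forall v, g (pure v) = f v.

Lemma slot_map (a : GH -> {linear N -> N}) : exists g : {linear T -> T},
  forall v, g (pure v) = pure [ffun s => a s (v s)].
Proof.
apply: pure_map => v s b x y.
have e z : [ffun c => a c (upd v s z c)] = upd [ffun c => a c (v c)] s (a s z).
  by apply/ffunP => c; rewrite !ffunE; case: eqP => [->|].
by rewrite !e linearP pure_msl.
Qed.

Section Slot.
Variable om : {linear N -> N}.

(* f in slot t, with the Koszul sign in the preceding slots *)
Definition slot (f : {linear N -> N}) (t s : GH) : {linear N -> N} :=
  if before s t then om else if s == t then f else idfun.

Lemma slotE f t s x : slot f t s x = if before s t then om x else if s == t then f x else x.
Proof. by rewrite /slot; case: ifP => // _; case: ifP. Qed.

Variables (d h pr : {linear N -> N}) (D : {linear T -> T}).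
Hypothesis pure_ext : forall (S : lmodType L) (g g' : {linear T -> S}),
  (forall v, g (pure v) = g' (pure v)) -> g =1 g'.
Hypothesis D_pure : forall v, D (pure v) = \sum_t pure [ffun s => slot d t s (v s)].
Hypothesis om_om : forall x, om (om x) = x.
Hypothesis om_dif : forall x, om (d x) = - d (om x).
Hypothesis om_h : forall x, om (h x) = - h (om x).
Hypothesis homotopy : forall x, x - pr x = d (h x) + h (d x).

(** [H] is [h] in slot [s], with [om] in the slots before it. It anticommutes with the terms of [D]
    in the other slots; the term in slot [s] gives [d h + h d], as the two operators [om] in each
    earlier slot cancel. *)
Lemma slot_homotopy s : exists (H P : {linear T -> T}),
  (forall v, P (pure v) = pure (upd v s (pr (v s)))) /\
  forall z, z - P z = D (H z) + H (D z).
Proof.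
have [H hH] := slot_map (slot h s).
have [P hP] := slot_map (fun c => if c == s then pr else idfun).
have {}hP v : P (pure v) = pure (upd v s (pr (v s))).
  rewrite hP; congr pure; apply/ffunP => c; rewrite !ffunE.
  by case: eqP => [->|].
exists H, P; split=> // z.
apply: (pure_ext (g := idfun \- P) (g' := (D \o H) \+ (H \o D))) => v {z}.
change (pure v - P (pure v) = D (H (pure v)) + H (D (pure v))).
rewrite hH !D_pure linear_sum -big_split /= hP.
rewrite [RHS](bigD1 s) //= [X in _ = _ + X]big1 ?addr0 => [|t ts]; last first.
  have lt_st : before s t = ~~ before t s.
    rewrite /before; case: ltngtP => // /val_inj/enum_rank_inj e.
    by rewrite e eqxx in ts.
  have ltss (c : GH) : before c c = false by rewrite /before ltnn.
  have lt_tr (a b c : GH) : before a b -> before b c -> before a c by apply: ltn_trans.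
  rewrite hH; set U := [ffun c => slot d t c _]; set V := [ffun c => slot h s c _].
  (* The two tensors agree except in the earlier of the slots [s] and [t], where moving [om] past
     [d] or [h] changes the sign. *)
  suff [c ec e] : exists2 c, U c = - V c & forall c', c' != c -> U c' = V c'.
    have -> : U = upd V c (- V c).
      by apply/ffunP => c'; rewrite updE; case: (eqVneq c' c) => [->|/e].
    by rewrite (mslN pure_msl) upd_id addNr.
  have [lt_ts|ge_ts] := boolP (before t s).
    exists t => [|c' c't]; rewrite !ffunE !slotE ?ltss ?lt_ts ?eqxx.
      by apply/esym; rewrite -[RHS]opprK; congr (- _); exact: om_dif.
    rewrite (negPf c't); case: ifP => // c1.
    by rewrite (lt_tr _ _ _ c1 lt_ts).
  rewrite (negPf ge_ts) in lt_st.
  exists s => [|c' c's]; rewrite !ffunE !slotE ?ltss ?lt_st ?eqxx.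
    exact: om_h.
  rewrite (negPf c's); have [c1|//] := boolP (before c' s).
  by rewrite (lt_tr _ _ _ c1 lt_st).
rewrite hH.
set U := [ffun c => slot d s c _]; set V := [ffun c => slot h s c _].
have ltss (c : GH) : before c c = false by rewrite /before ltnn.
have -> : U = upd v s (d (h (v s))).
  apply/ffunP => c; rewrite updE !ffunE !slotE.
  case: (eqVneq c s) => [->|_]; first by rewrite !ltss.
  by case: (before c s); rewrite ?om_om.
have -> : V = upd v s (h (d (v s))).
  apply/ffunP => c; rewrite updE !ffunE !slotE.
  case: (eqVneq c s) => [->|_]; first by rewrite !ltss.
  by case: (before c s); rewrite ?om_om.
rewrite -(mslD pure_msl) -{1}(upd_id v s) -(mslN pure_msl) -(mslD pure_msl).
by congr (pure (upd v s _)); exact: homotopy.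
Qed.

Variables (J : finType) (xx : J -> N) (xi : J -> {linear N -> l^o}).
Hypothesis prE : forall x, pr x = \sum_j xi j x *: xx j.
Hypothesis xi_xx : forall i j, xi i (xx j) = (i == j)%:R.
Hypothesis xi_d : forall j x, xi j (d x) = 0.
Hypothesis D_D : forall z, D (D z) = 0.

Definition xpure (f : {ffun GH -> J}) : T := pure [ffun s => xx (f s)].

(** The functionals are products of the [xi] over all slots. The projections [pr] are applied one
    slot after another, each changing a cycle by a boundary, so the tensors of representatives span
    the cohomology. *)
Lemma kunneth_basis : exists c : {ffun GH -> J} -> {linear T -> L^o},
  [/\ forall f z, c f (D z) = 0, forall f g, c f (xpure g) = (f == g)%:R
    & forall z, D z = 0 -> exists y, z - \sum_f c f z *: xpure f = D y].
Proof.
have cm (f : {ffun GH -> J}) : msl (fun v : {ffun GH -> N} => \prod_s emb s (xi (f s) (v s)) : L^o).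
  move=> v s a x y; rewrite !(bigD1 (P := xpredT) s) //= !updE eqxx linearP /= rmorphD rmorphM.
  rewrite mulrDl -mulrA; congr (_ * (_ * _) + _ * _); apply: eq_bigr => c /negPf cs.
    by rewrite !updE cs.
  by rewrite !updE cs.
have /boolp.choice[c hc] := fun f => pure_map (cm f).
exists c; split.
- move=> f; apply: (pure_ext (g := c f \o D) (g' := \0)) => v /=.
  rewrite D_pure linear_sum big1 // => t _; rewrite hc (bigD1 t) //= ffunE slotE.
  by rewrite {1}/before ltnn eqxx xi_d rmorph0 mul0r.
- move=> f g; rewrite hc; have [->|neq] := eqVneq f g.
    by rewrite big1 // => s _; rewrite ffunE xi_xx eqxx rmorph1.
  have /existsP[s fgs] : [exists s, f s != g s].
    apply: contraNT neq; rewrite negb_exists => /forallP h'.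
    by apply/eqP/ffunP => s; apply/eqP; rewrite -[_ == _]negbK.
  by rewrite (bigD1 s) //= ffunE xi_xx (negPf fgs) rmorph0 mul0r.
have [H hH] := boolp.choice slot_homotopy.
have [P hP] := boolp.choice hH.
pose Q r z := foldr (fun s z => P s z) z r.
have Q_D r z : D z = 0 -> D (Q r z) = 0 /\ exists y, z - Q r z = D y.
  move=> dz; elim: r => [|s r [IH1 [y IH2]]] /=; first by split=> //; exists 0; rewrite subrr linear0.
  have [_ hs] := hP s; have := hs (Q r z); rewrite IH1 linear0 addr0 => e.
  have ePz : P s (Q r z) = Q r z - D (H s (Q r z)) by rewrite -e opprB addrC subrK.
  rewrite ePz; split; first by rewrite linearB IH1 D_D subrr.
  by exists (y + H s (Q r z)); rewrite opprB addrA addrAC IH2 linearD.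
have Ql r : linear (Q r) by elim: r => [|s r IH] a x y //=; rewrite IH linearP.
have Qpure r v : uniq r -> Q r (pure v) = pure [ffun s => if s \in r then pr (v s) else v s].
  elim: r => [_|s r IH /= /andP[sr ur]] /=; first by congr pure; apply/ffunP => s; rewrite ffunE.
  have [hPs _] := hP s; rewrite IH // hPs; congr pure; apply/ffunP => c'.
  by rewrite updE !ffunE inE; have [->|//] := eqVneq c' s; rewrite (negPf sr).
have cl : linear (fun z => \sum_f c f z *: xpure f).
  move=> a x y; rewrite scaler_sumr -big_split; apply: eq_bigr => f _ /=.
  by rewrite linearP scalerDl scalerA.
move=> z dz; have [_ [y hy]] := Q_D (enum {: GH}) z dz; exists y; rewrite -hy; congr (_ - _).
apply: (pure_ext (g := mklin cl) (g' := mklin (Ql (enum {: GH})))) => v.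
change (\sum_f c f (pure v) *: xpure f = Q (enum {: GH}) (pure v)).
rewrite Qpure ?enum_uniq //.
transitivity (pure [ffun s => \sum_j xi j (v s) *: xx j]).
  rewrite (msl_expand pure_msl (fun s j => xi j (v s)) (fun _ j => xx j)).
  by apply: eq_bigr => f _; rewrite hc.
by congr pure; apply/ffunP => s; rewrite !ffunE mem_enum prE.
Qed.
End Slot.
End SlotOperators.

Section Kunneth.
Variables (k : fieldType) (l : fieldExtType k) (L : splittingFieldType k).
Variable iota : 'AHom(l, L).
Notation G := (gal_of {:L}).
Notation GH := (cosetT iota).
Variables (C : falgType l) (M : dgmod C) (T : lmodType L).
Notation N := (rs M).
Variable pure : {ffun GH -> N} -> T.
Hypothesis pure_msl : msl pure.
Hypothesis pure_map : forall (S : lmodType L) (f : {ffun GH -> N} -> S), msl f ->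
  exists g : {linear T -> S}, forall v, g (pure v) = f v.
Hypothesis pure_ext : forall (S : lmodType L) (g g' : {linear T -> S}),
  (forall v, g (pure v) = g' (pure v)) -> g =1 g'.
Variable D : {linear T -> T}.
Hypothesis D_pure : forall deg v, mhom deg v ->
  D (pure v) = \sum_s (-1) ^+ deg_before deg s *: pure (upd v s (rs_map (dg_dif M) (v s))).

Variable r : retract (dgc M).
Let d : {linear N -> N} := rs_map (dg_dif M).
Let om : {linear N -> N} := rt_om r.
Let h : {linear N -> N} := rt_h r.
Let xx : rt_J r -> N := @rt_x _ _ r.
Let xi : rt_J r -> {linear N -> l^o} := @rt_xi _ _ r.

Let pr_linear : linear (fun x : N => \sum_j xi j x *: xx j).
Proof.
move=> a x y; rewrite scaler_sumr -big_split; apply: eq_bigr => j _ /=.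
by rewrite linearP scalerDl scalerA.
Qed.
Let pr : {linear N -> N} := mklin pr_linear.

Let om_hom n (x : N) : homogeneous (X := M) n x -> om x = (-1) ^+ `|n|%N *: x.
Proof.
move=> hx; rewrite -signr_odd; apply: (@rt_om_par _ _ r) => i hi.
rewrite (homogeneous_comp _ hx); have [e|//] := eqVneq i n.
by rewrite e eqxx in hi.
Qed.

(** The signs [deg_before] become the operator [om] in the preceding slots, which gives a formula
    valid on all pure tensors and not only on homogeneous ones. *)
Lemma tens_dif_pure v : D (pure v) = \sum_t pure [ffun s => slot om d t s (v s)].
Proof.
have /boolp.choice[g hg] := fun t => slot_map pure_msl pure_map (slot om d t).
have gl : linear (fun z => \sum_t g t z).
  move=> a x y; rewrite scaler_sumr -big_split; apply: eq_bigr => t _ /=.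
  by rewrite linearP.
have := pure_hom_ext pure_msl pure_ext (g := D) (g' := mklin gl).
move=> e; rewrite e => [|deg w hw]; last first.
  rewrite (D_pure hw); apply: eq_bigr => t _; rewrite hg.
  transitivity (pure [ffun s => (if before s t then (-1) ^+ `|deg s|%N else 1) *: upd w t (d (w t)) s]).
    rewrite (pure_scale pure_msl); congr (_ *: pure _); last by apply/ffunP => s; rewrite [RHS]ffunE.
    rewrite /deg_before -prodrXr big_mkcond; apply: eq_bigr => s _.
    by case: ifP => _; rewrite ?rmorph1 // rmorphXn rmorphN rmorph1.
  congr pure; apply/ffunP => s; rewrite !ffunE slotE.
  have [st|_] := boolP (before s t); last by rewrite scale1r; case: eqP => [->|].
  have [e'|_] := eqVneq s t; first by move: st; rewrite e' /before ltnn.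
  by rewrite (om_hom (hw s)).
by apply: eq_bigr => t _; rewrite hg.
Qed.

End Kunneth.

(** The functionals detect the coefficients of the [x i] modulo boundaries, and [bdy_par_split]
    discards the terms of the other parity. *)
Lemma dual_family_hdim (F : fieldType) (V : scplx F) (I : finType) (p : I -> bool)
    (x : I -> V) (c : I -> {linear V -> F^o}) :
  (forall i, cyc (p i) (x i)) -> (forall i z, c i (sc_dif V z) = 0) ->
  (forall i j, c i (x j) = (i == j)%:R) ->
  (forall z, sc_dif V z = 0 -> bdy (z - \sum_i c i z *: x i)) ->
  forall b, hdim V b #|[pred i | p i == b]|.
Proof.
move=> xc c0 cx cs b; pose r := enum [pred i | p i == b].
exists (map x r); split.
- by rewrite size_map -cardE.
- by move=> _ /mapP[i ir ->]; move: ir; rewrite mem_enum inE => /eqP <-.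
- apply/indepm_mapP; [exact: bdy_sub | exact: enum_uniq | move=> e [y ey] i ir].
  have := c0 i y; rewrite -ey linear_sum (bigD1_seq i) ?enum_uniq //= linearZ /= cx eqxx.
  rewrite big1 ?addr0 => [|j /negPf ji]; first by rewrite /GRing.scale /= mulr1.
  by rewrite linearZ /= cx eq_sym ji scaler0.
move=> z [pz dz]; apply/spanm_mapP; first exact: enum_uniq.
exists (fun i => c i z).
have eS : \sum_i c i z *: x i = \sum_(i <- r) c i z *: x i + \sum_(i | p i != b) c i z *: x i.
  by rewrite /r big_enum [LHS](bigID (fun i => p i == b)).
have := cs z dz; rewrite eS opprD addrA; apply: (@bdy_par_split _ V b).
  apply: (lsubB (sc_par_sub V b)) => //; rewrite /r big_enum.
  apply: (lsub_sum _ (sc_par_sub V b)) => i /eqP pi.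
  by apply: (lsubZ _ (sc_par_sub V _)); have [] := xc i; rewrite pi.
apply: (lsubN (sc_par_sub V _)); apply: (lsub_sum _ (sc_par_sub V _)) => i pi.
have -> : ~~ b = p i by case: (p i) pi; case: (b).
by apply: (lsubZ _ (sc_par_sub V _)); case: (xc i).
Qed.

(** * The cohomology of the fixed part *)

Lemma odd_abszD (i j : int) : odd `|(i + j)%R|%N = odd `|i|%N (+) odd `|j|%N.
Proof. lia. Qed.

Lemma odd_absz_sum (I : finType) (f : I -> int) :
  odd `|(\sum_i f i)%R|%N = \big[addb/false]_i odd `|f i|%N.
Proof. exact: (big_morph (fun i : int => odd `|i|%N) odd_abszD). Qed.

Lemma sum_signs (I : finType) (p : I -> bool) :
  \sum_i (-1) ^+ p i = #|[pred i | p i == false]|%:Z - #|[pred i | p i == true]|%:Z :> int.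
Proof.
rewrite (bigID p) /= addrC; congr (_ + _).
  rewrite (eq_bigr (fun=> 1)) => [|i /negPf ->]; last by rewrite expr0.
  rewrite sumr_const natz; apply: (f_equal Posz); apply: eq_card => i.
  by change (~~ p i = (p i == false)); case: (p i).
rewrite (eq_bigr (fun=> -1)) => [|i ->]; last by rewrite expr1.
rewrite sumr_const mulNrn natz; congr (- _); apply: (f_equal Posz); apply: eq_card => i.
by change (p i = (p i == true)); case: (p i).
Qed.

(** Expanding the power of [\sum_j (-1) ^+ p j] over the functions [f] collects the signs of the
    total parity; this is the multiplicativity of the Euler characteristic. *)
Lemma card_parity (S J : finType) (p : J -> bool) (pf := fun f : {ffun S -> J} => \big[addb/false]_s p (f s)) :
  #|[pred f | pf f == false]|%:Z - #|[pred f | pf f == true]|%:Z =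
  (#|[pred j | ~~ p j]|%:Z - #|[pred j | p j]|%:Z) ^+ #|S| :> int.
Proof.
have -> : #|[pred j | ~~ p j]| = #|[pred j | p j == false]|.
  by apply: eq_card => j; rewrite !inE; case: (p j).
have -> : #|[pred j | p j]| = #|[pred j | p j == true]|.
  by apply: eq_card => j; rewrite !inE; case: (p j).
rewrite -!sum_signs -prodr_const bigA_distr_bigA; apply: eq_bigr => f _.
by apply: (big_morph (fun b : bool => (-1) ^+ b : int)) => // a b; rewrite signr_addb.
Qed.

Section FixedPart.
Variables (k : fieldType) (l : fieldExtType k) (L : splittingFieldType k).
Hypothesis hL : galois 1 {:L}.
Variable iota : 'AHom(l, L).
Notation G := (gal_of {:L}).
Notation GH := (cosetT iota).
Variables (C : falgType l) (M : dgmod C) (T : lmodType L).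
Notation N := (rs M).
Variable pure : {ffun GH -> N} -> T.
Hypothesis pure_msl : msl pure.
Hypothesis pure_map : forall (S : lmodType L) (f : {ffun GH -> N} -> S), msl f ->
  exists g : {linear T -> S}, forall v, g (pure v) = f v.
Hypothesis pure_ext : forall (S : lmodType L) (g g' : {linear T -> S}),
  (forall v, g (pure v) = g' (pure v)) -> g =1 g'.
Variables (comp : int -> {linear T -> T}) (D : {linear T -> T}) (gal : G -> T -> T).
Hypothesis comp_pure : forall n deg v, mhom deg v ->
  comp n (pure v) = if \sum_s deg s == n then pure v else 0.
Hypothesis D_pure : forall deg v, mhom deg v ->
  D (pure v) = \sum_s (-1) ^+ deg_before deg s *: pure (upd v s (rs_map (dg_dif M) (v s))).
Hypothesis galP : forall rho (a : L) x y, gal rho (a *: x + y) = rho a *: gal rho x + gal rho y.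
Hypothesis gal_pure : forall rho deg v, mhom deg v ->
  gal rho (pure v) = (-1) ^+ koszul rho deg *: pure (permute rho v).
Variables (C' : falgType k) (W : dgmod C') (inc : rs W -> T).
Hypothesis incP : forall a x y, inc (a *: x + y) = a%:A *: inc x + inc y.
Hypothesis inc_inj : injective inc.
Hypothesis inc_fix : forall v, (exists w, inc w = v) <-> forall rho, gal rho v = v.
Hypothesis inc_comp : forall n w, inc (dg_comp W n w) = comp n (inc w).
Hypothesis inc_dif : forall w, inc (rs_map (dg_dif W) w) = D (inc w).

Let galM := tens_galM pure_msl pure_ext galP gal_pure.
Let gal1 := tens_gal1 pure_msl pure_ext galP gal_pure.

Let inc0 : inc 0 = 0.
Proof.
have := incP 1 0 0; rewrite !scale1r addr0 => e.
by apply: (addrI (inc 0)); rewrite addr0 -e.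
Qed.
Let incD x y : inc (x + y) = inc x + inc y.
Proof. by have := incP 1 x y; rewrite !scale1r. Qed.
Let inc_gal rho w : gal rho (inc w) = inc w.
Proof. by move: rho; apply/inc_fix; exists w. Qed.

Let gtr_inc t : exists w, inc w = gtr gal t.
Proof. by apply/inc_fix => rho; apply: (gtr_fixed galP galM). Qed.

(** By descent the fixed part spans [T] over [L]. Statements linear over [L], such as [D (D t) = 0],
    can thus be imported from the dg module [W]. *)
Lemma fixed_ind (P : T -> Prop) : P 0 -> (forall x y, P x -> P y -> P (x + y)) ->
  (forall a w, P (a *: inc w)) -> forall t, P t.
Proof.
move=> P0 PD Pi t; have [n [e [c hec]]] := gal_dual_bases L.
rewrite [t](gtr_expand galP gal1 _ hec); elim/big_rec: _ => // i x _ Px.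
by apply: PD => //; have [w <-] := gtr_inc (e i *: t).
Qed.

Let comp_gal n rho t : comp n (gal rho t) = gal rho (comp n t).
Proof.
move: t; apply: fixed_ind => [|x y hx hy|a w].
- by rewrite linear0 (gal0 galP) linear0.
- by rewrite linearD !(galD galP) linearD hx hy.
- by rewrite linearZ /= !(galZ galP) linearZ /= -inc_comp !inc_gal inc_comp.
Qed.

Definition tpar (b : bool) (t : T) := forall n : int, odd `|n|%N != b -> comp n t = 0.

Fact tpar_sub b : lsub (tpar b).
Proof.
split=> [n _|a x y hx hy n hn]; first exact: linear0.
by rewrite linearP hx // hy // scaler0 addr0.
Qed.

Lemma tpar_inc b (w : rs W) : dgpar (X := W) b w -> tpar b (inc w).
Proof. by move=> h n hn; rewrite -inc_comp h. Qed.

Fact tpar_dec b t : exists x0 x1, [/\ tpar b x0, tpar (~~ b) x1 & t = x0 + x1].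
Proof.
move: t; apply: fixed_ind => [|x y [x0 [x1 [h0 h1 ->]]] [y0 [y1 [h2 h3 ->]]]|a w].
- by exists 0, 0; rewrite addr0; split=> //; case: (tpar_sub b); case: (tpar_sub (~~ b)).
- exists (x0 + y0), (x1 + y1); rewrite addrACA.
  by split=> //; [apply: (lsubD (tpar_sub b)) | apply: (lsubD (tpar_sub (~~ b)))].
have [w0 [w1 [h0 h1 ->]]] := dgpar_dec b (w : rs W).
exists (a *: inc w0), (a *: inc w1); rewrite incD scalerDr.
by split=> //; [apply: (lsubZ _ (tpar_sub b)) | apply: (lsubZ _ (tpar_sub (~~ b)))]; apply: tpar_inc.
Qed.

Fact tpar_uniq b t : tpar b t -> tpar (~~ b) t -> t = 0.
Proof.
move=> h1 h2; have ct n : comp n t = 0.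
  by have [e|/h1//] := eqVneq (odd `|n|%N) b; apply: h2; rewrite e; case: (b).
have [m [e [c hec]]] := gal_dual_bases L.
rewrite [t](gtr_expand galP gal1 _ hec) big1 // => i _.
have [w ew] := gtr_inc (e i *: t); rewrite -ew.
suff -> : w = 0 by rewrite inc0 scaler0.
(* All components of [t] vanish, hence those of its traces, and these come from [W], where an
   element with zero components is zero. *)
apply: dg_comp0 => n; apply: inc_inj; rewrite inc0 inc_comp ew /gtr linear_sum big1 // => rho _.
by rewrite comp_gal linearZ /= ct scaler0 (gal0 galP).
Qed.

Fact tpar_dif b t : tpar b t -> tpar (~~ b) (D t).
Proof.
move=> h n hn.
have -> : comp n (D t) = D (comp (n - 1) t).
  move: {h} t; apply: fixed_ind => [|x y hx hy|a w].
  - by rewrite !linear0.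
  - by rewrite !linearD hx hy.
  by rewrite !linearZ /= -inc_comp -!inc_dif -inc_comp -dg_comp_dif.
rewrite h ?linear0 // odd_absz_sub1; by move: hn; case: odd; case: (b).
Qed.

Fact tdif_dif t : D (D t) = 0.
Proof.
move: t; apply: fixed_ind => [|x y hx hy|a w].
- by rewrite !linear0.
- by rewrite !linearD hx hy addr0.
by rewrite !linearZ /= -!inc_dif; have := @dg_dif_dif _ W w => /= e; rewrite [X in inc X]e inc0 scaler0.
Qed.

Definition tcplx : scplx L :=
  @SCplx L T tpar D tpar_sub tpar_dec tpar_uniq tpar_dif tdif_dif.

(** The slots are cut into homogeneous components one at a time, after which the total degree is a
    sum of degrees of known parities. *)
Lemma tpar_pure (b : GH -> bool) (v : {ffun GH -> N}) :
  (forall s, dgpar (X := M) (b s) (v s)) -> tpar (\big[addb/false]_s b s) (pure v).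
Proof.
move=> hv n hn.
suff main (r : seq GH) (u : {ffun GH -> N}) : (forall s, s \in r -> dgpar (X := M) (b s) (u s)) ->
    (forall s, s \notin r -> exists2 m, homogeneous (X := M) m (u s) & odd `|m|%N = b s) ->
    comp n (pure u) = 0.
  apply: (main (enum {: GH})) => s; first by move=> _; apply: hv.
  by rewrite mem_enum.
elim: r u => [|s r IH] u h1 h2.
  have /boolp.choice[deg hdeg] : forall s, exists m, homogeneous (X := M) m (u s) /\ odd `|m|%N = b s.
    by move=> s; have [//|m ? ?] := h2 s; exists m.
  rewrite (comp_pure n (deg := deg)) => [|s]; last by case: (hdeg s).
  case: eqP => // en; case/eqP: hn; rewrite -en odd_absz_sum.
  by apply: eq_bigr => s _; case: (hdeg s).
have [q [_ eq]] := dg_comp_sum (u s : M).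
rewrite -(upd_id u s) [X in upd u s X]eq (msl_sum pure_msl) linear_sum big1 // => m _.
have [om|om] := eqVneq (odd `|m|%N) (b s); last first.
  by rewrite (h1 s (mem_head _ _) m om) (msl0 pure_msl) linear0.
apply: IH => c cr; rewrite updE; have [->|cs] := eqVneq c s.
- move=> i hi; rewrite dg_comp_comp; have [e|//] := eqVneq i m; first by rewrite e om eqxx in hi.
- by apply: h1; rewrite inE cr orbT.
- by exists m => //; apply: comp_homogeneous.
- by apply: h2; rewrite inE negb_or cs.
Qed.

(** The basis from [kunneth_basis] is indexed by functions from [G/H] to a homology basis of [M],
    with the sum of parities as parity. Descent carries its cardinalities to [W], and [card_parity]
    evaluates their difference. *)
Lemma fixed_hdim n0 n1 : hdim (dgc M) false n0 -> hdim (dgc M) true n1 ->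
  exists m0 m1, [/\ hdim (dgc W) false m0, hdim (dgc W) true m1
    & m0%:Z - m1%:Z = (n0%:Z - n1%:Z) ^+ #|{: GH}|].
Proof.
move=> hn0 hn1; have [r [rn0 rn1]] := retract_exists hn0 hn1.
pose pr x := \sum_j rt_xi (r := r) j x *: rt_x (r := r) j.
have prl : linear (pr : rs M -> rs M).
  move=> a x y; rewrite /pr scaler_sumr -big_split; apply: eq_bigr => j _ /=.
  by rewrite linearP scalerDl scalerA.
have [c [c0 cx cs]] := @kunneth_basis k l L iota (rs M) T pure pure_msl pure_map (rt_om r)
  (rs_map (dg_dif M)) (rt_h r) (mklin prl) D pure_ext (tens_dif_pure pure_msl pure_map pure_ext D_pure r)
  (@rt_om_om _ _ r) (@rt_om_dif _ _ r) (@rt_om_h _ _ r) (@rt_homotopy _ _ r) (rt_J r)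
  (@rt_x _ _ r) (@rt_xi _ _ r) (fun x => erefl) (@rt_xi_x _ _ r) (@rt_xi_dif _ _ r) tdif_dif.
pose pf (f : {ffun GH -> rt_J r}) := \big[addb/false]_s rt_p (r := r) (f s).
have h b : hdim (dgc W) b #|[pred f | pf f == b]|.
  apply: (@hdim_descent k L hL tcplx (dgc W) inc gal galP galM gal1 incP inc_inj inc_fix inc_dif tpar_inc).
  apply: (@dual_family_hdim L tcplx _ pf (xpure pure (@rt_x _ _ r)) c) => //.
  move=> f; split.
    apply: tpar_pure => s; rewrite ffunE; have [] := rt_x_cyc (r := r) (f s); exact.
  rewrite /xpure [LHS](tens_dif_pure pure_msl pure_map pure_ext D_pure r) big1 // => t _.
  apply: (msl_eq0 pure_msl (s := t)); rewrite ffunE slotE {1}/before ltnn eqxx ffunE.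
  by have [] := rt_x_cyc (r := r) (f t).
exists #|[pred f | pf f == false]|, #|[pred f | pf f == true]|; split=> //.
by rewrite card_parity rn0 rn1.
Qed.
End FixedPart.

Section MultisemilinearRestriction.
Variables (k : fieldType) (l : fieldExtType k) (L : splittingFieldType k).
Variable iota : 'AHom(l, L).
Notation GH := (cosetT iota).

Lemma mslE (C : falgType l) (M : lmodType C^c) (T : lmodType L) (f : {ffun GH -> M} -> T) :
  (forall (v : {ffun GH -> M}) (s : GH) (a : l) (x y : M),
    f (upd v s (((a%:A : C) : C^c) *: x + y)) =
    emb s a *: f (upd v s x) + f (upd v s y)) <-> msl (N := rs M) f.
Proof. by split; exact. Qed.
End MultisemilinearRestriction.

Section TransferHomology.
Variables (k : fieldType) (l : fieldExtType k) (L : splittingFieldType k).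
Hypothesis hL : galois 1 {:L}.
Variable iota : 'AHom(l, L).
Variables (A A' : falgType l).
Notation G := (gal_of {:L}).
Notation GH := (cosetT iota).
Notation C := (optens A A').
Variables (M : dgmod C) (W : dgmod (optens (Rnc iota A) (Rnc iota A'))).
Variable tr : transfer (iota := iota) M W.
Notation T := (tr_tensor tr).

Let pure : {ffun GH -> rs M} -> T := tr_pure tr.

Let pure_msl : msl pure.
Proof.
have h : multisemilinear (tr_pure tr) by have [h _] := tr_tensorP tr.
exact: (proj1 (@mslE k l L iota C M T (tr_pure tr)) h).
Qed.

Let pure_map (S : lmodType L) (f : {ffun GH -> rs M} -> S) : msl f ->
  exists g : {linear T -> S}, forall v, g (pure v) = f v.
Proof.
move=> hf; have [_ h] := tr_tensorP tr.
exact: (proj1 (h S f (proj2 (@mslE k l L iota C M S f) hf))).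
Qed.

Let pure_ext (S : lmodType L) (g g' : {linear T -> S}) :
  (forall v, g (pure v) = g' (pure v)) -> g =1 g'.
Proof.
move=> e; have [_ h] := tr_tensorP tr.
have gm : msl (g \o pure) by move=> v s a x y; rewrite /= pure_msl linearP.
apply: (proj2 (h S _ (proj2 (@mslE k l L iota C M S (g \o pure)) gm))) => // v.
exact: esym (e v).
Qed.

(** A scalar [a] acts on [W] as [optens_pure a%:A 1], and [tr_incl_act] expands this as [a] times
    the identity of the tensor product; in this way linearity over [k] is recovered from the
    action. *)
Lemma tr_incl_base (a : k) (x y : rs W) :
  tr_incl tr (a *: x + y) = a%:A *: tr_incl tr x + tr_incl tr y.
Proof.
rewrite raddfD rs_scaleE; congr (_ + _).
have -> : a%:A = optens_pure (a%:A : Rnc iota A) (1 : Rnc iota A').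
  by rewrite -optens_pure1 optens_pureZl.
rewrite tr_incl_act; move: (tr_incl tr x) => t.
pose P (i : 'I_(\dim {:A})) (j : 'I_(\dim {:A'})) : C := optens_pure (bas i) (bas j).
have e1 : \sum_i \sum_j (crd i (1 : A) * crd j (1 : A')) *: P i j = 1.
  rewrite -optens_pure1 [X in optens_pure X _]crd_expand optens_pure_suml.
  apply: eq_bigr => i _; rewrite optens_pureZl [X in optens_pure _ X]crd_expand optens_pure_sumr.
  by rewrite scaler_sumr; apply: eq_bigr => j _; rewrite optens_pureZr scalerA.
have hact (f : {ffun GH -> 'I_(\dim {:A})}) (g : {ffun GH -> 'I_(\dim {:A'})}) v :
    tr_act tr [ffun s => bas (f s)] [ffun s => bas (g s)] (pure v) =
    pure [ffun s => ((P (f s) (g s) : C^c) *: (v s : M) : rs M)].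
  rewrite [LHS]tr_act_pure; congr pure; apply/ffunP => s.
  by rewrite !ffunE.
rewrite -[in RHS](tens_act1 pure_msl pure_ext e1 hact t) scaler_sumr.
apply: eq_bigr => f _; rewrite scaler_sumr; apply: eq_bigr => g _.
rewrite scalerA mulrA; congr (_ * _ *: _); last first.
  by rewrite Rnc_val1 [LHS]scalg_oneE.
have -> : vsval (a%:A : Rnc iota A) = a *: (1 : tensA iota A) by rewrite -[in RHS]Rnc_val1; exact: linearZ.
by rewrite [LHS]ffunE [X in _ *: X]scalg_oneE mulr_algl.
Qed.

Lemma transfer_hdim n0 n1 : hdim (dgc M) false n0 -> hdim (dgc M) true n1 ->
  exists m0 m1, [/\ hdim (dgc W) false m0, hdim (dgc W) true m1
    & m0%:Z - m1%:Z = (n0%:Z - n1%:Z) ^+ #|{: GH}|].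
Proof.
refine (@fixed_hdim k l L hL iota C M T pure pure_msl pure_map pure_ext (tr_comp tr) (tr_dif tr)
  (@tr_gal k l L iota A A' M W tr) (tr_comp_pure tr) (tr_dif_pure tr)
  (@tr_gal_semilinear _ _ _ _ _ _ _ _ tr) (tr_gal_pure tr)
  (optens (Rnc iota A) (Rnc iota A')) W (tr_incl tr) tr_incl_base (@tr_incl_inj _ _ _ _ _ _ _ _ tr)
  (@tr_inclP _ _ _ _ _ _ _ _ tr) (tr_incl_comp tr) (tr_incl_dif tr) n0 n1).
Qed.
End TransferHomology.

(** * Existence of the fixed part *)

(* a vector space with a right action of R^op \otimes R' *)
Record bimod (F : fieldType) (R R' : falgType F) := Bimod {
  bm_space :> lmodType F;
  bm_act : R -> R' -> bm_space -> bm_space;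
  bm_linl : forall b v, linear (fun a => bm_act a b v);
  bm_linr : forall a v, linear (fun b => bm_act a b v);
  bm_lin : forall a b, linear (bm_act a b);
  bm_act1 : forall v, bm_act 1 1 v = v;
  bm_actM : forall a b a' b' v, bm_act a b (bm_act a' b' v) = bm_act (a * a') (b' * b) v }.

Section BimodModule.
Variables (F : fieldType) (R R' : falgType F) (B : bimod R R').
Notation C := (optens R R').

Definition bmod : Type := bm_space B.
HB.instance Definition _ := GRing.Zmodule.copy bmod B.

Definition bmod_act (c : C^c) (v : bmod) : bmod :=
  \sum_ij opcoef ij (c : C) *: bm_act (bas ij.1) (bas ij.2) (v : B).

Lemma bmod_act_linl v : linear (fun c : C => bmod_act c v : B).
Proof.
move=> a c c'; rewrite /bmod_act scaler_sumr.
transitivity (\sum_ij (a *: (opcoef ij c *: bm_act (bas ij.1) (bas ij.2) (v : B)) +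
    opcoef ij c' *: bm_act (bas ij.1) (bas ij.2) (v : B))); last exact: big_split.
by apply: eq_bigr => ij _; rewrite opcoef_linear scalerDl scalerA.
Qed.

Lemma bmod_act_linr c : linear (fun v : B => bmod_act c v : B).
Proof.
move=> a u v; rewrite /bmod_act scaler_sumr.
transitivity (\sum_ij (a *: (opcoef ij (c : C) *: bm_act (bas ij.1) (bas ij.2) u) +
    opcoef ij (c : C) *: bm_act (bas ij.1) (bas ij.2) v)); last exact: big_split.
by apply: eq_bigr => ij _; rewrite bm_lin scalerDr !scalerA mulrC.
Qed.

Fact bmod_actDl v : {morph bmod_act^~ v : c c' / c + c'}.
Proof.
move=> c c'; have := bmod_act_linl v 1 c c'; rewrite !scale1r; exact.
Qed.

Fact bmod_actDr : right_distributive bmod_act +%R.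
Proof. move=> c u v; have := bmod_act_linr c 1 u v; rewrite !scale1r; exact. Qed.

Lemma bmod_act_pure a b v : bmod_act (optens_pure a b : C) v = bm_act a b v.
Proof.
rewrite [in RHS](crd_expand a) (linear_fun_sum (bm_linl b v)).
transitivity (\sum_i \sum_j (crd i a * crd j b) *: bm_act (bas i) (bas j) (v : B)).
  rewrite pair_big; apply: eq_bigr => -[i j] _.
  by rewrite opcoef_pure.
apply: eq_bigr => i _; rewrite (linear_funZ (bm_linl b v)) [in RHS](crd_expand b).
rewrite (linear_fun_sum (bm_linr (bas i) v)) scaler_sumr; apply: eq_bigr => j _.
by rewrite (linear_funZ (bm_linr (bas i) v)) scalerA.
Qed.

Fact bmod_act1 : left_id 1 bmod_act.
Proof. by move=> v; rewrite -[1]/(1 : C) -optens_pure1 bmod_act_pure bm_act1. Qed.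

Fact bmod_actA c c' v : bmod_act c (bmod_act c' v) = bmod_act (c * c') v.
Proof.
have h (z z' : C) u : bmod_act z (bmod_act z' u) = bmod_act (z' * z : C) u.
  rewrite [z](optens_expand z) [LHS](linear_fun_sum (bmod_act_linl _)) mulr_sumr.
  rewrite [RHS](linear_fun_sum (bmod_act_linl _)); apply: eq_bigr => ij _.
  rewrite [LHS](linear_funZ (bmod_act_linl _)) -scalerAr [RHS](linear_funZ (bmod_act_linl _)).
  congr (_ *: _); rewrite [z'](optens_expand z') (linear_fun_sum (bmod_act_linl _)).
  rewrite [LHS](linear_fun_sum (bmod_act_linr _)) mulr_suml.
  rewrite [RHS](linear_fun_sum (bmod_act_linl _)); apply: eq_bigr => pq _.
  rewrite (linear_funZ (bmod_act_linl _)) [LHS](linear_funZ (bmod_act_linr _)) -scalerAl.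
  rewrite [RHS](linear_funZ (bmod_act_linl _)); congr (_ *: _).
  by rewrite optens_pureM !bmod_act_pure bm_actM.
exact: (h c c' v).
Qed.
HB.instance Definition _ := GRing.Zmodule_isLmodule.Build C^c bmod bmod_actA bmod_act1 bmod_actDr bmod_actDl.

Lemma bmod_pureE a b (v : bmod) : ((optens_pure a b : C) : C^c) *: v = bm_act a b v :> B.
Proof. exact: bmod_act_pure. Qed.

End BimodModule.

Section CoordinateTensor.
Variables (k : fieldType) (l : fieldExtType k) (L : splittingFieldType k).
Variable iota : 'AHom(l, L).
Notation G := (gal_of {:L}).
Notation GH := (cosetT iota).
Variables (C : falgType l) (M : lmodType C^c).
Notation N := (rs M).
Variables (J : finType) (e : J -> N) (co : J -> {linear N -> l^o}).
Hypothesis coE : forall v, v = \sum_j co j v *: e j.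
Hypothesis co_e : forall i j, co i (e j) = (i == j)%:R.

(** A coordinate model of the tensor product, for [M] with a finite basis indexed by [J]; the
    functions from [GH] to [J] index its [L]-basis. *)
Definition ctens : lmodType L := {ffun {ffun GH -> J} -> L^o}.
Notation T := ctens.

Definition cpure (v : {ffun GH -> N}) : T :=
  ([ffun f : {ffun GH -> J} => \prod_s emb s (co (f s) (v s))] : {ffun _ -> L^o}).

Lemma cpureE v (f : {ffun GH -> J}) : (cpure v : {ffun _ -> L^o}) f = \prod_s emb s (co (f s) (v s)).
Proof. exact: ffunE. Qed.

Lemma cpure_msl : msl cpure.
Proof.
move=> v s a x y; apply/ffunP => f; rewrite [RHS]ffunE [X in _ = X + _]ffunE !cpureE.
rewrite !(bigD1 (P := xpredT) s) //= !updE eqxx linearP /= rmorphD rmorphM.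
have h u : \prod_(c | c != s) emb c (co (f c) (upd v s u c)) = \prod_(c | c != s) emb c (co (f c) (v c)).
  by apply: eq_bigr => c /negPf cs; rewrite updE cs.
by rewrite !h mulrDl -mulrA.
Qed.

Definition cbas (f : {ffun GH -> J}) : T := cpure [ffun s => e (f s)].

Lemma cbasE f g : (cbas f : {ffun _ -> L^o}) g = (f == g)%:R.
Proof.
rewrite cpureE; under eq_bigr do rewrite ffunE co_e.
have [->|neq] := eqVneq f g; first by rewrite big1 // => s _; rewrite eqxx rmorph1.
have /existsP[s bfs] : [exists s, f s != g s].
  apply: contraNT neq; rewrite negb_exists => /forallP h.
  by apply/eqP/ffunP => s; apply/eqP; rewrite -[_ == _]negbK.
by rewrite (bigD1 s) //= eq_sym (negPf bfs) rmorph0 mul0r.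
Qed.

Lemma ctens_expand (t : T) : t = \sum_f (t : {ffun _ -> L^o}) f *: cbas f.
Proof.
apply/ffunP => g; rewrite sum_ffunE (bigD1 g) //= ffunE cbasE eqxx big1 ?addr0 => [|f /negPf fg].
  exact: esym (mulr1 _).
by rewrite ffunE cbasE fg; exact: mulr0.
Qed.

Lemma cpure_map (S : lmodType L) (f : {ffun GH -> N} -> S) : msl f ->
  exists g : {linear T -> S}, forall v, g (cpure v) = f v.
Proof.
move=> hf.
have gl : linear (fun t : T => \sum_h (t : {ffun _ -> L^o}) h *: f [ffun s => e (h s)]).
  move=> a x y; rewrite scaler_sumr -big_split; apply: eq_bigr => h _ /=.
  by rewrite !ffunE scalerDl scalerA.
exists (mklin gl) => v.
have {2}-> : v = [ffun s => \sum_j co j (v s) *: e j].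
  by apply/ffunP => s; rewrite ffunE -coE.
by rewrite (msl_expand hf (fun s j => co j (v s)) (fun _ j => e j)); apply: eq_bigr => h _; rewrite cpureE.
Qed.

Lemma cpure_ext (S : lmodType L) (g g' : {linear T -> S}) :
  (forall v, g (cpure v) = g' (cpure v)) -> g =1 g'.
Proof.
move=> h t; rewrite [t]ctens_expand !linear_sum; apply: eq_bigr => f _.
by rewrite !linearZ /= h.
Qed.

(** The permutation action without Koszul signs; [sgal] adds them. *)
Definition cgal (rho : G) (t : T) : T :=
  ([ffun f => rho ((t : {ffun _ -> L^o}) (permute rho^-1%g f))] : {ffun _ -> L^o}).

Lemma cgalP rho (a : L) x y : cgal rho (a *: x + y) = rho a *: cgal rho x + cgal rho y.
Proof. by apply/ffunP => f; rewrite !ffunE rmorphD rmorphM. Qed.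

Lemma cgal_pure rho v : cgal rho (cpure v) = cpure (permute rho v).
Proof.
apply/ffunP => f; rewrite ffunE !cpureE rmorph_prod /=.
rewrite [RHS](reindex_inj (can_inj (coset_mulK rho))) /=.
by apply: eq_bigr => s _; rewrite emb_mul !ffunE invgK coset_mulK.
Qed.

(* the right action of \otimes_\sigma ^\sigma C_L *)
Fact cact_exists (z : {ffun GH -> C}) : exists g : {linear T -> T},
  forall v, g (cpure v) = cpure [ffun s => ((z s : C^c) *: (v s : M) : N)].
Proof.
apply: cpure_map => v s a x y.
have ez u : [ffun c => ((z c : C^c) *: (upd v s u c : M) : N)] =
    upd [ffun c => ((z c : C^c) *: (v c : M) : N)] s ((z s : C^c) *: (u : M) : N).
  by apply/ffunP => c; rewrite !ffunE; case: eqP => [->|].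
rewrite !ez -cpure_msl; congr (cpure (upd _ _ _)).
rewrite [LHS]scalerDr !rs_scaleE; congr (_ + _).
rewrite !scalerA; apply: (f_equal (fun u : C^c => u *: (x : M))).
by change ((a%:A : C) * z s = z s * (a%:A : C)); rewrite mulr_algr mulr_algl.
Qed.

Definition cact z : {linear T -> T} := projT1 (cid (cact_exists z)).

Lemma cact_pure z v : cact z (cpure v) = cpure [ffun s => ((z s : C^c) *: (v s : M) : N)].
Proof. exact: (projT2 (cid (cact_exists z))). Qed.

Lemma cactM z z' t : cact z (cact z' t) = cact [ffun s => z' s * z s] t.
Proof.
apply: (cpure_ext (g := cact z \o cact z') (g' := cact [ffun s => z' s * z s])) => v /=.
rewrite !cact_pure; congr cpure; apply/ffunP => s; rewrite !ffunE scalerA.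
by [].
Qed.

Lemma cact1 t : cact [ffun=> 1] t = t.
Proof.
apply: (cpure_ext (g := cact [ffun=> 1]) (g' := idfun)) => v.
rewrite cact_pure; congr cpure; apply/ffunP => s; rewrite !ffunE.
exact: (scale1r (v s : M)).
Qed.

Lemma cact_msl t : msl (fun z => cact z t).
Proof.
move=> z s a x y /=.
have lin z' : cact z' t = \sum_f (t : {ffun _ -> L^o}) f *: cact z' (cbas f).
  by rewrite {1}[t]ctens_expand linear_sum; apply: eq_bigr => f _; rewrite linearZ.
rewrite !lin scaler_sumr -big_split; apply: eq_bigr => f _ /=.
rewrite scalerA mulrC -scalerA -scalerDr; congr (_ *: _); rewrite !cact_pure.
set v := [ffun s => e (f s)].
have ez u : [ffun c => ((upd z s u c : C^c) *: (v c : M) : N)] =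
    upd [ffun c => ((z c : C^c) *: (v c : M) : N)] s ((u : C^c) *: (v s : M) : N).
  by apply/ffunP => c; rewrite !ffunE; case: eqP => [->|].
rewrite !ez -cpure_msl; congr (cpure (upd _ _ _)).
rewrite -[LHS]/(((a *: x + y : C) : C^c) *: (v s : M)) [LHS]scalerDl rs_scaleE; congr (_ + _).
rewrite scalerA; apply: (f_equal (fun u : C^c => u *: (v s : M))).
by change (a *: x = x * (a%:A : C)); rewrite mulr_algr.
Qed.

Lemma cgal_act rho z t : cgal rho (cact z t) = cact (permute rho z) (cgal rho t).
Proof.
have l1 : linear (fun t => cgal rho (cact z t) : twist rho T).
  by move=> a x y; rewrite linearP cgalP.
have l2 : linear (fun t => cact (permute rho z) (cgal rho t) : twist rho T).
  by move=> a x y; rewrite cgalP linearP.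
apply: (cpure_ext (g := mklin l1) (g' := mklin l2)) => v.
change (cgal rho (cact z (cpure v)) = cact (permute rho z) (cgal rho (cpure v))).
rewrite cact_pure !cgal_pure cact_pure; congr cpure; apply/ffunP => s.
by rewrite !ffunE.
Qed.
End CoordinateTensor.

Section TensorBimodule.
Variables (k : fieldType) (l : fieldExtType k) (L : splittingFieldType k).
Hypothesis hL : galois 1 {:L}.
Variable iota : 'AHom(l, L).
Notation G := (gal_of {:L}).
Notation GH := (cosetT iota).

Lemma tensA_lin_ext (A : falgType l) (S : lmodType L)
    (F F' : {ffun {ffun GH -> 'I_(\dim {:A})} -> L^o} -> S) :
  linear F -> linear F' -> (forall x, F (@tensA_pure k l L iota A x) = F' (@tensA_pure k l L iota A x)) ->
  F =1 F'.
Proof.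
move=> hF hF' h t; rewrite [t](tensA_expand (t : tensA iota A)).
rewrite (linear_fun_sum hF) (linear_fun_sum hF'); apply: eq_bigr => f _.
by rewrite [LHS](linear_funZ hF) [RHS](linear_funZ hF') h.
Qed.

Variables (A A' : falgType l) (C : falgType l) (op : A -> A' -> C).
Hypothesis op_linl : forall y, linear (op^~ y).
Hypothesis op_linr : forall x, linear (op x).
Hypothesis opM : forall x y x' y', op x y * op x' y' = op (x' * x) (y * y').
Hypothesis op1 : op 1 1 = 1.
Variable M : lmodType C^c.
Notation N := (rs M).
Variables (J : finType) (e : J -> N) (co : J -> {linear N -> l^o}).
Hypothesis coE : forall v, v = \sum_j co j v *: e j.
Hypothesis co_e : forall i j, co i (e j) = (i == j)%:R.
Notation T := (ctens iota J).
Notation act := (@cact k l L iota C M J e co coE).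
Notation TA := (tensA iota A).
Notation TA' := (tensA iota A').
Notation VA := {ffun {ffun GH -> 'I_(\dim {:A})} -> L^o}.
Notation VA' := {ffun {ffun GH -> 'I_(\dim {:A'})} -> L^o}.
Notation tpure := (@tensA_pure k l L iota _).
Notation gal := (@cgal k l L iota J).

Definition opact (x : {ffun GH -> A}) (y : {ffun GH -> A'}) : {linear T -> T} :=
  act [ffun s => op (x s) (y s)].

(** Modelled on the right side of [tr_incl_act], for elements that need not be invariant; by
    [tact_pure] it is the slotwise action on pure tensors. *)
Definition tensor_act (a : VA) (b : VA') (t : T) : T :=
  \sum_(f : {ffun GH -> 'I_(\dim {:A})}) \sum_(g : {ffun GH -> 'I_(\dim {:A'})}) (a f * b g) *:
    opact [ffun s => bas (f s)] [ffun s => bas (g s)] t.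

Lemma tact_linl b t : linear (fun a => tensor_act a b t).
Proof.
move=> c a a'; rewrite /tensor_act scaler_sumr -big_split; apply: eq_bigr => f _ /=.
rewrite scaler_sumr -big_split; apply: eq_bigr => g _ /=.
by rewrite !ffunE scalerA -scalerDl mulrDl -mulrA.
Qed.

Lemma tact_linr a t : linear (fun b => tensor_act a b t).
Proof.
move=> c b b'; rewrite /tensor_act scaler_sumr -big_split; apply: eq_bigr => f _ /=.
rewrite scaler_sumr -big_split; apply: eq_bigr => g _ /=.
by rewrite !ffunE scalerA -scalerDl mulrDr mulrCA.
Qed.

Lemma tact_lin a b : linear (tensor_act a b).
Proof.
move=> c t t'; rewrite /tensor_act scaler_sumr -big_split; apply: eq_bigr => f _ /=.
rewrite scaler_sumr -big_split; apply: eq_bigr => g _ /=.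
by rewrite linearP scalerDr !scalerA mulrC.
Qed.

Lemma tact_pure x y t : tensor_act (tpure x) (tpure y) t = opact x y t.
Proof.
have updop1 s u x' : [ffun c => op (upd x' s u c) (y c)] = upd [ffun c => op (x' c) (y c)] s (op u (y s)).
  by apply/ffunP => c; rewrite !ffunE; case: eqP => [->|].
have ml : msl (fun x => opact x y t).
  by move=> v s a u u' /=; rewrite /opact !updop1 op_linl (cact_msl coE co_e t).
have updop2 s u x' (y' : {ffun GH -> A'}) : [ffun c => op (x' c) (upd y' s u c)] = upd [ffun c => op (x' c) (y' c)] s (op (x' s) u).
  by apply/ffunP => c; rewrite !ffunE; case: eqP => [->|].
have mr x' : msl (fun y => opact x' y t).
  by move=> v s a u u' /=; rewrite /opact !updop2 op_linr (cact_msl coE co_e t).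
have {2}-> : x = [ffun s => \sum_i crd i (x s) *: bas i].
  by apply/ffunP => s; rewrite ffunE -crd_expand.
rewrite (msl_expand ml (fun s i => crd i (x s)) (fun _ i => bas i)); apply: eq_bigr => f _.
have {2}-> : y = [ffun s => \sum_i crd i (y s) *: bas i].
  by apply/ffunP => s; rewrite ffunE -crd_expand.
rewrite (msl_expand (mr _) (fun s i => crd i (y s)) (fun _ i => bas i)) scaler_sumr.
by apply: eq_bigr => g _; rewrite scalerA ![(tpure _ : {ffun _ -> _}) _]tpureE.
Qed.

(** Linearity in each argument reduces the claim to four pure tensors, where it is [opM] in each
    slot. *)
Lemma tactM (a : TA) (b : TA') (a' : TA) (b' : TA') t :
  tensor_act a b (tensor_act a' b' t) = tensor_act (a * a' : TA) (b' * b : TA') t.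
Proof.
move: a; apply: tensA_lin_ext; first exact: tact_linl.
  move=> c u v; rewrite -tact_linl; congr (tensor_act _ _ t).
  by rewrite -[LHS]/((tsc c u + v : TA) * a') mulrDl tsc_mull.
move=> x; move: b; apply: tensA_lin_ext; first exact: tact_linr.
  move=> c u v; rewrite -tact_linr; congr (tensor_act _ _ t).
  by rewrite -[LHS]/(b' * (tsc c u + v : TA')) mulrDr tsc_mulr.
move=> y; move: a'; apply: tensA_lin_ext.
- by move=> c u v; rewrite tact_linl tact_lin.
- move=> c u v; rewrite -tact_linl; congr (tensor_act _ _ t).
  by rewrite -[LHS]/(_ * (tsc c u + v : TA)) mulrDr tsc_mulr.
move=> x'; move: b'; apply: tensA_lin_ext.
- by move=> c u v; rewrite tact_linr tact_lin.
- move=> c u v; rewrite -tact_linr; congr (tensor_act _ _ t).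
  by rewrite -[LHS]/((tsc c u + v : TA') * _) mulrDl tsc_mull.
move=> y'; rewrite !tensA_pureM !tact_pure /opact (cactM coE co_e); congr (act _ t).
by apply/ffunP => s; rewrite !ffunE opM.
Qed.

Lemma tact1 t : tensor_act (1 : TA) (1 : TA') t = t.
Proof.
rewrite -!tensA_pure1 tact_pure /opact -[RHS](cact1 coE co_e); congr (act _ t).
by apply/ffunP => s; rewrite !ffunE op1.
Qed.

Lemma gal_tact rho (a : TA) (b : TA') t :
  gal rho (tensor_act a b t) = tensor_act (tensA_gal rho a) (tensA_gal rho b) (gal rho t).
Proof.
rewrite /tensor_act (gal_sum (@cgalP k l L iota J)) [RHS](reindex_inj (can_inj (permuteK rho))).
apply: eq_bigr => f _; rewrite (gal_sum (@cgalP k l L iota J)).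
rewrite [RHS](reindex_inj (can_inj (permuteK rho))); apply: eq_bigr => g _ /=.
rewrite (galZ (@cgalP k l L iota J)) /opact (cgal_act coE co_e) rmorphM.
congr (_ * _ *: act _ _); try by rewrite ffunE permuteK.
by apply/ffunP => s; rewrite !ffunE.
Qed.
End TensorBimodule.

Section FixedBimodule.
Variables (k : fieldType) (l : fieldExtType k) (L : splittingFieldType k).
Hypothesis hL : galois 1 {:L}.
Variable iota : 'AHom(l, L).
Notation G := (gal_of {:L}).
Notation GH := (cosetT iota).
Variables (A A' : falgType l) (C : falgType l) (op : A -> A' -> C).
Hypothesis op_linl : forall y, linear (op^~ y).
Hypothesis op_linr : forall x, linear (op x).
Hypothesis opM : forall x y x' y', op x y * op x' y' = op (x' * x) (y * y').
Hypothesis op1 : op 1 1 = 1.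
Variable M : lmodType C^c.
Notation N := (rs M).
Variables (J : finType) (e : J -> N) (co : J -> {linear N -> l^o}).
Hypothesis coE : forall v, v = \sum_j co j v *: e j.
Hypothesis co_e : forall i j, co i (e j) = (i == j)%:R.
Notation T := (ctens iota J).
Notation TK := {ffun {ffun GH -> J} -> L}.
Notation TA := (tensA iota A).
Notation TA' := (tensA iota A').
Notation R := (Rnc iota A).
Notation R' := (Rnc iota A').
Notation tact := (@tensor_act k l L iota A A' C op M J e co coE).
Variable g : int.

(** With all slots in the single degree [g] the Koszul sign depends on [rho] alone. *)
Definition sgal (rho : G) (t : T) : T :=
  (-1) ^+ koszul (iota := iota) rho (fun=> g) *: cgal rho t.

Lemma sgalP rho (a : L) x y : sgal rho (a *: x + y) = rho a *: sgal rho x + sgal rho y.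
Proof. by rewrite /sgal cgalP scalerDr !scalerA mulrC. Qed.

Lemma ctens_scale_base (a : k) (x : TK) : a *: x = a%:A *: (x : T) :> T.
Proof. by apply/ffunP => f; rewrite !ffunE -[LHS]mulr_algl. Qed.

Fact sgal_is_linear rho : linear (sgal rho : TK -> TK).
Proof.
move=> a x y; rewrite -[LHS]/(sgal rho ((a *: x : T) + (y : T))) ctens_scale_base sgalP gal_base.
by rewrite -[RHS]/((a *: (sgal rho x : TK) : T) + sgal rho y) ctens_scale_base.
Qed.

Definition sgal_map rho : {linear TK -> TK} := mklin (sgal_is_linear rho).

Definition fixedT : {vspace TK} := (\bigcap_(rho : G) fixedSpace (linfun (sgal_map rho)))%VS.

Lemma fixedTP (t : TK) : reflect (forall rho, sgal rho t = t) (t \in fixedT).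
Proof.
rewrite memvE; apply: (iffP subv_bigcapP) => h rho.
  by have := h rho isT; rewrite -memvE => /fixedSpaceP; rewrite lfunE.
by move=> _; rewrite -memvE; apply/fixedSpaceP; rewrite lfunE; exact: h.
Qed.

Lemma sgal_tact rho (a : TA) (b : TA') t :
  sgal rho (tact a b t) = tact (tensA_gal rho a) (tensA_gal rho b) (sgal rho t).
Proof. by rewrite /sgal gal_tact // (linear_funZ (tact_lin op coE _ _)). Qed.

Fact fixed_act_subproof (r : R) (r' : R') (w : subvs_of fixedT) :
  (tact (vsval r) (vsval r') (vsval w : T) : TK) \in fixedT.
Proof.
apply/fixedTP => rho; rewrite sgal_tact !Rnc_gal; congr (tensor_act _ _ _ _ _).
by move: rho; apply/fixedTP; exact: subvsP.
Qed.
Definition fixed_act r r' w : subvs_of fixedT := Subvs (fixed_act_subproof r r' w).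

Fact fixed_act_linl r' w : linear (fun r => fixed_act r r' w).
Proof.
move=> a r s; apply: val_inj.
change (tact (vsval (a *: r + s)) (vsval r') (vsval w) =
  a *: (vsval (fixed_act r r' w) : TK) + vsval (fixed_act s r' w) :> TK).
rewrite -[RHS]/((a *: (vsval (fixed_act r r' w) : TK) : T) + _) ctens_scale_base -tact_linl.
by rewrite linearP /= -tsc_base.
Qed.

Fact fixed_act_linr r w : linear (fun r' => fixed_act r r' w).
Proof.
move=> a r' s; apply: val_inj.
change (tact (vsval r) (vsval (a *: r' + s)) (vsval w) =
  a *: (vsval (fixed_act r r' w) : TK) + vsval (fixed_act r s w) :> TK).
rewrite -[RHS]/((a *: (vsval (fixed_act r r' w) : TK) : T) + _) ctens_scale_base -tact_linr.
by rewrite linearP /= -tsc_base.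
Qed.

Fact fixed_act_lin r r' : linear (fixed_act r r').
Proof.
move=> a u v; apply: val_inj.
change (tact (vsval r) (vsval r') (vsval (a *: u + v)) =
  a *: (vsval (fixed_act r r' u) : TK) + vsval (fixed_act r r' v) :> TK).
rewrite -[RHS]/((a *: (vsval (fixed_act r r' u) : TK) : T) + _) ctens_scale_base -tact_lin.
congr (tensor_act _ _ _ _ _); rewrite linearP.
by rewrite -[LHS]/((a *: (vsval u : TK) : T) + _) ctens_scale_base.
Qed.

Fact fixed_act1 w : fixed_act 1 1 w = w.
Proof.
apply: val_inj; change (tact (vsval (1 : R)) (vsval (1 : R')) (vsval w) = vsval w :> T).
by rewrite !Rnc_val1; exact: tact1.
Qed.

Fact fixed_actM a b a' b' w : fixed_act a b (fixed_act a' b' w) = fixed_act (a * a') (b' * b) w.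
Proof. by apply: val_inj; exact: tactM. Qed.

Definition fixed_bimod : bimod R R' :=
  @Bimod k R R' (subvs_of fixedT) fixed_act fixed_act_linl fixed_act_linr fixed_act_lin
    fixed_act1 fixed_actM.

Definition fixed_incl_fun (w : bmod fixed_bimod) : T := vsval (w : subvs_of fixedT).
Fact fixed_incl_zmod : zmod_morphism fixed_incl_fun.
Proof. by move=> x y; exact: (linearB (vsval : subvs_of fixedT -> TK) x y). Qed.
Definition fixed_incl : {additive bmod fixed_bimod -> T} :=
  HB.pack fixed_incl_fun (GRing.isZmodMorphism.Build _ _ _ fixed_incl_zmod).

Lemma fixed_incl_inj : injective fixed_incl.
Proof. exact: (@val_inj _ _ (subvs_of fixedT)). Qed.

Lemma fixed_inclP t : (exists w, fixed_incl w = t) <-> (forall rho, sgal rho t = t).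
Proof.
split=> [[w <-]|h]; first by apply/fixedTP; exact: (subvsP (w : subvs_of fixedT)).
have h' : (t : TK) \in fixedT by apply/fixedTP.
by exists (Subvs h').
Qed.

Lemma fixed_incl_act r r' w :
  fixed_incl (((optens_pure r r' : optens R R') : (optens R R')^c) *: w) =
  tact (vsval r) (vsval r') (fixed_incl w).
Proof. by rewrite bmod_pureE. Qed.
End FixedBimodule.

Section OneDegree.
Variables (k : fieldType) (l : fieldExtType k) (L : splittingFieldType k).
Variable iota : 'AHom(l, L).
Notation G := (gal_of {:L}).
Notation GH := (cosetT iota).
Variables (C : falgType l) (X : dgmod C) (g : int).
Hypothesis X_comp : forall n (x : X), dg_comp X n x = if n == g then x else 0.
Hypothesis X_dif : forall x : X, dg_dif X x = 0.
Variables (T : lmodType L) (pure : {ffun GH -> rs X} -> T).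
Hypothesis pure_msl : msl pure.

(** A pure tensor with a zero slot vanishes, so the formulas on homogeneous families need checking
    only for the constant degree [g]. *)
Lemma one_degree deg (v : {ffun GH -> rs X}) : mhom deg v ->
  deg =1 (fun=> g) \/ exists s, v s = 0.
Proof.
move=> hv; have [h|hn] := pselect (exists s, v s = 0); [by right | left=> s].
have := hv s; rewrite /homogeneous X_comp; have [//|_ e] := eqVneq (deg s) g.
by case: hn; exists s; rewrite -e.
Qed.

Definition one_comp (n : int) : {linear T -> T} :=
  if n == g *+ #|{: GH}| then (idfun : {linear T -> T}) else (\0 : {linear T -> T}).

Lemma one_compE n t : one_comp n t = if n == g *+ #|{: GH}| then t else 0.
Proof. by rewrite /one_comp; case: ifP. Qed.

Lemma one_comp_pure n deg v : mhom deg v ->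
  one_comp n (pure v) = if \sum_s deg s == n then pure v else 0.
Proof.
move=> /one_degree[e|[s es]]; last by rewrite (msl_eq0 pure_msl es) linear0; case: ifP.
by rewrite one_compE (eq_bigr _ (fun s _ => e s)) sumr_const eq_sym.
Qed.

Lemma one_dif_pure deg v : mhom deg v -> (\0 : {linear T -> T}) (pure v) =
  \sum_s (-1) ^+ deg_before deg s *: pure (upd v s (rs_map (dg_dif X) (v s))).
Proof.
move=> _; rewrite big1 // => s _.
by rewrite [rs_map _ _]X_dif (msl0 pure_msl) scaler0.
Qed.

Lemma one_gal_pure (gal : G -> T -> T) : 
  (forall rho v, gal rho (pure v) = (-1) ^+ koszul (iota := iota) rho (fun=> g) *: pure (permute rho v)) ->
  forall rho deg v, mhom deg v -> gal rho (pure v) = (-1) ^+ koszul rho deg *: pure (permute rho v).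
Proof.
move=> h rho deg v hv; rewrite h; have [e|[s es]] := one_degree hv.
  congr (_ ^+ _ *: _); apply: eq_bigr => s _; apply: eq_bigr => t _.
  by rewrite !e.
by rewrite (msl_eq0 pure_msl (s := Defs.coset_mul s rho)) ?scaler0 // ffunE coset_mulK.
Qed.
End OneDegree.

Section TransferExists.
Variables (k : fieldType) (l : fieldExtType k) (L : splittingFieldType k).
Hypothesis hL : galois 1 {:L}.
Variable iota : 'AHom(l, L).
Variables (A A' : falgType l).
Notation G := (gal_of {:L}).
Notation GH := (cosetT iota).
Notation C := (optens A A').
Notation C' := (optens (Rnc iota A) (Rnc iota A')).
Variables (X : dgmod C) (g : int).
Hypothesis X_comp : forall n (x : X), dg_comp X n x = if n == g then x else 0.
Hypothesis X_dif : forall x : X, dg_dif X x = 0.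
Notation N := (rs X).
Variables (J : finType) (e : J -> N) (co : J -> {linear N -> l^o}).
Hypothesis coE : forall v, v = \sum_j co j v *: e j.
Hypothesis co_e : forall i j, co i (e j) = (i == j)%:R.

Let op_linl (y : A') : linear (fun x : A => optens_pure x y : C).
Proof. by move=> a x x'; exact: optens_pure_linl. Qed.
Let op_linr (x : A) : linear (fun y : A' => optens_pure x y : C).
Proof. by move=> a y y'; exact: optens_pure_linr. Qed.

Let B := @fixed_bimod k l L iota A A' C (@optens_pure l A A') op_linl op_linr
  (fun x y x' y' => optens_pureM x x' y y') (@optens_pure1 l A A') X J e co coE co_e g.
Let W : dgmod C' := dg_shift (bmod B) (g *+ #|{: GH}|).
Let T : lmodType L := ctens iota J.

Let incl : {additive W -> T} := @fixed_incl k l L iota A A' C (@optens_pure l A A') op_linl op_linr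
  (fun x y x' y' => optens_pureM x x' y y') (@optens_pure1 l A A') X J e co coE co_e g.

Let pure : {ffun GH -> X} -> T := @cpure k l L iota C X J co.

(** [W] is the fixed space of the signed Galois action on the coordinate tensor, placed in degree
    [g] times the number of slots, with zero differential. *)
Lemma transfer_exists : exists W', inhabited (transfer (iota := iota) X W').
Proof.
exists W; constructor.
have pmsl : msl (pure : {ffun GH -> N} -> T) by exact: cpure_msl.
have tensP : is_tensor pure.
  split; first exact: (proj2 (@mslE k l L iota C X T pure) pmsl).
  move=> S f hf; split.
    exact: (cpure_map coE (proj1 (@mslE k l L iota C X S f) hf)).
  move=> h h' e1 e2; apply: (cpure_ext co_e) => v; exact: etrans (e1 v) (esym (e2 v)).
apply: (@Transfer k l L iota A A' X W T pure tensP (one_comp iota g T) _ \0 _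
  (@sgal k l L iota J g) _ _
  (@opact k l L iota A A' C (@optens_pure l A A') X J e co coE) _ incl).
- exact: (one_comp_pure X_comp pmsl).
- exact: (one_dif_pure X_dif pmsl).
- exact: sgalP.
- apply: (one_gal_pure X_comp pmsl) => rho v; rewrite /sgal; congr (_ *: _); exact: cgal_pure.
- move=> a a' v; rewrite /opact; apply: etrans (cact_pure coE _ _) _; congr cpure.
  by apply/ffunP => s; rewrite [LHS]ffunE [RHS]ffunE ffunE.
- exact: fixed_incl_inj.
- exact: fixed_inclP.
- by move=> n w; rewrite one_compE sh_compE; case: eqP => // _; exact: (raddf0 incl).
- by move=> w; exact: (raddf0 incl).
- exact: fixed_incl_act.
Qed.
End TransferExists.

Section OneDegreeBasis.
Variables (F : fieldType) (C : falgType F) (X : dgmod C) (g : int).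
Hypothesis X_comp : forall n (x : X), dg_comp X n x = if n == g then x else 0.
Hypothesis X_dif : forall x : X, dg_dif X x = 0.

(** In one degree with zero differential, a homology basis is a basis of the module itself. *)
Lemma one_degree_basis n (P : Prop) : hdim (dgc X) (odd `|g|%N) n ->
  (forall (e : 'I_n -> rs X) (co : 'I_n -> {linear rs X -> F^o}),
    (forall v, v = \sum_j (co j v : F) *: e j) -> (forall i j, co i (e j) = (i == j)%:R) -> P) -> P.
Proof.
move=> /hdim_family[e [_ e_free e_span]] hP.
have bdyE (x : rs X) : bdy (X := dgc X) x <-> x = 0.
  split=> [[y ->]|->]; [exact: X_dif | by exists 0; rewrite linear0].
have /boolp.choice[c hc] : forall v : rs X, exists c, v = \sum_j c j *: e j.
  move=> v; have [|c /bdyE/eqP] := e_span v.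
    split; last exact: X_dif.
    move=> i ig; rewrite X_comp; have [ei|//] := eqVneq i g.
    by rewrite ei eqxx in ig.
  by rewrite subr_eq0 => /eqP ec; exists c.
have c_uniq v c' : v = \sum_j c' j *: e j -> forall j, c v j = c' j.
  move=> hv j; apply/eqP; rewrite -subr_eq0; apply/eqP.
  apply: (e_free (fun j => c v j - c' j)); apply/bdyE.
  rewrite (eq_bigr (fun j => c v j *: e j - c' j *: e j)) => [|i _]; last exact: scalerBl.
  by rewrite sumrB -hc -hv subrr.
have cl j : linear (fun v => c v j : F^o).
  move=> a x y; apply: (c_uniq _ (fun j => a * c x j + c y j)).
  rewrite {1}[x]hc {1}[y]hc scaler_sumr -big_split; apply: eq_bigr => i _ /=.
  by rewrite scalerDl scalerA.
apply: (hP e (fun j => mklin (cl j))) => [v|i j]; first exact: hc.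
apply: (c_uniq _ (fun i => (i == j)%:R)).
rewrite (bigD1 j) //= eqxx scale1r big1 ?addr0 // => m /negPf ->; exact: scale0r.
Qed.
End OneDegreeBasis.

Section Representatives.
Variables (F : fieldType) (C : falgType F) (U : {vspace C}).
Hypotheses (hS : simple_alg C) (hU : (U * {:C} <= U)%VS) (minU : minimal_right_ideal U).
Notation M := (rideal hU).

Lemma euler_dgV_const n (g : int) :
  euler (dgV M (fun _ : 'I_n => g)) = n%:Z * euler (dg_shift M g).
Proof.
elim: n => [|n IH].
  have h b : hdim (dgc (dgV M (fun _ : 'I_0 => g))) b 0.
    by exists [::]; split=> //= x _; exists 0; apply: fsumP => -[].
  by rewrite (eulerE (h false) (h true)) mul0r subrr.
have cV := dgV_compact hS hU minU (fun _ : 'I_n.+1 => g).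
have cV' := dgV_compact hS hU minU (fun _ : 'I_n => g).
have /(chi_eq hS hU minU) /= -> := dgV_split hS minU cV' cV.
by rewrite IH intS mulrDl mul1r addrC.
Qed.

Lemma euler_shift : euler (dg_shift M 0) = (\dim U)%:Z /\ euler (dg_shift M 1) = - (\dim U)%:Z.
Proof.
have e0 : euler (dg_shift M 0) = (\dim U)%:Z.
  rewrite -(euler_ideal hU); apply: esym.
  exact: (chi_eq hS hU minU (@K0_qis _ (dg_deg0 M) (dg_shift M 0) (ideal_compact hS hU minU)
    (shift_compact hS hU minU 0) idfun (@qis_id _ (dg_deg0 M)))).
split=> //; have /(chi_eq hS hU minU) /= := shift_succ_class hS hU minU 0.
by rewrite e0 => /eqP; rewrite addr_eq0 => /eqP.
Qed.

Lemma class_representative (m : int) : exists (X : dgmod C) (g : int) (n : nat),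
  [/\ forall i (x : X), dg_comp X i x = if i == g then x else 0, forall x : X, dg_dif X x = 0,
      hdim (dgc X) (odd `|g|%N) n, compact X & euler X = m * (\dim U)%:Z].
Proof.
have [n [g eg]] : exists n g, n%:Z * euler (dg_shift M g) = m * (\dim U)%:Z.
  have [e0 e1] := euler_shift; case: m => n; first by exists n, 0; rewrite e0.
  (* Negative multiples are represented by copies of [U] in the odd degree [1]. *)
  by exists n.+1, 1; rewrite e1 NegzE mulrN mulNr.
pose X := dgV M (fun _ : 'I_n => g); have [d hd] := dgV_hdim hU (fun _ : 'I_n => g) (odd `|g|%N).
exists X, g, d; split=> //.
- move=> i x; apply: fsumP => j; rewrite dv_compE eq_sym.
  by case: eqP.
- exact: dgV_compact.
- by rewrite euler_dgV_const.
Qed.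
End Representatives.

Section TransferClass.
Variables (k : fieldType) (l : fieldExtType k) (L : splittingFieldType k).
Hypothesis hL : galois 1 {:L}.
Variable iota : 'AHom(l, L).
Variables (A A' : falgType l).
Hypotheses (hA : central_simple A) (hA' : central_simple A').
Notation C := (optens A A').
Notation R := (Rnc iota A).
Notation R' := (Rnc iota A').
Notation C' := (optens R R').

Let azA : azumaya A.
Proof. by case/central_simpleP: hA => hS hZ; apply: csa_azumaya. Qed.
Let azA' : azumaya A'.
Proof. by case/central_simpleP: hA' => hS hZ; apply: csa_azumaya. Qed.

Lemma optens_csa : central_simple C.
Proof. by apply: azumaya_csa; apply: optens_azumaya. Qed.

Lemma optens_Rnc_csa : central_simple C'.
Proof.
have az (B : falgType l) : azumaya B -> azumaya (Rnc iota B).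
  by move=> hB; case/central_simpleP: (Rnc_central_simple hL iota hB) => hS hZ; apply: csa_azumaya.
by apply: azumaya_csa; apply: optens_azumaya; apply: az.
Qed.

Lemma dim_optens_Rnc : \dim {:C'} = (\dim {:C} ^ \dim {:l})%N.
Proof. by rewrite !dim_optens !(dim_Rnc hL) expnMn. Qed.
End TransferClass.

Section CentralSimpleClasses.
Variables (F : fieldType) (C : falgType F) (delta : nat).
Hypotheses (hC : central_simple C) (dimC : \dim {:C} = (delta * delta)%N).

Let hS : simple_alg C. Proof. by case/central_simpleP: hC. Qed.

Lemma class_hdim (X : dgmod C) (a : K0 C) : has_class X a ->
  exists n0 n1, [/\ hdim (dgc X) false n0, hdim (dgc X) true n1 & n0%:Z - n1%:Z = chi a].
Proof.
have [U mU] := minimal_right_ideal_exists C; have [hU _ _] := mU.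
move=> [cX e]; have [n0 h0] := compact_hdim hS hU mU false cX.
have [n1 h1] := compact_hdim hS hU mU true cX.
exists n0, n1; split=> //; rewrite -(eulerE h0 h1).
by apply/(has_classP hS hU mU) => //; exists cX.
Qed.

Lemma hdim_class (X : dgmod C) (a : K0 C) n0 n1 :
  hdim (dgc X) false n0 -> hdim (dgc X) true n1 -> n0%:Z - n1%:Z = chi a -> has_class X a.
Proof.
have [U mU] := minimal_right_ideal_exists C; have [hU _ _] := mU.
move=> h0 h1 e; apply/(has_classP hS hU mU); first exact: (hdim_compact hS hU mU h0 h1).
by rewrite (eulerE h0 h1).
Qed.

(** The Euler characteristic of a compact module is a multiple of [\dim U], which is
    [delta * ind C]. Applied to the fixed part, this gives the divisibility of [n ^ d] by the
    index. *)
Lemma hdim_dvd (X : dgmod C) n0 n1 (z : int) :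
  hdim (dgc X) false n0 -> hdim (dgc X) true n1 -> n0%:Z - n1%:Z = z * delta%:Z ->
  (Posz (ind C) %| z)%Z.
Proof.
have [U mU] := minimal_right_ideal_exists C; have [hU _ _] := mU.
move=> h0 h1; rewrite -(eulerE h0 h1).
have cX := hdim_compact hS hU mU h0 h1.
have [m /= ->] := chi_dvd hS hU mU (K0_class cX).
rewrite (dim_minimal_right_ideal hC dimC mU) mulnC PoszM mulrA => /mulIf e.
apply/dvdzP; exists m; apply/esym/e.
by have := delta_gt0 dimC; case: (delta).
Qed.

Lemma one_degree_representative (z : int) : (Posz (ind C) %| z)%Z ->
  exists (X : dgmod C) (g : int) (n : nat),
  [/\ forall i (x : X), dg_comp X i x = if i == g then x else 0, forall x : X, dg_dif X x = 0,
      hdim (dgc X) (odd `|g|%N) n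
    & forall a, chi a = z * delta%:Z -> has_class X a].
Proof.
have [U mU] := minimal_right_ideal_exists C; have [hU _ _] := mU.
move=> /dvdzP[m ->]; have [X [g [n [h1 h2 h3 h4 h5]]]] := class_representative hS hU mU m.
exists X, g, n; split=> // a ea; apply/(has_classP hS hU mU) => //.
by rewrite h5 ea (dim_minimal_right_ideal hC dimC mU) mulnC PoszM mulrA.
Qed.
End CentralSimpleClasses.

Theorem theorem3p12 (k : fieldType) (l : fieldExtType k)
    (hsep : separable 1 {:l}) (d : nat) (hd : \dim {:l} = d)
    (L : splittingFieldType k) (hL : galois 1 {:L}) (iota : 'AHom(l, L))
    (A A' : falgType l) (hA : central_simple A) (hA' : central_simple A') :
  (exists phi : int -> HomU A A', ind_iso_K0 phi) /\
  (exists psi : int -> HomU (Rnc iota A) (Rnc iota A'), ind_iso_K0 psi) /\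
  forall (phi : int -> HomU A A')
         (psi : int -> HomU (Rnc iota A) (Rnc iota A')),
    ind_iso_K0 phi -> ind_iso_K0 psi ->
    forall n : int, (Posz (ind (optens A A')) %| n)%Z ->
      (Posz (ind (optens (Rnc iota A) (Rnc iota A'))) %| n ^+ d)%Z /\
      Rnc_hom (phi n) (psi (n ^+ d)).
Proof.
have hC := optens_csa hA hA'; have hC' := optens_Rnc_csa hL iota hA hA'.
have [hZ hS] := (central_simpleP _).1 hC.
have [delta dimC _] := ind_dims hZ hS.
have dimC' : \dim {: optens (Rnc iota A) (Rnc iota A')} = (delta ^ d * delta ^ d)%N.
  by rewrite (dim_optens_Rnc hL) dimC hd expnMn.
split; first exact: (ind_iso_exists hC dimC).
split; first exact: (ind_iso_exists hC' dimC').
move=> phi psi hphi hpsi n hn.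
have chi_phi := ind_iso_chi hC dimC hphi hn.
have powE (z : int) : z = n * delta%:Z -> z ^+ #|{: cosetT iota}| = n ^+ d * (delta ^ d)%N%:Z.
  by move=> ->; rewrite (card_cosetT hL) hd exprMn -!natz natrX.
have [X [g [m [X_comp X_dif X_hdim X_class]]]] := one_degree_representative hC dimC hn.
have [W [trW]] : exists W, inhabited (transfer (iota := iota) X W).
  apply: (@one_degree_basis l (optens A A') X g X_comp X_dif m _ X_hdim).
  exact: (@transfer_exists k l L iota A A' X g X_comp X_dif 'I_m).
(* The existence of one fixed part [W] already forces the divisibility: its Euler characteristic is
   [n ^ d * delta ^ d]. *)
have hdvd : (Posz (ind (optens (Rnc iota A) (Rnc iota A'))) %| n ^+ d)%Z.
  have [n0 [n1 [h0 h1 en]]] := class_hdim hC (X_class _ chi_phi).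
  have [m0 [m1 [k0 k1 em]]] := transfer_hdim hL trW h0 h1.
  apply: (hdim_dvd hC' dimC' k0 k1); rewrite em; apply: powE.
  by rewrite en chi_phi.
split=> //; split.
  by exists X, W; split; [exists | apply: X_class].
move=> M W' tr hM; have [n0 [n1 [h0 h1 en]]] := class_hdim hC hM.
have [m0 [m1 [k0 k1 em]]] := transfer_hdim hL tr h0 h1.
apply: (hdim_class hC' k0 k1); rewrite em (ind_iso_chi hC' dimC' hpsi hdvd).
by apply: powE; rewrite en chi_phi.
Qed.
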